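(* Let $\rho>0$ be a constant and let $f:\mathbb{R}\to\mathbb{R}$ be a smooth $2\pi$-periodic function such that $f$ is not a constant function and $f'(\phi)\neq 0$ for every $\phi\in[0,2\pi]$ with $f(\phi)=0$. Let $\varphi$ be the random dynamical system on the circle $\mathbb{R}/2\pi\mathbb{Z}$ generated by the Stratonovich stochastic differential equation $$d\phi_t=\rho\,dt+f(\phi_t)\circ dW_t \quad \text{mod } 2\pi ,$$ let $\mu$ be its unique stationary probability distribution, and let $\lambda$ be the Lyapunov exponent of its linearization, i.e. the constant value of $$\lambda=\lim_{t\to\infty}\frac1t\log|D\varphi(t,\omega,x)|$$ for $\mathbb{P}\times\mu$-almost every $(\omega,x)$. Then $\lambda<0$.
   Context: Setting. $\Omega$ is the space of continuous functions $\omega:\mathbb{R}_{\ge 0}\to\mathbb{R}$ with $\omega(0)=0$, equipped with the topology of uniform convergence on compact intervals, its Borel $\sigma$-algebra $\mathcal{F}$ and the Wiener measure $\mathbb{P}$, so that $W_t(\omega)=\omega(t)$ is a standard Brownian motion; the shifts are $\theta_t\omega(s)=\omega(t+s)-\omega(t)$. The phase space is the circle $\mathbb{R}/2\pi\mathbb{Z}$, identified with $[0,2\pi]$ with endpoints glued. The Itô form of the equation is $$d\phi_t=\Big(\rho+\tfrac12 f'(\phi_t)f(\phi_t)\Big)dt+f(\phi_t)\,dW_t .$$ $\varphi(t,\omega,x)$ denotes the solution at time $t\ge 0$ started at $x$ at time $0$; it is a smooth random dynamical system, satisfying $\varphi(t+s,\omega,x)=\varphi(t,\theta_s\omega,\varphi(s,\omega,x))$,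 and $D\varphi(t,\omega,x)$ is its derivative with respect to $x$. By Hörmander's theorem the one-point motion has a unique stationary distribution $\mu$, which has a smooth density with respect to Lebesgue measure. The skew product $\Theta_t(\omega,x)=(\theta_t\omega,\varphi(t,\omega,x))$ is ergodic and preserves $\mathbb{P}\times\mu$, so that the limit defining $\lambda$ exists and is constant $\mathbb{P}\times\mu$-almost everywhere. *)

(* Defs.v *)
From HB Require Import structures.
From mathcomp Require Import all_boot all_order all_algebra.
From mathcomp Require Import all_classical all_reals all_analysis.

Set Implicit Arguments.
Unset Strict Implicit.
Unset Printing Implicit Defensive.

Import Order.TTheory GRing.Theory Num.Theory.
Import numFieldNormedType.Exports.

Local Open Scope ring_scope.
Local Open Scope classical_set_scope.

(* A continuous path on [0, +oo[ starting at 0 is encoded by its extension by 0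
   to the negative half-line.  The extension is unique and continuous, and
   uniform convergence on the compact subsets of R amounts to uniform
   convergence on the compact intervals of [0, +oo[. *)
Definition is_path (R : realType) : set {family compact, R -> R} :=
  [set w | continuous (w : R -> R) /\ forall t : R, t <= 0 -> w t = 0].

Definition path_space (R : realType) := set_type (@is_path R).

HB.instance Definition _ (R : realType) := Topological.on (path_space R).

Lemma zero_is_path (R : realType) : (fun=> 0 : R) \in @is_path R.
Proof. by rewrite inE; split => // x; exact: cst_continuous. Qed.

HB.instance Definition _ (R : realType) :=
  isPointed.Build (path_space R)
    (exist (fun w => w \in @is_path R) _ (zero_is_path R)).

Definition wiener_space (R : realType) :=
  g_sigma_algebraType (@open (path_space R)).

HB.instance Definition _ (R : realType) := Measurable.on (wiener_space R).

Definition bm (R : realType) (t : R) (w : wiener_space R) : R :=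
  (set_val w : R -> R) t.

Lemma shift_is_path (R : realType) (s : R) (w : wiener_space R) :
  (fun u => bm (s + Num.max 0 u) w - bm s w) \in @is_path R.
Proof.
have [cw _] : is_path (set_val w) by apply: set_mem; exact: (valP w).
rewrite inE; split=> [u|u u0]; last by rewrite (max_idPl u0) addr0 subrr.
apply: cvgB; last exact: cvg_cst.
have cu : {for u, continuous (fun v : R => s + Num.max 0 v)}.
  apply: cvgD; first exact: cvg_cst.
  by apply: continuous_max; [exact: cvg_cst|exact: cvg_id].
exact: (continuous_comp cu (cw _)).
Qed.

(* theta_s w (u) = w (s + u) - w s for u >= 0 *)
Definition shift (R : realType) (s : R) (w : wiener_space R) : wiener_space R :=
  exist (fun w' => w' \in @is_path R) _ (shift_is_path s w).

(* The increments over consecutive intervals are independent, the one over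
   [s, t] having law N(0, t - s); [normal_prob] takes the standard deviation. *)
Definition wiener_measure (R : realType) (P : probability (wiener_space R) R) :=
  forall (n : nat) (t : nat -> R) (B : nat -> set (measurableTypeR R)),
    0 <= t 0 -> (forall i, t i < t i.+1) -> (forall i, measurable (B i)) ->
    P [set w | forall i, (i < n)%N -> B i (bm (t i.+1) w - bm (t i) w)] =
    (\prod_(i < n) normal_prob 0 (Num.sqrt (t i.+1 - t i)) (B i))%E.

Section stochastic_calculus.
Variables (R : realType) (P : probability (wiener_space R) R).
Implicit Types (X H : R -> wiener_space R -> R) (I : wiener_space R -> R).

(* sigma(W_s, s <= t), augmented by the null sets *)
Definition brownian_filtration (t : R) : set (set (wiener_space R)) :=
  <<s [set A | (exists s (B : set (measurableTypeR R)),
                  [/\ 0 <= s <= t, measurable B & A = bm s @^-1` B])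
               \/ P.-negligible A] >>.

Definition adapted X := forall (t : R) (B : set (measurableTypeR R)),
  0 <= t -> measurable B -> brownian_filtration t (X t @^-1` B).

Definition continuous_paths X :=
  forall w, {within [set t | 0 <= t], continuous (X ^~ w)}.

(* The subdivision 0 < s_0 < ... < s_(n-1) = t of [0, t] is given by the list s;
   its i-th interval is [(0 :: s)`_i, s`_i]. *)
Definition lim_in_probability (t : R) (S : seq R -> wiener_space R -> R) I :=
  forall e k : R, 0 < e -> 0 < k -> exists2 d : R, 0 < d &
    forall s : seq R, itv_partition 0 t s ->
      (forall i, (i < size s)%N -> s`_i - (0 :: s)`_i < d) ->
      (P [set w | e <= `|S s w - I w|]%R <= k%:E)%E.

(* I is the Ito integral of H dW over [0, t]. For a continuous adapted
   integrand it is the limit in probability of the left-point sums. *)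
Definition ito_integral H (t : R) I :=
  lim_in_probability t (fun s w => \sum_(i < size s)
    H (0 :: s)`_i w * (bm s`_i w - bm (0 :: s)`_i w)) I.

(* I is the Stratonovich integral of H o dW over [0, t]. *)
Definition stratonovich_integral H (t : R) I :=
  lim_in_probability t (fun s w => \sum_(i < size s)
    (H (0 :: s)`_i w + H s`_i w) / 2 * (bm s`_i w - bm (0 :: s)`_i w)) I.

(* X solves dX = rho dt + f(X) o dW, X_0 = x.  A Stratonovich equation is an
   equation between semimartingales, which symmetric sums alone do not enforce:
   the Ito form of the equation, imposed along with it, does. *)
Record stratonovich_solution (rho : R) (f : R -> R) (x : R) X : Prop := {
  solution_adapted : adapted X ;
  solution_continuous : continuous_paths X ;
  solution_initial : forall w, X 0 w = x ;
  solution_stratonovich : forall t, 0 <= t ->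
    stratonovich_integral (fun s w => f (X s w)) t
      (fun w => X t w - x - rho * t) ;
  solution_ito : forall t, 0 <= t ->
    ito_integral (fun s w => f (X s w)) t
      (fun w => X t w - x -
        \int[lebesgue_measure]_(s in `[0, t])
          (rho + 2^-1 * derive1 f (X s w) * f (X s w))) }.

End stochastic_calculus.

Section random_dynamical_systems.
Variable R : realType.
Implicit Type phi : R -> wiener_space R -> R -> R.

(* Smooth random dynamical system on the circle R/2piZ over the shift, given
   by its lift to R: a point of the circle is a real number up to 2pi. *)
Record smooth_circle_rds phi : Prop := {
  rds_degree1 : forall t w x, 0 <= t ->
    phi t w (x + 2 * pi) = phi t w x + 2 * pi ;
  rds_measurable : measurable_fun
    ([set z | 0 <= z.1.1] :
      set (measurableTypeR R * wiener_space R * measurableTypeR R))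
    ((fun z => phi z.1.1 z.1.2 z.2) :
      measurableTypeR R * wiener_space R * measurableTypeR R ->
      measurableTypeR R) ;
  rds_id : forall w x, phi 0 w x = x ;
  rds_cocycle : forall s t w x, 0 <= s -> 0 <= t ->
    phi (t + s) w x = phi t (shift s w) (phi s w x) ;
  rds_derivable : forall k t w x, 0 <= t -> derivable ((phi t w)^`(k)) x 1 ;
  rds_continuous : forall k w, {within [set z : R * R | 0 <= z.1],
    continuous (fun z : R * R => (phi z.1 w)^`(k) z.2)} }.

Definition circle_mod (x : R) : R :=
  x - 2 * pi * (Num.floor (x / (2 * pi)))%:~R.

(* Probability measures on the circle are identified with the probability
   measures on R that are concentrated on the fundamental domain [0, 2pi[. *)
Definition stationary_distribution (P : probability (wiener_space R) R) phi
    (mu : probability (measurableTypeR R) R) :=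
  mu `[0, 2 * pi[ = 1%E /\
  forall (t : R) (A : set (measurableTypeR R)), 0 <= t -> measurable A ->
    (\int[mu]_x P [set w | A (circle_mod (phi t w x))])%E = mu A.

Definition lyapunov_exponent (P : probability (wiener_space R) R) phi
    (mu : probability (measurableTypeR R) R) (lambda : R) :=
  {ae (P \x mu)%E, forall z,
    (fun t : R => t^-1 * ln `|(phi t z.1)^`() z.2|) @ +oo --> lambda}.

End random_dynamical_systems.

(* Main.v *)
(* Write L for the generator of the one-point motion.  If there are a periodic g
   and c > 0 with f f''/2 + L g <= -c, then, for small s > 0, the function
   (1 + 2 s g(x)) |v|^(2 s) decreases exponentially in mean along the
   linearized flow, whence lambda < 0.

   The corrector g is obtained by perturbing the motion with an independent
   noise of size k: the Poisson equation then has an explicit solution H = g'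
   through a Riccati substitution, whose mean over a period is positive and
   bounded below uniformly in k because f is not constant; a multiple of a
   uniformly expanding field corrects that mean to 0, and k is taken small.

   The linearized flow enters only through the two-point motion: the decay is
   proved for (eta + sin^2(z/2))^s with z the distance of the solutions started
   at x and x + e, and e -> 0 by Fatou's lemma.  Ito's formula is
   replaced by a one-step Taylor estimate with an error of order h^(3/2), and
   Gronwall's lemma. *)

(* Along the linearized flow [log |v|] has Ito drift [f f''/2], and [|v|^(2 s) (1 + 2 s g)] has
   drift [2 s (f f''/2 + L g) |v|^(2 s)] up to a term of order [s^2]: this is what singles out the
   corrector inequality.

   The Poisson equation for [g] is singular where [f] vanishes. The extra noise replaces [f^2] by
   [a = f^2 + k^2] and gives a regular linear equation for [H]. With [N = rho + f f'/2 + a H/2 > 0]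
   one finds [H + (ln N)' = (2 (N - rho)^2 + k^2 f'^2/2) / (a N)], and since [ln N] is periodic this
   square is the source of the positive mean. Going back to [f^2] costs [k^2 H'/2], which is of
   order [k] by a barrier argument.

   The hypotheses provide stochastic equations for the solutions but none for their derivative in
   the starting point, hence the detour through two points. The parameter [eta] keeps the power of
   the distance smooth where the two solutions meet; it disappears in the limit because it is taken
   equal to the cube of the initial distance. *)
Require Import Defs.
From mathcomp Require Import all_boot all_order all_algebra.
From mathcomp Require Import all_classical all_reals all_analysis measurable_realfun.
From mathcomp Require Import ring lra.

Set Implicit Arguments.
Unset Strict Implicit.
Unset Printing Implicit Defensive.

Import Order.TTheory GRing.Theory Num.Theory.
Import numFieldNormedType.Exports.

Local Open Scope ring_scope.
Local Open Scope classical_set_scope.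

(** * Derivatives and smoothness *)

Section calculus.
Variable R : realType.
Implicit Types f g : R -> R.

(** With the derivative given as an explicit function, closed forms are composed by the rules below
    and then normalized through [derivative_eq]. *)
Definition derivative f f' := forall x : R, is_derive x 1 f (f' x).

Lemma derivative_continuous f f' : derivative f f' -> continuous f.
Proof.
by move=> df x; apply: differentiable_continuous; apply/derivable1_diffP; case: (df x).
Qed.

Lemma derivative_unique f f' g' : derivative f f' -> derivative f g' -> f' = g'.
Proof.
by move=> df dg; apply/funext => x; have [_ <-] := df x; have [_ <-] := dg x.
Qed.

Lemma derivative_eq f f' g' : derivative f f' -> f' =1 g' -> derivative f g'.
Proof. by move=> df e x; rewrite -e; exact: df. Qed.

Lemma derivative_cst c : derivative (fun=> c) (fun=> 0).
Proof. by move=> x; exact: is_derive_cst. Qed.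

Lemma derivative_id : derivative (fun x => x) (fun=> 1).
Proof. by move=> x; exact: is_derive_id. Qed.

Lemma derivativeD f f' g g' : derivative f f' -> derivative g g' ->
  derivative (fun x => f x + g x) (fun x => f' x + g' x).
Proof. by move=> df dg x; have := is_deriveD (df x) (dg x). Qed.

Lemma derivativeN f f' : derivative f f' ->
  derivative (fun x => - f x) (fun x => - f' x).
Proof. by move=> df x; have := is_deriveN (df x). Qed.

Lemma derivativeB f f' g g' : derivative f f' -> derivative g g' ->
  derivative (fun x => f x - g x) (fun x => f' x - g' x).
Proof. by move=> df dg; apply: derivativeD => //; exact: derivativeN. Qed.

Lemma derivativeM f f' g g' : derivative f f' -> derivative g g' ->
  derivative (fun x => f x * g x) (fun x => f' x * g x + f x * g' x).
Proof.
move=> df dg x; have := is_deriveM (df x) (dg x).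
by move/is_derive_eq; apply; rewrite /GRing.scale/=; ring.
Qed.

Lemma derivativeZ c f f' : derivative f f' ->
  derivative (fun x => c * f x) (fun x => c * f' x).
Proof.
move=> df; apply: derivative_eq (derivativeM (derivative_cst c) df) _ => x.
by rewrite mul0r add0r.
Qed.

Lemma derivative_sqr f f' : derivative f f' ->
  derivative (fun x => f x ^+ 2) (fun x => 2 * f x * f' x).
Proof.
move=> df; have -> : (fun x => f x ^+ 2) = (fun x => f x * f x).
  by apply/funext => x; rewrite expr2.
by apply: derivative_eq (derivativeM df df) _ => x; ring.
Qed.

Lemma is_derive_compose f g (a b x : R) : is_derive (g x) 1 f a ->
  is_derive x 1 g b -> is_derive x 1 (fun y => f (g y)) (a * b).
Proof.
by move=> df dg; have := is_derive1_comp df dg.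
Qed.

Lemma derivative_comp f f' g g' : derivative f f' -> derivative g g' ->
  derivative (fun x => f (g x)) (fun x => f' (g x) * g' x).
Proof. by move=> df dg x; exact: is_derive_compose. Qed.

Lemma derivative_expR g g' : derivative g g' ->
  derivative (fun x => expR (g x)) (fun x => g' x * expR (g x)).
Proof.
move=> dg; have dexp : derivative expR expR by move=> x; exact: is_derive_expR.
by apply: derivative_eq (derivative_comp dexp dg) _ => x; rewrite mulrC.
Qed.

Lemma derivative_ln g g' : derivative g g' -> (forall x, 0 < g x) ->
  derivative (fun x => ln (g x)) (fun x => g' x / g x).
Proof.
move=> dg g0 x; rewrite mulrC; apply: is_derive_compose => //.
exact: is_derive1_ln.
Qed.

Lemma derivative_inv g g' : derivative g g' -> (forall x, g x != 0) ->
  derivative (fun x => (g x)^-1) (fun x => - g' x * (g x)^-1 ^+ 2).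
Proof.
move=> dg g0 x; have := is_deriveV (g0 x) (dg x).
by move/is_derive_eq; apply; rewrite /GRing.scale/= exprVn mulNr mulrC -mulNr mulrC.
Qed.

Lemma derivative_shift c f f' : derivative f f' ->
  derivative (fun x => f (x + c)) (fun x => f' (x + c)).
Proof.
move=> df; have dc := derivativeD derivative_id (derivative_cst c).
by apply: derivative_eq (derivative_comp df dc) _ => x; rewrite addr0 mulr1.
Qed.

(** The intermediate point is located by its distance to [x], which covers both orders of [x] and
    [y]; the Taylor bounds then need no case distinction on the sign of the increment. *)
Lemma mean_value f f' x y : derivative f f' -> exists2 z,
  `|z - x| <= `|y - x| & f y - f x = f' z * (y - x).
Proof.
move=> df; have cf := derivative_continuous df.
have [xy|yx] := leP x y.
  have [z] := MVT_segment xy (fun z _ => df z) (continuous_subspaceT cf).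
  rewrite in_itv/= => /andP[xz zy] e; exists z => //.
  by rewrite !ger0_norm ?subr_ge0 ?lerD2r//.
have [z] := MVT_segment (ltW yx) (fun z _ => df z) (continuous_subspaceT cf).
rewrite in_itv/= => /andP[yz zx] e; exists z.
  by rewrite ![`|_ - x|]distrC !ger0_norm ?subr_ge0 ?lerD2l ?lerN2// ltW.
by rewrite -[LHS]opprB e -mulrN opprB.
Qed.

Lemma mean_value_bound f f' M x y : derivative f f' ->
  (forall z, `|z - x| <= `|y - x| -> `|f' z| <= M) ->
  `|f y - f x| <= M * `|y - x|.
Proof.
move=> df bf; have [z zx ->] := mean_value x y df.
by rewrite normrM ler_wpM2r// bf.
Qed.

Lemma derivative_nondecreasing f f' : derivative f f' ->
  (forall x, 0 <= f' x) -> {homo f : x y / x <= y}.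
Proof.
move=> df f0 x y xy; have [z _] := mean_value x y df.
by rewrite -subr_ge0 => ->; rewrite mulr_ge0// subr_ge0.
Qed.

Lemma derivative0_cst f : derivative f (fun=> 0) -> forall x y, f x = f y.
Proof.
move=> df x y; apply/eqP; rewrite -subr_eq0 -normr_le0.
by have := @mean_value_bound f _ 0 y x df; rewrite mul0r; apply => *; rewrite normr0.
Qed.

(** The mean value inequality is applied to the error as a function of the endpoint. This loses the
    factor 1/2 of Taylor's formula, and [taylor2] likewise the factor 1/6; constants do not matter
    later. *)
Lemma taylor1 f f1 f2 M x d : derivative f f1 -> derivative f1 f2 ->
  (forall z, `|z - x| <= `|d| -> `|f2 z| <= M) ->
  `|f (x + d) - f x - f1 x * d| <= M * `|d| ^+ 2.
Proof.
move=> df df1 bf; pose g u := f u - f x - f1 x * (u - x).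
have dg : derivative g (fun u => f1 u - f1 x).
  have := derivativeB (derivativeB df (derivative_cst (f x)))
    (derivativeZ (f1 x) (derivativeB derivative_id (derivative_cst x))).
  by move/derivative_eq; apply => u; ring.
have := @mean_value_bound g _ (M * `|d|) x (x + d) dg.
rewrite /g [x + d - x]addrAC !subrr add0r mulr0 !subr0 expr2 mulrA; apply => z zd.
apply: le_trans (@mean_value_bound f1 f2 M x z df1 _) _.
  by move=> v vz; apply: bf; exact: le_trans zd.
by apply: ler_wpM2l => //; apply: le_trans (bf x _); rewrite // subrr normr0.
Qed.

Lemma taylor2 f f1 f2 f3 M x d :
  derivative f f1 -> derivative f1 f2 -> derivative f2 f3 ->
  (forall z, `|z - x| <= `|d| -> `|f3 z| <= M) ->
  `|f (x + d) - f x - f1 x * d - f2 x * d ^+ 2 / 2| <= M * `|d| ^+ 3.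
Proof.
move=> df df1 df2 bf.
pose g u := f u - f x - f1 x * (u - x) - f2 x / 2 * (u - x) ^+ 2.
have dx := derivativeB derivative_id (derivative_cst x).
have dg : derivative g (fun u => f1 u - f1 x - f2 x * (u - x)).
  have := derivativeB (derivativeB (derivativeB df (derivative_cst (f x)))
    (derivativeZ (f1 x) dx)) (derivativeZ (f2 x / 2) (derivative_sqr dx)).
  by move/derivative_eq; apply => u; field.
have M0 : 0 <= M by apply: le_trans (bf x _); rewrite // subrr normr0.
have := @mean_value_bound g _ (M * `|d| ^+ 2) x (x + d) dg.
rewrite /g [x + d - x]addrAC !subrr add0r mulr0 !subr0 expr0n/= mulr0 subr0.
have -> : M * `|d| ^+ 2 * `|d| = M * `|d| ^+ 3 by ring.
rewrite mulrAC subr0; apply => z zd.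
have := @taylor1 f1 f2 f3 M x (z - x) df1 df2.
rewrite [x + _]addrC subrK => H; apply: le_trans (H _) _.
  by move=> v vz; apply: bf; exact: le_trans zd.
by rewrite ler_wpM2l// lerXn2r ?nnegrE.
Qed.

(** The class C^n, with the derivatives as existential witnesses: closure under an operation follows
    by induction on [n] from the corresponding rule for [derivative]. *)
Fixpoint smooth (n : nat) f : Prop :=
  if n is m.+1 then exists2 f', derivative f f' & smooth m f' else continuous f.

Lemma smooth_continuous n f : smooth n f -> continuous f.
Proof. by case: n => [//|n] [f' df _]; exact: derivative_continuous df. Qed.

Lemma smoothS n f : smooth n.+1 f -> smooth n f.
Proof.
elim: n f => [|n IHn] f; first exact: smooth_continuous.
by case=> f' df sf; exists f' => //; exact: IHn.
Qed.

Lemma smooth_le m n f : (m <= n)%N -> smooth n f -> smooth m f.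
Proof.
move=> /subnKC <-; elim: (n - m)%N f => [|k IHk] f; first by rewrite addn0.
by rewrite addnS => /smoothS; exact: IHk.
Qed.

Lemma smooth_cst n c : smooth n (fun=> c).
Proof.
elim: n c => [|n IHn] c /=; first by move=> x; exact: cvg_cst.
by exists (fun=> 0); [exact: derivative_cst|exact: IHn].
Qed.

Lemma smoothD n f g : smooth n f -> smooth n g -> smooth n (fun x => f x + g x).
Proof.
elim: n f g => [|n IHn] f g /=; first by move=> cf cg x; apply: cvgD; [exact: cf|exact: cg].
move=> [f' df sf] [g' dg sg]; exists (fun x => f' x + g' x).
  exact: derivativeD.
exact: IHn.
Qed.

Lemma smoothM n f g : smooth n f -> smooth n g -> smooth n (fun x => f x * g x).
Proof.
elim: n f g => [|n IHn] f g.
  by move=> /= cf cg x; apply: cvgM; [exact: cf|exact: cg].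
move=> sf sg; have [[f' df sf'] [g' dg sg']] := (sf, sg).
exists (fun x => f' x * g x + f x * g' x); first exact: derivativeM.
by apply: smoothD; apply: IHn => //; exact: smoothS.
Qed.

Lemma smoothN n f : smooth n f -> smooth n (fun x => - f x).
Proof.
move=> sf; have := smoothM (smooth_cst n (-1)) sf.
by congr smooth; apply/funext => x; rewrite mulN1r.
Qed.

Lemma smoothB n f g : smooth n f -> smooth n g -> smooth n (fun x => f x - g x).
Proof. by move=> sf sg; apply: smoothD => //; exact: smoothN. Qed.

Lemma smoothX n k f : smooth n f -> smooth n (fun x => f x ^+ k).
Proof.
move=> sf; elim: k => [|k IHk]; first exact: smooth_cst.
have := smoothM sf IHk.
by congr smooth; apply/funext => x; rewrite exprS.
Qed.

Lemma smooth_expR n f : smooth n f -> smooth n (fun x => expR (f x)).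
Proof.
elim: n f => [|n IHn] f.
  by move=> /= cf x; apply: continuous_comp; [exact: cf|exact: continuous_expR].
move=> sf; have [f' df sf'] := sf; exists (fun x => f' x * expR (f x)).
  exact: derivative_expR.
by apply: smoothM => //; apply: IHn; exact: smoothS.
Qed.

Lemma smooth_inv n f : smooth n f -> (forall x, f x != 0) ->
  smooth n (fun x => (f x)^-1).
Proof.
elim: n f => [|n IHn] f.
  by move=> /= cf f0 x; apply: cvgV; [exact: f0|exact: cf].
move=> sf f0; have [f' df sf'] := sf; exists (fun x => - f' x * (f x)^-1 ^+ 2).
  exact: derivative_inv.
by apply: smoothM; [exact: smoothN|apply: smoothX; apply: IHn => //; exact: smoothS].
Qed.

Lemma smooth_ln n f : smooth n f -> (forall x, 0 < f x) ->
  smooth n (fun x => ln (f x)).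
Proof.
case: n => [|n].
  move=> /= cf f0 x; apply: (continuous_comp (cf x)).
  by apply: continuous_ln; exact: f0.
move=> sf f0; have [f' df sf'] := sf; exists (fun x => f' x / f x).
  exact: derivative_ln.
apply: smoothM => //; apply: smooth_inv; first exact: smoothS.
by move=> x; rewrite gt_eqF.
Qed.

Lemma smooth_derivative n f f' : derivative f f' -> smooth n.+1 f -> smooth n f'.
Proof. by move=> df [g dg sg]; rewrite (derivative_unique df dg). Qed.

Lemma derivative_smooth n f f' : derivative f f' -> smooth n f' -> smooth n.+1 f.
Proof. by move=> df sf; exists f'. Qed.

End calculus.

(** * The corrector *)

Section periodic.
Variables (R : realType) (T : R).
Hypothesis T0 : 0 < T.
Implicit Types u v : R -> R.

Definition periodic u := forall x, u (x + T) = u x.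

Lemma periodic_natmul u n x : periodic u -> u (x + n%:R * T) = u x.
Proof.
move=> pu; elim: n => [|n IHn]; first by rewrite mul0r addr0.
by rewrite -natr1 mulrDl mul1r addrA pu.
Qed.

Lemma periodic_intmul u (k : int) x : periodic u -> u (x + k%:~R * T) = u x.
Proof.
move=> pu; case: k => n; first exact: periodic_natmul.
rewrite NegzE -(@periodic_natmul u n.+1 (x + _))//; congr u.
by rewrite mulrNz mulNr subrK.
Qed.

Lemma reduce_period x : exists k : int, 0 <= x + k%:~R * T <= T.
Proof.
exists (- Num.floor (x / T)); rewrite mulrNz mulNr.
have := floor_le (x / T); have := floorD1_gt (x / T).
rewrite intrD -ltrBlDr ler_pdivlMr// => h1 h2; rewrite subr_ge0 h2/=.
rewrite lerBlDr; move: h1; rewrite ltrBlDr ltr_pdivrMr// mulrDl mul1r addrC => /ltW.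
by [].
Qed.

Lemma periodic_max u : continuous u -> periodic u -> exists c, forall x, u x <= u c.
Proof.
move=> cu pu; have [c _ H] := EVT_max (ltW T0) (continuous_subspaceT cu).
exists c => x; have [k kP] := reduce_period x.
by rewrite -(periodic_intmul k x pu); apply: H; rewrite in_itv.
Qed.

Lemma periodic_bounded u : continuous u -> periodic u -> exists M, forall x, `|u x| <= M.
Proof.
move=> cu pu; have [|x|c H] := @periodic_max (fun x => `|u x|).
- by move=> x; apply: continuous_comp; [exact: cu|exact: norm_continuous].
- by rewrite pu.
- by exists `|u c|.
Qed.

Lemma derivative_at_max u u' c : derivative u u' -> (forall x, u x <= u c) -> u' c = 0.
Proof.
move=> du H.
have d0 : is_derive c 1 u 0.
  apply: (@derive1_at_max _ u (c - 1) (c + 1)) => //.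
  - by lra.
  - by move=> t _; have [] := du t.
  - by rewrite in_itv/= ltrBlDr !ltrDl ltr01.
have [_ <-] := du c; by have [_ ->] := d0.
Qed.

Lemma derivative_periodic u u' : derivative u u' -> periodic u -> periodic u'.
Proof.
move=> du pu x; have := derivative_unique (derivative_shift T du) (_ : derivative _ u').
rewrite (_ : (fun x => u (x + T)) = u); last exact/funext.
by move=> /(_ du) /(congr1 (@^~ x)).
Qed.

Lemma periodic_of_derivative u u' : derivative u u' -> periodic u' -> u T = u 0 -> periodic u.
Proof.
move=> du pu' e x; have d0 : derivative (fun x => u (x + T) - u x) (fun=> 0).
  apply: derivative_eq (derivativeB (derivative_shift T du) du) _ => y.
  by rewrite pu' subrr.
have := derivative0_cst d0 x 0; rewrite add0r e subrr => /eqP.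
by rewrite subr_eq0 => /eqP.
Qed.

(** At a point [c] where the periodic function [u] is minimal its derivative vanishes, so
    [m c * u c = r c] and the minimum has the sign of [r c]. *)
Lemma comparison u r m : derivative u (fun x => r x - m x * u x) -> periodic u ->
  (forall x, 0 < m x) -> (forall x, 0 <= r x) -> forall x, 0 <= u x.
Proof.
move=> du pu m0 r0.
have cu := derivative_continuous du.
have [|x|c H] := @periodic_max (fun x => - u x).
- by move=> x; apply: continuousN; exact: cu.
- by rewrite pu.
have /eqP := derivative_at_max (derivativeN du) H.
rewrite oppr_eq0 subr_eq0 => /eqP rc x.
apply: (@le_trans _ _ (u c)); last by rewrite -lerN2.
by rewrite -(pmulr_rge0 _ (m0 c)) -rc.
Qed.

Lemma strict_comparison u r m : derivative u (fun x => r x - m x * u x) -> periodic u ->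
  (forall x, 0 < m x) -> (forall x, 0 < r x) -> forall x, 0 < u x.
Proof.
move=> du pu m0 r0.
have cu := derivative_continuous du.
have [|x|c H] := @periodic_max (fun x => - u x).
- by move=> x; apply: continuousN; exact: cu.
- by rewrite pu.
have /eqP := derivative_at_max (derivativeN du) H.
rewrite oppr_eq0 subr_eq0 => /eqP rc x.
apply: (@lt_le_trans _ _ (u c)); last by rewrite -lerN2.
by rewrite -(pmulr_rgt0 _ (m0 c)) -rc.
Qed.

Local Notation leb := (@lebesgue_measure R).

(** With base point -oo a single integral is defined for every upper bound; the vanishing of [u] on
    the negative axis makes it converge. *)
Let one_sided_primitive u : continuous u -> (forall x, x <= 0 -> u x = 0) ->
  derivative (fun x => \int[leb]_(t in `]-oo, x]) u t) u.
Proof.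
move=> cu u0 x.
have [|||d1 d2] := @continuous_FTC1 R u -oo%O x (x + 1) _ _ _ (cu x).
- by rewrite ltrDl.
- apply/integrable_mkcond; first exact: measurable_itv.
  have [x1|x1] := leP (x + 1) 0.
    rewrite (_ : _ \_ _ = fun=> 0%E); first exact: integrable0.
    apply/funext => t; rewrite patchE; case: ifPn => //; rewrite inE/= in_itv/= => tx.
    by rewrite u0// (le_trans tx).
  have i : leb.-integrable `[0, x + 1] (EFin \o u).
    apply: continuous_compact_integrable; first exact: segment_compact.
    exact: continuous_subspaceT.
  move/integrable_mkcond : i => /(_ (measurable_itv _)).
  congr (integrable _ _ _); apply/funext => t; rewrite !patchE.
  case: ifPn; rewrite ?inE ?notin_setE/= !in_itv/=.
    by move=> /andP[t0 tx]; rewrite ifT// inE/= in_itv.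
  move=> /negP; rewrite negb_and -!ltNge => /orP[t0|tx].
    by case: ifP => // _; rewrite u0// ltW.
  by rewrite ifF//; apply/negbTE; rewrite notin_setE/= in_itv/= leNgt tx.
- by rewrite ltNyr.
by apply: DeriveDef; [exact: d1|rewrite -derive1E; exact: d2].
Qed.

(** The cutoff [chi] splits [u] into a part that vanishes to the left of 0 and a part that vanishes
    to the right of 1. The reflection about 1/2 brings the second part into the first situation. *)
Lemma exists_primitive u : continuous u -> exists U, derivative U u.
Proof.
move=> cu.
pose chi (x : R) := Num.min 1 (Num.max 0 x).
have cchi : continuous chi.
  move=> x; apply: continuous_min; first exact: cvg_cst.
  by apply: continuous_max; [exact: cvg_cst|exact: cvg_id].
pose u1 x := chi x * u x; pose u2 x := (1 - chi (- x)) * u (- x).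
have cu1 : continuous u1.
  by move=> x; apply: cvgM; [exact: cchi|exact: cu].
have cu2 : continuous u2.
  move=> x; apply: cvgM.
    apply: cvgB; first exact: cvg_cst.
    apply: (continuous_comp (f := -%R)); [exact: opp_continuous|exact: cchi].
  apply: (continuous_comp (f := -%R)); [exact: opp_continuous|exact: cu].
have v1 x : x <= 0 -> u1 x = 0.
  by move=> x0; rewrite /u1 /chi (max_idPl x0) (min_idPr _)// mul0r.
have v2 x : x <= -1 -> u2 x = 0.
  move=> x1; rewrite /u2 /chi (max_idPr _) ?oppr_ge0 ?(le_trans x1)//.
  by rewrite (min_idPl _) ?subrr ?mul0r// lerNr.
pose u3 x := u2 (x - 1).
have cu3 : continuous u3.
  move=> x; apply: (continuous_comp (f := fun y : R => y - 1)); last exact: cu2.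
  by apply: cvgB; [exact: cvg_id|exact: cvg_cst].
have v3 x : x <= 0 -> u3 x = 0 by move=> x0; apply: v2; lra.
have [U1 d1] : exists U, derivative U u1.
  by eexists; exact: one_sided_primitive cu1 v1.
have [U3 d3] : exists U, derivative U u3.
  by eexists; exact: one_sided_primitive cu3 v3.
have dlin : derivative (fun x : R => 1 - x) (fun=> - 1).
  apply: derivative_eq (derivativeB (derivative_cst 1) (@derivative_id R)) _ => x.
  by rewrite sub0r.
exists (fun x => U1 x - U3 (1 - x)).
apply: derivative_eq (derivativeB d1 (derivative_comp d3 dlin)) _ => x.
rewrite mulrN1 opprK /u1 /u3 /u2 (_ : 1 - x - 1 = - x); last by ring.
by rewrite !opprK; ring.
Qed.

(** Variation of constants leaves one constant [c] free, fixed by [u T = u 0]. This can be solved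
    because [m > 0] makes the homogeneous solution [expR (- A)] take different values at 0 and
    [T]. *)
Lemma periodic_linear_ode (r m : R -> R) : continuous r -> continuous m ->
  periodic r -> periodic m -> (forall x, 0 < m x) ->
  exists2 u, periodic u & derivative u (fun x => r x - m x * u x).
Proof.
move=> cr cm pr pm m0.
have [A dA] := exists_primitive cm.
have cA := derivative_continuous dA.
have [|U dU] := @exists_primitive (fun x => expR (A x) * r x).
  move=> x; apply: cvgM; last exact: cr.
  by apply: continuous_comp; [exact: cA|exact: continuous_expR].
have AT : A 0 < A T.
  have [z _ e] := mean_value 0 T dA.
  by rewrite -subr_gt0 e subr0 mulr_gt0.
have e0 : expR (- A 0) - expR (- A T) != 0.
  by rewrite subr_eq0 gt_eqF// ltr_expR ltrN2.
pose c := (expR (- A T) * U T - expR (- A 0) * U 0) / (expR (- A 0) - expR (- A T)).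
pose u x := expR (- A x) * (c + U x).
have du : derivative u (fun x => r x - m x * u x).
  have := derivativeM (derivative_expR (derivativeN dA)) (derivativeD (derivative_cst c) dU).
  move/derivative_eq; apply => x; rewrite add0r /u mulrA -expRD addNr expR0 mul1r.
  by rewrite mulNr mulNr mulrA addrC.
exists u => //.
have uT : u T = u 0.
  apply/eqP; rewrite -subr_eq0 /u !mulrDr; apply/eqP.
  have : c * (expR (- A 0) - expR (- A T)) = expR (- A T) * U T - expR (- A 0) * U 0.
    by rewrite /c divfK.
  by lra.
(* The difference [u (y + T) - u y] solves the homogeneous equation and vanishes at 0, hence
   everywhere. *)
move=> x; pose v y := expR (A y) * (u (y + T) - u y).
have dv : derivative v (fun=> 0).
  have du2 : derivative (fun y => u (y + T) - u y) (fun y => - m y * (u (y + T) - u y)).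
    apply: derivative_eq (derivativeB (derivative_shift T du) du) _ => y.
    by rewrite pr pm; ring.
  apply: derivative_eq (derivativeM (derivative_expR dA) du2) _ => y; ring.
have := derivative0_cst dv x 0; rewrite /v add0r uT subrr mulr0 => /eqP.
by rewrite mulf_eq0 expR_eq0/= subr_eq0 => /eqP.
Qed.

Lemma smooth_linear_ode (u r m : R -> R) n : smooth n r -> smooth n m ->
  derivative u (fun x => r x - m x * u x) -> smooth n.+1 u.
Proof.
move=> sr sm du; have H k : (k <= n)%N -> smooth k.+1 u.
  elim: k => [_|k IHk kn].
    apply: (derivative_smooth du); apply: smoothB; first exact: smooth_continuous sr.
    by apply: smoothM; [exact: smooth_continuous sm|exact: derivative_continuous du].
  apply: (derivative_smooth du); apply: smoothB; first exact: smooth_le sr.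
  by apply: smoothM; [exact: smooth_le sm|exact: IHk (ltnW kn)].
exact: H.
Qed.

End periodic.

(** * The regularized Poisson equation *)

Section regularized.
Variables (R : realType) (T rho C : R) (f f1 f2 f3 : R -> R).
Hypotheses (T0 : 0 < T) (rho0 : 0 < rho) (C1 : 1 <= C).
Hypotheses (df : derivative f f1) (df1 : derivative f1 f2).
Hypotheses (sf : forall n, smooth n f).
Hypotheses (pf : periodic T f).
Hypotheses (fC : forall x, `|f x| <= C) (f1C : forall x, `|f1 x| <= C)
  (f2C : forall x, `|f2 x| <= C).

Let C0 : 0 <= C. Proof. exact: le_trans C1. Qed.
Let pf1 : periodic T f1. Proof. exact: derivative_periodic df pf. Qed.
Let pf2 : periodic T f2. Proof. exact: derivative_periodic df1 pf1. Qed.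
Let sf1 n : smooth n f1. Proof. exact: (smooth_derivative df (sf n.+1)). Qed.
Let sf2 n : smooth n f2. Proof. exact: (smooth_derivative df1 (sf1 n.+1)). Qed.

Section amplitude.
Variable k : R.
Hypothesis k0 : 0 < k.

(** The squared diffusion coefficient once an independent noise of size [k] is added. Its root
    [amplitude] is written with [expR] and [ln] so that the closure rules for [derivative] and
    [smooth] apply. *)
Definition amplitude_sqr x := f x ^+ 2 + k ^+ 2.
Definition amplitude x := expR (ln (amplitude_sqr x) / 2).
Local Notation a := amplitude_sqr.
Local Notation e := amplitude.

Lemma amplitude_sqr_gt0 x : 0 < a x.
Proof. by rewrite ltr_wpDl ?sqr_ge0// exprn_gt0. Qed.

Lemma amplitude_gt0 x : 0 < e x. Proof. exact: expR_gt0. Qed.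

Lemma amplitude_sqrE x : e x ^+ 2 = a x.
Proof.
rewrite /e -expRM_natr divfK ?pnatr_eq0// lnK// posrE.
exact: amplitude_sqr_gt0.
Qed.

Lemma derivative_amplitude_sqr : derivative a (fun x => 2 * (f x * f1 x)).
Proof.
apply: derivative_eq (derivativeD (derivative_sqr df) (derivative_cst (k ^+ 2))) _ => x.
by rewrite addr0 mulrA.
Qed.

Lemma derivative_amplitude : derivative e (fun x => f x * f1 x / e x).
Proof.
have := derivative_expR (derivativeZ 2^-1 (derivative_ln derivative_amplitude_sqr amplitude_sqr_gt0)).
rewrite (_ : (fun x => expR _) = e); last by apply/funext => x; rewrite /e mulrC.
move/derivative_eq; apply => x; rewrite -/(a x) [2^-1 * ln _]mulrC -/(e x) -amplitude_sqrE.
by field; rewrite gt_eqF// amplitude_gt0.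
Qed.

Lemma periodic_amplitude : periodic T e.
Proof. by move=> x; rewrite /e /a pf. Qed.

Lemma smooth_amplitude_sqr n : smooth n a.
Proof. by apply: smoothD; [apply: smoothX|exact: smooth_cst]. Qed.

Lemma smooth_amplitude n : smooth n e.
Proof.
apply: smooth_expR; apply: smoothM; last exact: smooth_cst.
by apply: smooth_ln; [exact: smooth_amplitude_sqr|exact: amplitude_sqr_gt0].
Qed.

Lemma amplitude_ge_f x : `|f x| <= e x.
Proof.
rewrite -(@ler_pXn2r _ 2) ?nnegrE ?(ltW (amplitude_gt0 x))//.
by rewrite amplitude_sqrE real_normK ?num_real// lerDl sqr_ge0.
Qed.

Lemma amplitude_ge_k x : k <= e x.
Proof.
rewrite -(@ler_pXn2r _ 2) ?nnegrE ?(ltW (amplitude_gt0 x)) ?(ltW k0)//.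
by rewrite amplitude_sqrE lerDr sqr_ge0.
Qed.

Hypothesis k1 : k <= 1.

Lemma amplitude_sqr_le x : a x <= C ^+ 2 + 1.
Proof.
apply: lerD; first by rewrite -[leLHS]real_normK ?num_real// lerXn2r ?nnegrE.
by rewrite expr_le1// ltW.
Qed.

Lemma amplitude_le x : e x <= C ^+ 2 + 1.
Proof.
have h := amplitude_sqr_le x; rewrite -amplitude_sqrE in h.
have h1 : 1 <= C ^+ 2 + 1 by rewrite lerDr sqr_ge0.
have e0 := amplitude_gt0 x.
have [e1|e1] := leP (e x) 1; first exact: le_trans h1.
by apply: le_trans h; rewrite expr2 ler_peMl// ltW.
Qed.

End amplitude.

(* Subtracting a multiple of [H1] makes the primitive of a field of positive
   mean periodic, and this only lowers the left-hand side of the corrector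
   inequality. *)
Lemma exists_expanding_field : exists G1 H1 H1' c,
  [/\ derivative G1 H1, derivative H1 H1', (forall n, smooth n H1) & periodic T H1] /\
  [/\ 0 < c, 0 < G1 T - G1 0 &
   forall x, c <= rho * H1 x + f x * (f1 x * H1 x + f x * H1' x) / 2].
Proof.
(* The condition [k * C <= rho] keeps [f * f1 * k^2 / e^2 / 2] below [rho / 2] in absolute value. *)
pose k := Num.min 1 (rho / C).
have Cp : 0 < C by exact: lt_le_trans C1.
have k0 : 0 < k by rewrite lt_min ltr01 divr_gt0.
have k1 : k <= 1 by rewrite ge_min lexx.
have kC : k * C <= rho by rewrite -ler_pdivlMr// ge_min lexx orbT.
pose e := amplitude k; have e0 x : 0 < e x := amplitude_gt0 k x.
have en0 x : e x != 0 by rewrite gt_eqF.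
(* For [k = 0] this is [1 / |f|]: away from the zeros of [f] the noise term [f * (f * H1)'] vanishes
   and only [rho * H1 > 0] remains. A positive [k] removes the poles. *)
pose H1 x := (e x)^-1.
have dH : derivative H1 (fun x => - (f x * f1 x) / e x ^+ 3).
  apply: derivative_eq (derivative_inv (derivative_amplitude k0) en0) _ => x.
  by rewrite -/(e x); field; rewrite en0.
have sH n : smooth n H1 by apply: smooth_inv => //; exact: smooth_amplitude.
have [G1 dG] := exists_primitive (sH 0%N).
have B0 : 0 < C ^+ 2 + 1 by rewrite ltr_wpDl ?sqr_ge0.
exists G1, H1, (fun x => - (f x * f1 x) / e x ^+ 3), (rho / 2 / (C ^+ 2 + 1)); split.
  by split=> // x; rewrite /H1 /e periodic_amplitude.
split; first by rewrite !divr_gt0.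
  have [z _ ->] := mean_value 0 T dG; rewrite subr0 mulr_gt0// invr_gt0//.
move=> x.
have -> : rho * H1 x + f x * (f1 x * H1 x + f x * (- (f x * f1 x) / e x ^+ 3)) / 2 =
  (rho + f x * f1 x * k ^+ 2 / e x ^+ 2 / 2) * (e x)^-1.
  have e2 : k ^+ 2 = e x ^+ 2 - f x ^+ 2 by rewrite /e amplitude_sqrE// /amplitude_sqr addrAC subrr add0r.
  by rewrite /H1 e2; field.
apply: ler_pM.
- by rewrite divr_ge0// ltW.
- by rewrite invr_ge0 ltW.
- have h : `|f x * f1 x * k ^+ 2 / e x ^+ 2| <= rho.
    rewrite normrM [`|_^-1|]gtr0_norm ?invr_gt0 ?exprn_gt0// ler_pdivrMr ?exprn_gt0//.
    rewrite normrM [`|k ^+ 2|]ger0_norm ?sqr_ge0//.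
    apply: (@le_trans _ _ (e x * C * (k * e x))).
      apply: ler_pM; rewrite ?sqr_ge0//.
        by rewrite normrM; apply: ler_pM => //; exact: amplitude_ge_f.
      by rewrite expr2 ler_pM2l// amplitude_ge_k.
    have -> : e x * C * (k * e x) = k * C * e x ^+ 2 by ring.
    by rewrite ler_wpM2r ?sqr_ge0.
  by move: h; rewrite ler_norml => /andP[h _]; lra.
- by rewrite lef_pV2 ?posrE// amplitude_le.
Qed.

(* [H] solves the Poisson equation of the motion perturbed by an independent
   noise of size [k]; the bound on [H'] is uniform in [k]. *)
Lemma exists_regularized_field : exists2 C2, 0 < C2 & forall k, 0 < k -> k <= 1 ->
  exists H H' N, [/\ derivative H H', (forall n, smooth n H), periodic T H,
    periodic T N & (forall x, 0 < N x)] /\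
    [/\ derivative N (fun x => (2 * rho ^+ 2 + k ^+ 2 * f1 x ^+ 2 / 2 -
          (2 * rho - f x * f1 x) * N x) / amplitude_sqr k x),
      (forall x, H x = 2 * (N x - rho - f x * f1 x / 2) / amplitude_sqr k x),
      (forall x, amplitude_sqr k x * H' x / 2 =
        - (f x * f2 x / 2) - (rho + f x * f1 x / 2) * H x),
      (forall x, `|k ^+ 2 * H' x / 2| <= C2 * k) &
      (forall x, N x <= C2)].
Proof.
(* [L] and [K] are the constants of the barrier [B = K a / (1 + L a)]. By the arithmetic-geometric
   inequality [L] makes [|f f1| / (1 + L a)] at most [rho / 2], and [K] then makes [B' + m B] at
   least [C], which bounds [|r|]. *)
pose L := (C / rho) ^+ 2.
have Cp : 0 < C by exact: lt_le_trans C1.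
have L0 : 0 < L by rewrite exprn_gt0// divr_gt0.
pose A := C ^+ 2 + 1; have A0 : 0 < A by rewrite ltr_wpDl ?sqr_ge0.
pose K := C * (1 + L * A) / rho.
have K0 : 0 < K by rewrite divr_gt0// mulr_gt0// addr_gt0// mulr_gt0.
pose C2 := C + (2 * rho + C ^+ 2) * K + (rho + C ^+ 2 + A * (K * A)).
have Csq : 0 < C ^+ 2 by rewrite exprn_gt0.
exists C2.
  have h1 : 0 < (2 * rho + C ^+ 2) * K by rewrite mulr_gt0// addr_gt0// mulr_gt0.
  have h2 : 0 < A * (K * A) by apply: mulr_gt0 => //; exact: mulr_gt0.
  by apply: addr_gt0; [exact: addr_gt0|apply: addr_gt0 => //; exact: addr_gt0].
move=> k k0 k1.
pose a := amplitude_sqr k; pose e := amplitude k.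
have e0 x : 0 < e x := amplitude_gt0 k x.
have a0 x : 0 < a x := amplitude_sqr_gt0 k0 x.
have ea x : e x ^+ 2 = a x := amplitude_sqrE k0 x.
have en0 x : e x != 0 by rewrite gt_eqF.
have an0 x : a x != 0 by rewrite gt_eqF.
have de : derivative e (fun x => f x * f1 x / e x) := derivative_amplitude k0.
have da : derivative a (fun x => 2 * (f x * f1 x)) := derivative_amplitude_sqr k.
have pe : periodic T e by exact: periodic_amplitude.
have pa : periodic T a by move=> x; rewrite /a /amplitude_sqr pf.
have se n : smooth n e by exact: smooth_amplitude.
have sa n : smooth n a by exact: smooth_amplitude_sqr.
have aA x : a x <= A by exact: amplitude_sqr_le.
have eA x : e x <= A by exact: amplitude_le.
(* The unknown is [J = e H]: as [e' = f f1 / e], this factor cancels the term [f f1 H] of the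
   equation and leaves only the positive damping [m]. *)
pose m x := 2 * rho / a x; pose r x := - (f x * f2 x) / e x.
have m0 x : 0 < m x by rewrite divr_gt0// mulr_gt0.
have sm n : smooth n m.
  by apply: smoothM; [exact: smooth_cst|exact: smooth_inv].
have sr n : smooth n r.
  by apply: smoothM; [apply: smoothN; exact: smoothM|exact: smooth_inv].
have pm : periodic T m by move=> x; rewrite /m pa.
have pr : periodic T r by move=> x; rewrite /r pe pf pf2.
have [J pJ dJ] := periodic_linear_ode T0 (sr 0%N) (sm 0%N) pr pm m0.
have sJ n : smooth n J.
  by apply: smoothS; exact: smooth_linear_ode (sr n) (sm n) dJ.
(* A barrier of the order of [a] gives [|J| <= K a], hence [|H| <= K e] with [K] independent of [k];
   the maximum principle with the bound on [r] alone would only give a bound of the order of [a / e]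
   times the size of [f]. *)
pose B x := K * a x / (1 + L * a x).
have La0 x : 0 < 1 + L * a x by rewrite addr_gt0// mulr_gt0.
have Lan0 x : 1 + L * a x != 0 by rewrite gt_eqF.
have dB : derivative B (fun x => 2 * K * (f x * f1 x) / (1 + L * a x) ^+ 2).
  have d1 : derivative (fun x => 1 + L * a x) (fun x => L * (2 * (f x * f1 x))).
    apply: derivative_eq (derivativeD (derivative_cst 1) (derivativeZ L da)) _ => x.
    by rewrite add0r.
  apply: derivative_eq (derivativeM (derivativeZ K da) (derivative_inv d1 Lan0)) _ => x.
  by field; rewrite Lan0.
have pB : periodic T B by move=> x; rewrite /B pa.
have barrier x : C <= 2 * K * (f x * f1 x) / (1 + L * a x) ^+ 2 + m x * B x.
  have -> : 2 * K * (f x * f1 x) / (1 + L * a x) ^+ 2 + m x * B x =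
    2 * K / (1 + L * a x) * (rho + f x * f1 x / (1 + L * a x)).
    by rewrite /m /B; field; rewrite Lan0 an0.
  have h : `|f x * f1 x / (1 + L * a x)| <= rho / 2.
    rewrite normrM [`|_^-1|]gtr0_norm ?invr_gt0// ler_pdivrMr//.
    rewrite normrM; apply: (@le_trans _ _ (`|f x| * C)); first by rewrite ler_wpM2l.
    apply: (@le_trans _ _ (rho / 2 * (1 + L * `|f x| ^+ 2))); last first.
      rewrite ler_pM2l ?divr_gt0// lerD2l ler_pM2l// real_normK ?num_real//.
      by rewrite lerDl sqr_ge0.
    have -> : rho / 2 * (1 + L * `|f x| ^+ 2) = (rho ^+ 2 + (C * `|f x|) ^+ 2) / (2 * rho).
      by rewrite /L; field; rewrite gt_eqF.
    rewrite ler_pdivlMr ?mulr_gt0//.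
    by have := sqr_ge0 (rho - C * `|f x|); rewrite !expr2; lra.
  have KC : C <= 2 * K / (1 + L * a x) * (rho / 2).
    have -> : 2 * K / (1 + L * a x) * (rho / 2) = K * rho / (1 + L * a x) by field.
    rewrite ler_pdivlMr// /K divfK ?gt_eqF// ler_pM2l// lerD2l ler_pM2l//.
  apply: le_trans KC _; rewrite ler_wpM2l//.
    by rewrite divr_ge0 ?(ltW (La0 x))// mulr_ge0// ltW.
  by move: h; rewrite ler_norml => /andP[h _]; lra.
have rC x : `|r x| <= C.
  rewrite normrM normrN [`|_^-1|]gtr0_norm ?invr_gt0// ler_pdivrMr//.
  by rewrite normrM mulrC ler_pM// amplitude_ge_f.
have JB x : `|J x| <= B x.
  have h1 := comparison T0 (r := fun x => 2 * K * (f x * f1 x) / (1 + L * a x) ^+ 2 + m x * B x - r x)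
    (derivative_eq (derivativeB dB dJ) _) _ m0 _.
  have h2 := comparison T0 (r := fun x => 2 * K * (f x * f1 x) / (1 + L * a x) ^+ 2 + m x * B x + r x)
    (derivative_eq (derivativeD dB dJ) _) _ m0 _.
  rewrite ler_norml; apply/andP; split.
    rewrite -subr_ge0 opprK addrC; apply: h2 => y; rewrite ?pB ?pJ//=; first by ring.
    by have := barrier y; have := rC y; rewrite ler_norml => /andP[? _]; lra.
  rewrite -subr_ge0; apply: h1 => y; rewrite ?pB ?pJ//=; first by ring.
  by have := barrier y; have := rC y; rewrite ler_norml => /andP[_ ?]; lra.
have JK x : `|J x| <= K * a x.
  apply: le_trans (JB x) _; apply: ler_piMr; first by rewrite mulr_ge0 ?(ltW (a0 x)) ?(ltW K0).
  by rewrite invf_le1// lerDl mulr_ge0// ltW.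
pose H x := J x / e x.
have HK x : `|H x| <= K * e x.
  rewrite normrM [`|_^-1|]gtr0_norm ?invr_gt0// ler_pdivrMr//.
  by rewrite -mulrA -expr2 ea.
pose H' x := (- (f x * f2 x) - (2 * rho + f x * f1 x) * H x) / a x.
have dH : derivative H H'.
  apply: derivative_eq (derivativeM dJ (derivative_inv de en0)) _ => x.
  by rewrite /H' /H /r /m -ea; field; rewrite en0.
pose N x := rho + f x * f1 x / 2 + e x * J x / 2.
have dff : derivative (fun x => f x * f1 x) (fun x => f1 x ^+ 2 + f x * f2 x).
  by apply: derivative_eq (derivativeM df df1) _ => x; rewrite expr2.
have dN : derivative N (fun x => (2 * rho ^+ 2 + k ^+ 2 * f1 x ^+ 2 / 2 -
          (2 * rho - f x * f1 x) * N x) / a x).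
  have := derivativeD (derivativeD (derivative_cst rho) (derivativeZ 2^-1 dff))
    (derivativeZ 2^-1 (derivativeM de dJ)).
  rewrite (_ : (fun x => _ + _ + _) = N); last first.
    by apply/funext => x; rewrite /N ![2^-1 * _]mulrC.
  move/derivative_eq; apply => x.
  have k2 : k ^+ 2 = e x ^+ 2 - f x ^+ 2 by rewrite ea /a /amplitude_sqr addrAC subrr add0r.
  by rewrite /N /r /m -ea k2; field; rewrite en0.
have pN : periodic T N by move=> x; rewrite /N pf pf1 pe pJ.
(* Dividing by [e] cancels the term [f f1 N] of the equation for [N]; what is left has damping [m]
   and a positive source, so [strict_comparison] applies. *)
have N0 x : 0 < N x.
  have h := strict_comparison T0 (r := fun x => (2 * rho ^+ 2 + k ^+ 2 * f1 x ^+ 2 / 2) / (e x * a x))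
    (derivative_eq (derivativeM dN (derivative_inv de en0)) _) _ m0 _ x.
  have : 0 < N x * (e x)^-1.
    apply: h => y.
    - by rewrite /m -ea; field; rewrite en0.
    - by rewrite pN pe.
    - rewrite divr_gt0 ?mulr_gt0// ltr_pwDl// ?mulr_gt0 ?exprn_gt0//.
      by rewrite divr_ge0// mulr_ge0 ?sqr_ge0.
  by rewrite pmulr_lgt0// invr_gt0.
exists H, H', N; split.
  split=> //; first by move=> n; apply: smoothM => //; exact: smooth_inv.
  by move=> x; rewrite /H pJ pe.
split=> //.
- by move=> x; rewrite -/(a x) /N /H -ea; field; rewrite en0.
- by move=> x; rewrite -/(a x) /H'; field; rewrite an0.
(* [a * H'] is of order [e], since [f] and [H] both are; hence [k^2 H'] is of order [k^2 / e], which
   is at most [k]. *)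
- move=> x; pose W := C + (2 * rho + C ^+ 2) * K.
  have W0 : 0 <= W by rewrite addr_ge0// mulr_ge0 ?(ltW K0)// addr_ge0 ?sqr_ge0// mulr_ge0// ltW.
  have h : `|- (f x * f2 x) - (2 * rho + f x * f1 x) * H x| <= W * e x.
    apply: le_trans (ler_normB _ _) _; rewrite normrN.
    have -> : W * e x = C * e x + (2 * rho + C ^+ 2) * (K * e x) by rewrite /W; ring.
    apply: lerD.
      by rewrite normrM mulrC ler_pM// amplitude_ge_f.
    rewrite normrM; apply: ler_pM => //.
    apply: le_trans (ler_normD _ _) _; apply: lerD.
      by rewrite ger0_norm// mulr_ge0// ltW.
    by rewrite normrM expr2 ler_pM.
  have -> : k ^+ 2 * H' x / 2 = (k ^+ 2 / 2) / a x * (- (f x * f2 x) - (2 * rho + f x * f1 x) * H x).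
    by rewrite /H'; field; rewrite an0.
  have q0 : 0 <= k ^+ 2 / 2 / a x by rewrite !divr_ge0 ?sqr_ge0// ltW.
  rewrite normrM ger0_norm//; apply: le_trans (ler_wpM2l q0 h) _.
  have -> : k ^+ 2 / 2 / a x * (W * e x) = W * (k / 2) * (k / e x).
    by rewrite -ea; field; rewrite en0.
  have ke : k / e x <= 1 by rewrite ler_pdivrMr// mul1r amplitude_ge_k.
  apply: (@le_trans _ _ (W * (k / 2))).
    by rewrite ler_piMr// mulr_ge0// divr_ge0// ltW.
  apply: ler_pM => //; first by rewrite divr_ge0// ltW.
    rewrite /C2 -/W lerDl; apply: addr_ge0; first by rewrite addr_ge0 ?(ltW rho0) ?sqr_ge0.
    by apply: mulr_ge0; [exact: ltW|apply: mulr_ge0; exact: ltW].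
  by lra.
- move=> x; rewrite /N.
  have h1 : `|f x * f1 x| <= C ^+ 2 by rewrite normrM expr2 ler_pM.
  have h2 : `|e x * J x| <= A * (K * A).
    rewrite normrM; apply: ler_pM => //; first by rewrite gtr0_norm.
    by apply: le_trans (JK x) _; rewrite ler_pM2l.
  have h3 : 0 <= C + (2 * rho + C ^+ 2) * K.
    by rewrite addr_ge0// mulr_ge0 ?(ltW K0)// addr_ge0 ?sqr_ge0// mulr_ge0// ltW.
  move: h1 h2; rewrite !ler_norml => /andP[_ h1] /andP[_ h2].
  have h4 : 0 <= C ^+ 2 by rewrite sqr_ge0.
  have h5 : 0 <= A * (K * A) by apply: mulr_ge0; [exact: ltW|apply: mulr_ge0; exact: ltW].
  by rewrite /C2; lra.
Qed.

End regularized.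

(** * The corrector for the original motion *)

Section corrector.
Variables (R : realType) (T rho C : R) (f f1 f2 : R -> R).
Hypotheses (T0 : 0 < T) (rho0 : 0 < rho) (C1 : 1 <= C).
Hypotheses (df : derivative f f1) (df1 : derivative f1 f2).
Hypotheses (sf : forall n, smooth n f).
Hypotheses (pf : periodic T f).
Hypotheses (fC : forall x, `|f x| <= C) (f1C : forall x, `|f1 x| <= C)
  (f2C : forall x, `|f2 x| <= C).
Hypothesis nonconst : ~ exists c, forall x, f x = c.

Let C0 : 0 <= C. Proof. exact: le_trans C1. Qed.
Let Cp : 0 < C. Proof. exact: lt_le_trans C1. Qed.
Let pf1 : periodic T f1. Proof. exact: derivative_periodic df pf. Qed.
Let pf2 : periodic T f2. Proof. exact: derivative_periodic df1 pf1. Qed.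
Let sf1 n : smooth n f1. Proof. exact: (smooth_derivative df (sf n.+1)). Qed.

Let chi x := f x * f1 x.
Let chi' x := f1 x ^+ 2 + f x * f2 x.

Let dchi : derivative chi chi'.
Proof. by apply: derivative_eq (derivativeM df df1) _ => x; rewrite /chi' expr2. Qed.

Let pchi : periodic T chi. Proof. by move=> x; rewrite /chi pf pf1. Qed.

(** Were there equality, the nondecreasing [E] would be periodic, hence constant, and [chi], half
    the derivative of [f ^+ 2], would vanish. Then [f ^+ 2] is constant: either [f] is zero, or it
    has no zero and [f1] vanishes. Both contradict [nonconst]. *)
Lemma energy_increases E : derivative E (fun x => chi x ^+ 2) -> 0 < E T - E 0.
Proof.
move=> dE; have ndE := derivative_nondecreasing dE (fun x => sqr_ge0 _).
rewrite lt_neqAle subr_ge0 ndE ?(ltW T0)// andbT eq_sym subr_eq0; apply/negP => /eqP ET.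
apply: nonconst.
have pE : periodic T E.
  by apply: (periodic_of_derivative dE _ ET) => x; rewrite pchi.
have [c Ec] := periodic_max T0 (derivative_continuous dE) pE.
have E_cst x : E x = E c.
  apply/eqP; rewrite eq_le Ec/=.
  have [k /andP[k1 _]] := reduce_period T0 (x - c).
  rewrite -(periodic_intmul k x pE); apply: ndE.
  by rewrite -subr_ge0 addrAC.
have chi0 x : chi x = 0.
  have d0 : derivative E (fun=> 0).
    by rewrite (_ : E = fun=> E c); [exact: derivative_cst|apply/funext].
  by have /(congr1 (@^~ x)) /eqP := derivative_unique dE d0; rewrite sqrf_eq0 => /eqP.
have dsq : derivative (fun x => f x ^+ 2) (fun=> 0).
  by apply: derivative_eq (derivative_sqr df) _ => x; rewrite -mulrA -/(chi x) chi0 mulr0.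
have f_sqr x : f x ^+ 2 = f 0 ^+ 2 := derivative0_cst dsq x 0.
have [f00|f0n] := eqVneq (f 0) 0.
  exists 0 => x; have /eqP := f_sqr x.
  by rewrite f00 expr0n/= sqrf_eq0 => /eqP.
have d0 : derivative f (fun=> 0).
  apply: derivative_eq df _ => x; have /eqP := chi0 x; rewrite mulf_eq0 => /orP[/eqP fx|/eqP//].
  have := f_sqr x; rewrite fx expr0n/= => /esym/eqP; rewrite sqrf_eq0.
  by rewrite (negbTE f0n).
by exists (f 0) => x; exact: derivative0_cst d0 x 0.
Qed.

Lemma le_sqr_add (x th : R) : 0 < th -> x <= x ^+ 2 / (4 * th) + th.
Proof.
move=> th0; rewrite -(ler_pM2l (_ : 0 < 4 * th)) ?mulr_gt0//.
have -> : 4 * th * (x ^+ 2 / (4 * th) + th) = x ^+ 2 + 4 * th ^+ 2.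
  by field; rewrite gt_eqF.
by have := sqr_ge0 (x - 2 * th); rewrite !expr2; lra.
Qed.

(* Quantitative form of: if the field [H] has mean zero, then [N = rho]
   identically, hence [f * f'] vanishes identically. *)
Lemma regularized_mean C2 : 0 < C2 -> exists2 c0, 0 < c0 &
  exists2 k0, 0 < k0 & forall k G H N, 0 < k -> k <= 1 -> k <= k0 ->
    derivative G H -> periodic T N -> (forall x, 0 < N x) ->
    derivative N (fun x => (2 * rho ^+ 2 + k ^+ 2 * f1 x ^+ 2 / 2 -
          (2 * rho - chi x) * N x) / amplitude_sqr f k x) ->
    (forall x, H x = 2 * (N x - rho - chi x / 2) / amplitude_sqr f k x) ->
    (forall x, N x <= C2) -> c0 <= G T - G 0.
Proof.
move=> C20.
have cchi2 : continuous (fun x => chi x ^+ 2).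
  apply: (@smooth_continuous _ 0); apply: smoothX; apply: smoothM; [exact: sf|exact: sf1].
have [E dE] := exists_primitive cchi2.
pose D := E T - E 0; have D0 : 0 < D := energy_increases dE.
pose Sb := 3 * C ^+ 4 + 2 * rho * C ^+ 2 + (C ^+ 2 + 1) * (2 * C ^+ 2).
have Cn n : 0 < C ^+ n by rewrite exprn_gt0.
have Sb0 : 0 < Sb.
  have h1 : 0 < rho * C ^+ 2 by exact: mulr_gt0.
  have h2 : 0 < (C ^+ 2 + 1) * (2 * C ^+ 2) by rewrite mulr_gt0// ?addr_gt0// mulr_gt0.
  apply: addr_gt0 => //; apply: addr_gt0; first exact: mulr_gt0.
  by rewrite -mulrA mulr_gt0.
(* Over a period, [th] and the term in [k ^+ 2] each cost at most a quarter of [rho * D]; the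
   remaining half bounds the mean of [H] from below. *)
pose th := rho * D / (4 * T).
have th0 : 0 < th by rewrite divr_gt0// mulr_gt0.
pose L := (C ^+ 2 + 1) * C2.
have L0 : 0 < L by rewrite mulr_gt0// addr_gt0.
pose W := Sb ^+ 2 / (4 * th).
have W0 : 0 < W by apply: divr_gt0; [exact: exprn_gt0|exact: mulr_gt0].
have WL0 : 0 < W * L by rewrite mulr_gt0.
exists (rho * D / 2 / (W * L)).
  by apply: divr_gt0 => //; apply: divr_gt0 => //; exact: mulr_gt0.
exists (rho * D / (2 * T * C ^+ 4)); first by apply: divr_gt0; [exact: mulr_gt0|rewrite mulr_gt0// mulr_gt0].
move=> k G H N k0 k1 kk dG pN N0 dN HE NC2.
pose a := amplitude_sqr f k.
have a0 x : 0 < a x := amplitude_sqr_gt0 f k0 x.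
have aA x : a x <= C ^+ 2 + 1 := amplitude_sqr_le C1 fC k0 k1 x.
have da : derivative a (fun x => 2 * chi x) := derivative_amplitude_sqr df k.
have pa : periodic T a by move=> x; rewrite /a /amplitude_sqr pf.
set N' := fun x => _ in dN.
(* Adding [(ln N)'], whose mean over a period is 0, to [H] completes the square: the mean of [H] is
   that of [q], which dominates the mean of [(N - rho) ^+ 2]. *)
pose q x := (2 * (N x - rho) ^+ 2 + k ^+ 2 * f1 x ^+ 2 / 2) / (a x * N x).
have dQ : derivative (fun x => G x + ln (N x)) q.
  apply: derivative_eq (derivativeD dG (derivative_ln dN N0)) _ => x.
  have k2 : k ^+ 2 = a x - f x ^+ 2 by rewrite /a /amplitude_sqr addrAC subrr add0r.
  rewrite HE /q /N' -/(a x) k2 /chi; field.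
  by rewrite !gt_eqF.
have nq x : (N x - rho) ^+ 2 <= L * q x.
  rewrite /q mulrA ler_pdivlMr ?mulr_gt0//.
  have aN : a x * N x <= L by apply: ler_pM => //; apply: ltW.
  have n2 : 0 <= (N x - rho) ^+ 2 by rewrite sqr_ge0.
  have kf : 0 <= k ^+ 2 * f1 x ^+ 2 / 2 by rewrite divr_ge0// mulr_ge0 ?sqr_ge0.
  apply: (@le_trans _ _ (L * (N x - rho) ^+ 2)); first by rewrite mulrC ler_wpM2r.
  by rewrite ler_pM2l//; lra.
(* [Z] is periodic, so [Z'] has mean zero. In [Z'] the term [rho * chi ^+ 2] is the only one that
   carries neither [N - rho] nor [k]: if the mean of [q] were small, so would be that of
   [chi ^+ 2]. *)
pose Z x := a x * ((N x - rho) * chi x).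
pose Z' x := 2 * chi x * ((N x - rho) * chi x) + a x * (N' x * chi x + (N x - rho) * chi' x).
have dZ : derivative Z Z'.
  have dn : derivative (fun x => N x - rho) N'.
    apply: derivative_eq (derivativeB dN (derivative_cst rho)) _ => x.
    by rewrite subr0.
  exact: derivativeM da (derivativeM dn dchi).
have chiC x : `|chi x| <= C ^+ 2 by rewrite normrM expr2 ler_pM.
have pointwise x : rho * chi x ^+ 2 <= Z' x + W * L * q x + (th + k ^+ 2 * C ^+ 4 / 2).
  pose n := N x - rho; pose s := 3 * chi x ^+ 2 - 2 * rho * chi x + a x * chi' x.
  have ZE : Z' x = rho * chi x ^+ 2 + n * s + k ^+ 2 * f1 x ^+ 2 * chi x / 2.
    by rewrite /Z' /N' /s /n -/(a x); field; rewrite gt_eqF.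
  have sS : `|s| <= Sb.
    apply: le_trans (ler_normD _ _) _; apply: lerD.
      apply: le_trans (ler_normB _ _) _; apply: lerD.
        rewrite normrM ger0_norm// ler_pM2l// normrX.
        by rewrite (_ : C ^+ 4 = (C ^+ 2) ^+ 2) ?lerXn2r ?nnegrE ?sqr_ge0// -exprM.
      by rewrite normrM ger0_norm ?mulr_ge0 ?(ltW rho0)// ler_pM2l ?mulr_gt0.
    rewrite normrM (gtr0_norm (a0 x)); apply: ler_pM => //; first exact: ltW.
    apply: le_trans (ler_normD _ _) _; rewrite mulr_natl mulr2n; apply: lerD.
      by rewrite normrX lerXn2r ?nnegrE.
    by rewrite normrM expr2 ler_pM.
  have h1 : - (n * s) <= W * L * q x + th.
    apply: (@le_trans _ _ (`|n| * Sb)).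
      apply: le_trans (ler_norm _) _; rewrite normrN normrM.
      by rewrite ler_wpM2l.
    apply: le_trans (le_sqr_add _ th0) _; rewrite lerD2r.
    have -> : (`|n| * Sb) ^+ 2 / (4 * th) = W * n ^+ 2.
      by rewrite exprMn real_normK ?num_real// /W; ring.
    by rewrite -[W * L * _]mulrA ler_pM2l//; exact: nq.
  have h2 : - (k ^+ 2 * f1 x ^+ 2 * chi x / 2) <= k ^+ 2 * C ^+ 4 / 2.
    have hf : f1 x ^+ 2 <= C ^+ 2.
      by rewrite -[leLHS]real_normK ?num_real// lerXn2r ?nnegrE.
    have hc : - chi x <= C ^+ 2.
      by have := chiC x; rewrite ler_norml => /andP[? _]; rewrite lerNl.
    have -> : - (k ^+ 2 * f1 x ^+ 2 * chi x / 2) = k ^+ 2 / 2 * (f1 x ^+ 2 * - chi x) by ring.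
    have -> : k ^+ 2 * C ^+ 4 / 2 = k ^+ 2 / 2 * (C ^+ 2 * C ^+ 2) by ring.
    rewrite ler_wpM2l ?divr_ge0 ?sqr_ge0//.
    apply: le_trans (ler_wpM2l (sqr_ge0 _) hc) _.
    by rewrite ler_wpM2r ?sqr_ge0.
  by rewrite ZE; lra.
have dPhi := derivativeB (derivativeD (derivativeD dZ (derivativeZ (W * L) dQ))
   (derivativeZ (th + k ^+ 2 * C ^+ 4 / 2) (@derivative_id R))) (derivativeZ rho dE).
have Phi0 x : 0 <= Z' x + W * L * q x + (th + k ^+ 2 * C ^+ 4 / 2) * 1 - rho * chi x ^+ 2.
  by rewrite subr_ge0 mulr1; exact: pointwise.
have := derivative_nondecreasing dPhi Phi0 (ltW T0).
have ZT : Z T = Z 0 by rewrite /Z -[T]add0r pa pN pchi.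
have NT : N T = N 0 by rewrite -[T]add0r pN.
rewrite ZT NT mulr0 => h.
have kk2 : T * (k ^+ 2 * C ^+ 4 / 2) <= rho * D / 4.
  have e1 : k ^+ 2 <= rho * D / (2 * T * C ^+ 4).
    by apply: le_trans kk; rewrite expr2 ler_piMr// ltW.
  rewrite ler_pdivlMr in e1; last by rewrite !mulr_gt0.
  by lra.
have e2 : T * th = rho * D / 4 by rewrite /th; field; rewrite gt_eqF.
rewrite ler_pdivrMr//.
have e3 : rho * D = rho * E T - rho * E 0 by rewrite /D; ring.
have e4 : (th + k ^+ 2 * C ^+ 4 / 2) * T = T * th + T * (k ^+ 2 * C ^+ 4 / 2) by ring.
rewrite e4 in h.
have e5 : W * L * (G T + ln (N 0)) - W * L * (G 0 + ln (N 0)) = (G T - G 0) * (W * L) by ring.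
by lra.
Qed.

(** Inserting [H - b * H1] for [g'] leaves the regularization error [- k^2 H' / 2], at most
    [C2 * k], and the gain [- b * c1]. As [b >= b0] with [b0] independent of [k], a small [k] makes
    the error at most half of the gain. *)
Lemma exists_corrector : exists g g1 g2 c,
  [/\ derivative g g1, derivative g1 g2, (forall n, smooth n g) & periodic T g] /\
  (0 < c /\ forall x, f x * f2 x / 2 + rho * g1 x + f x * (f1 x * g1 x + f x * g2 x) / 2 <= - c).
Proof.
have [G1 [H1 [H1' [c1 [[dG1 dH1 sH1 pH1] [c10 m1 H1c]]]]]] :=
  exists_expanding_field T0 rho0 C1 df sf pf fC f1C.
have [C2 C20 reg] := exists_regularized_field T0 rho0 C1 df df1 sf pf fC f1C f2C.
have [c0 c00 [k0 k00 Hmean]] := regularized_mean C20.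
set m := G1 T - G1 0 in m1.
pose b0 := c0 / m; have b00 : 0 < b0 by rewrite divr_gt0.
pose k := Num.min 1 (Num.min k0 (b0 * c1 / (2 * C2))).
have kp : 0 < k.
  by rewrite !lt_min ltr01 k00 divr_gt0// mulr_gt0.
have k1 : k <= 1 by rewrite ge_min lexx.
have kk0 : k <= k0 by rewrite !ge_min lexx orbT.
have kC : C2 * k <= b0 * c1 / 2.
  have : k <= b0 * c1 / (2 * C2) by rewrite !ge_min lexx !orbT.
  by rewrite ler_pdivlMr ?mulr_gt0//; lra.
have [H [H' [N [[dH sH pH pN N0] [dN HE H'E H'C NC2]]]]] := reg k kp k1.
have [G dG] := exists_primitive (sH 0%N).
have Gm := Hmean k G H N kp k1 kk0 dG pN N0 dN HE NC2.
pose b := (G T - G 0) / m.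
have bb0 : b0 <= b by rewrite ler_pM2r// invr_gt0.
exists (fun x => G x - b * G1 x), (fun x => H x - b * H1 x), (fun x => H' x - b * H1' x),
  (b0 * c1 / 2).
have dg := derivativeB dG (derivativeZ b dG1).
split; first split=> //.
- exact: derivativeB dH (derivativeZ b dH1).
- move=> n; apply: smoothS; apply: (derivative_smooth dg).
  by apply: smoothB => //; apply: smoothM => //; exact: smooth_cst.
- apply: (periodic_of_derivative dg); first by move=> x; rewrite pH pH1.
  have : b * m = G T - G 0 by rewrite /b divfK ?gt_eqF.
  by rewrite /m; lra.
split; first by rewrite divr_gt0// mulr_gt0.
move=> x.
have e1 := H'E x; have e2 := H1c x.
have e3 : b0 * c1 <= b * (rho * H1 x + f x * (f1 x * H1 x + f x * H1' x) / 2).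
  by apply: ler_pM => //; exact: ltW.
have e4 : - (k ^+ 2 * H' x / 2) <= C2 * k.
  by apply: le_trans (H'C x); rewrite -normrN ler_norm.
have -> : f x * f2 x / 2 + rho * (H x - b * H1 x) +
    f x * (f1 x * (H x - b * H1 x) + f x * (H' x - b * H1' x)) / 2 =
  (f x * f2 x / 2 + (rho + f x * f1 x / 2) * H x + amplitude_sqr f k x * H' x / 2)
   - k ^+ 2 * H' x / 2 - b * (rho * H1 x + f x * (f1 x * H1 x + f x * H1' x) / 2).
  by rewrite /amplitude_sqr; field.
rewrite e1.
have -> : f x * f2 x / 2 + (rho + f x * f1 x / 2) * H x +
  (- (f x * f2 x / 2) - (rho + f x * f1 x / 2) * H x) = 0 by ring.
by lra.
Qed.

End corrector.

(** * Brownian increments and the filtration *)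

Section elementary.
Variable R : realDomainType.
Implicit Types x y : R.

Lemma norm_le_sqrD1 x : `|x| <= 1 + x ^+ 2.
Proof.
rewrite ler_norml; have := sqr_ge0 (x - 1); have := sqr_ge0 (x + 1).
by have := sqr_ge0 x; rewrite !expr2 => *; apply/andP; split; nra.
Qed.

Lemma normM_le_sqrD x y : `|x * y| <= x ^+ 2 + y ^+ 2.
Proof.
rewrite ler_norml; have := sqr_ge0 (x - y); have := sqr_ge0 (x + y).
have := sqr_ge0 x; have := sqr_ge0 y.
by rewrite !expr2 => *; apply/andP; split; nra.
Qed.

Lemma sqrD_le x y : (x + y) ^+ 2 <= 2 * x ^+ 2 + 2 * y ^+ 2.
Proof. by have := sqr_ge0 (x - y); rewrite !expr2 => ?; nra. Qed.

End elementary.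

(** * Expectations of real random variables *)

Section expectation.
Context d (T : measurableType d) (R : realType) (P : probability T R).
Implicit Types X Y Z : T -> R.

Definition integrable1 X := P.-integrable setT (EFin \o X).

Definition square_integrable X :=
  measurable_fun setT X /\ integrable1 (fun w => X w ^+ 2).

Definition mean X : R := \int[P]_w X w.

Lemma integrable1_measurable X : integrable1 X -> measurable_fun setT X.
Proof. by move=> /measurable_int/measurable_EFinP. Qed.

Lemma integrable1_le X Y : measurable_fun setT X ->
  (forall w, `|X w| <= Y w) -> integrable1 Y -> integrable1 X.
Proof.
move=> mX XY iY; apply: (le_integrable measurableT _ _ iY).
  exact/measurable_EFinP.
by move=> w _ /=; rewrite lee_fin (le_trans (XY w))// ler_norm.
Qed.

Lemma integrable1_cst c : integrable1 (fun=> c).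
Proof. exact: finite_measure_integrable_cst. Qed.

Lemma integrable1D X Y : integrable1 X -> integrable1 Y ->
  integrable1 (fun w => X w + Y w).
Proof. by move=> iX iY; have := integrableD measurableT iX iY. Qed.

Lemma integrable1Z c X : integrable1 X -> integrable1 (fun w => c * X w).
Proof. by move=> iX; have := integrableZl measurableT c iX. Qed.

Lemma integrable1B X Y : integrable1 X -> integrable1 Y ->
  integrable1 (fun w => X w - Y w).
Proof. by move=> iX iY; have := integrableB measurableT iX iY. Qed.

Lemma integrable1_norm X : integrable1 X -> integrable1 (fun w => `|X w|).
Proof. by move=> iX; have := integrable_norm iX. Qed.

Lemma integrable1_bounded X c : measurable_fun setT X ->
  (forall w, `|X w| <= c) -> integrable1 X.
Proof. by move=> mX Xc; apply: (integrable1_le mX Xc); exact: integrable1_cst. Qed.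

Lemma meanD X Y : integrable1 X -> integrable1 Y ->
  mean (fun w => X w + Y w) = mean X + mean Y.
Proof. by move=> iX iY; exact: RintegralD. Qed.

Lemma meanB X Y : integrable1 X -> integrable1 Y ->
  mean (fun w => X w - Y w) = mean X - mean Y.
Proof. by move=> iX iY; exact: RintegralB. Qed.

Lemma meanZ c X : integrable1 X -> mean (fun w => c * X w) = c * mean X.
Proof. by move=> iX; exact: RintegralZl. Qed.

Lemma mean_cst c : mean (fun=> c) = c.
Proof.
by rewrite /mean Rintegral_cst// [X in fine X]probability_setT mulr1.
Qed.

Lemma le_mean X Y : integrable1 X -> integrable1 Y ->
  (forall w, X w <= Y w) -> mean X <= mean Y.
Proof. by move=> iX iY XY; apply: le_Rintegral. Qed.

Lemma mean_ge0 X : (forall w, 0 <= X w) -> 0 <= mean X.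
Proof. by move=> X0; exact: Rintegral_ge0. Qed.

Lemma mean_norm X : integrable1 X -> `|mean X| <= mean (fun w => `|X w|).
Proof. by move=> iX; exact: le_normr_Rintegral. Qed.

Lemma mean_EFin X : integrable1 X -> (\int[P]_w (X w)%:E = (mean X)%:E)%E.
Proof.
by move=> iX; rewrite /mean fineK//; apply: integrable_fin_num.
Qed.

Lemma square_integrable1 X : square_integrable X -> integrable1 X.
Proof.
move=> [mX iX]; apply: (@integrable1_le _ (fun w => 1 + X w ^+ 2)) => //.
  by move=> w; exact: norm_le_sqrD1.
by apply: integrable1D => //; exact: integrable1_cst.
Qed.

Lemma square_integrableM X Y : square_integrable X -> square_integrable Y ->
  integrable1 (fun w => X w * Y w).
Proof.
move=> [mX iX] [mY iY].
apply: (@integrable1_le _ (fun w => X w ^+ 2 + Y w ^+ 2)) => //.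
- exact: measurable_funM.
- by move=> w; exact: normM_le_sqrD.
- exact: integrable1D.
Qed.

Lemma square_integrableD X Y : square_integrable X -> square_integrable Y ->
  square_integrable (fun w => X w + Y w).
Proof.
move=> [mX iX] [mY iY]; have mXY : measurable_fun setT (fun w => X w + Y w).
  exact: measurable_funD.
split=> //.
apply: (@integrable1_le _ (fun w => 2 * X w ^+ 2 + 2 * Y w ^+ 2)) => //.
- exact: measurable_funX.
- by move=> w; rewrite ger0_norm ?sqr_ge0// sqrD_le.
- by apply: integrable1D; exact: integrable1Z.
Qed.

Lemma square_integrable_bounded_mul c X Y : measurable_fun setT X ->
  (forall w, `|X w| <= c) -> square_integrable Y ->
  square_integrable (fun w => X w * Y w).
Proof.
move=> mX Xc [mY iY]; have mXY : measurable_fun setT (fun w => X w * Y w).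
  exact: measurable_funM.
split=> //; apply: (@integrable1_le _ (fun w => c ^+ 2 * Y w ^+ 2)) => //.
- exact: measurable_funX.
- move=> w; rewrite exprMn normrM [X in _ * X]ger0_norm ?sqr_ge0//.
  rewrite ler_wpM2r ?sqr_ge0// normrX lerXn2r ?nnegrE//.
  exact: le_trans (Xc w).
- exact: integrable1Z.
Qed.

Lemma square_integrable_bounded X c : measurable_fun setT X ->
  (forall w, `|X w| <= c) -> square_integrable X.
Proof.
move=> mX Xc; split=> //; apply: (@integrable1_bounded _ (c ^+ 2)).
  exact: measurable_funX.
move=> w; rewrite normrX lerXn2r ?nnegrE//; exact: le_trans (Xc w).
Qed.

Lemma square_integrableZ c X : square_integrable X ->
  square_integrable (fun w => c * X w).
Proof. by apply: (@square_integrable_bounded_mul `|c|). Qed.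

Lemma square_integrableB X Y : square_integrable X -> square_integrable Y ->
  square_integrable (fun w => X w - Y w).
Proof.
move=> sX sY; have := square_integrableD sX (square_integrableZ (-1) sY).
by congr square_integrable; apply/funext => w; rewrite mulN1r.
Qed.

Definition independent2 X Y := forall A B : set (R),
  measurable A -> measurable B ->
  (P (X @^-1` A `&` Y @^-1` B) = P (X @^-1` A) * P (Y @^-1` B))%E.

(** Independence says that the joint law is the product of the two laws. Tonelli's theorem for the
    absolute values gives integrability of the product, and then Fubini's theorem factors the
    mean. *)
Lemma independent2_mean X Y : integrable1 X -> integrable1 Y ->
  independent2 X Y ->
  integrable1 (fun w => X w * Y w) /\
  mean (fun w => X w * Y w) = mean X * mean Y.
Proof.
move=> iX iY indep.
have mX := integrable1_measurable iX; have mY := integrable1_measurable iY.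
pose X' : {mfun T >-> R} :=
  MeasurableFun.Pack (MeasurableFun.Class (isMeasurableFun.Build _ _ _ _ _ mX)).
pose Y' : {mfun T >-> R} :=
  MeasurableFun.Pack (MeasurableFun.Class (isMeasurableFun.Build _ _ _ _ _ mY)).
have mXY : measurable_fun setT
    (fun w => (X w, Y w) : R * R).
  by apply/measurable_fun_pairP.
pose XY' : {mfun T >-> (R * R)%type} :=
  MeasurableFun.Pack (MeasurableFun.Class (isMeasurableFun.Build _ _ _ _ _ mXY)).
pose mu1 : probability _ R := distribution P X'.
pose mu2 : probability _ R := distribution P Y'.
pose mu : probability _ R := distribution P XY'.
have muE : forall A, measurable A -> (mu1 \x mu2)%E A = mu A.
  by apply: product_measure_unique => A B mA mB; exact: indep.
pose m12 : {measure set _ -> \bar R} := (mu1 \x mu2)%E.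
pose f := fun z : R * R => z.1 * z.2.
have mf : measurable_fun setT f by apply: measurable_funM.
have mu1_norm : (\int[mu1]_x `|x%:E| = (mean (fun w => `|X w|))%:E)%E.
  rewrite ge0_integral_distribution//=; last exact: measurableT_comp.
  by rewrite -mean_EFin//; exact: integrable1_norm.
have mu2_norm : (\int[mu2]_x `|x%:E| = (mean (fun w => `|Y w|))%:E)%E.
  rewrite ge0_integral_distribution//=; last exact: measurableT_comp.
  by rewrite -mean_EFin//; exact: integrable1_norm.
have int12 : m12.-integrable setT (EFin \o f).
  apply/integrable12ltyP; first exact/measurable_EFinP.
  under eq_integral do (rewrite /=; under eq_integral do rewrite /f/= normrM EFinM).
  under eq_integral.
    move=> x _; rewrite ge0_integralZl//=; last exact: measurableT_comp.
    rewrite [X in (_ * X)%E]mu2_norm.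
    over.
  rewrite ge0_integralZr//=; last 2 first.
  - exact: measurableT_comp.
  - by rewrite lee_fin mean_ge0.
  by rewrite [X in (X * _)%E]mu1_norm -EFinM ltry.
have intmu : mu.-integrable setT (EFin \o f).
  apply/integrableP; split; first exact/measurable_EFinP.
  rewrite (eq_measure_integral m12); last by move=> A mA _; rewrite [RHS]muE.
  by case/integrableP : int12.
have intXY : integrable1 (fun w => X w * Y w).
  apply/integrableP; split; first exact/measurable_EFinP/measurable_funM.
  have := intmu => /integrableP[_]; rewrite ge0_integral_distribution//.
  by apply: measurableT_comp => //; exact/measurable_EFinP.
split=> //; apply: EFin_inj; rewrite -mean_EFin//.
have -> : (\int[P]_w (X w * Y w)%:E = \int[mu]_z (EFin \o f) z)%E.
  by rewrite integral_distribution//; exact/measurable_EFinP.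
rewrite (eq_measure_integral m12); last by move=> A mA _; rewrite [RHS]muE.
rewrite -integral12_prod_meas1//=.
have i1 : mu1.-integrable setT (EFin : R -> \bar R).
  by apply/integrableP; split=> //; rewrite mu1_norm ltry.
have i2 : mu2.-integrable setT (EFin : R -> \bar R).
  by apply/integrableP; split=> //; rewrite mu2_norm ltry.
have e2 : (\int[mu2]_x x%:E = (mean Y)%:E)%E.
  by rewrite integral_distribution// -mean_EFin.
have e1 : (\int[mu1]_x x%:E = (mean X)%:E)%E.
  by rewrite integral_distribution// -mean_EFin.
have eF x : (\int[mu2]_y (f (x, y))%:E = x%:E * (mean Y)%:E)%E.
  rewrite -e2 -integralZl//; apply: eq_integral => y _.
transitivity (\int[mu1]_x (x%:E * (mean Y)%:E))%E.
  by apply: eq_integral => x _; exact: eF.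
by rewrite integralZr// e1.
Qed.

End expectation.

(** * Moments of centred Gaussian variables *)

Section normal_moments.
Variable R : realType.
Implicit Types (s l : R) (f : R -> R).
Local Notation leb := (@lebesgue_measure R).

(** The Radon-Nikodym derivative of the law and [normal_pdf] have the same integrals over measurable
    sets, so they agree almost everywhere. *)
Lemma integral_normal_prob m s f : measurable_fun setT f ->
  (forall x, 0 <= f x) ->
  (\int[normal_prob m s]_x (f x)%:E =
   \int[leb]_x (f x * normal_pdf m s x)%:E)%E.
Proof.
move=> mf f0; pose nu : probability _ R := normal_prob m s.
have dom : nu `<< leb by exact: normal_prob_dominates.
rewrite -(@Radon_Nikodym_SigmaFinite.change_of_variables _ _ _ nu leb dom)//; last exact/measurable_EFinP.
have int_d := Radon_Nikodym_SigmaFinite.f_integrable dom.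
apply: ae_eq_integral => //.
- apply: emeasurable_funM; first exact/measurable_EFinP.
  exact: measurable_int int_d.
- apply/measurable_EFinP/measurable_funM => //; exact: measurable_normal_pdf.
- under [X in ae_eq _ _ _ X]eq_fun do rewrite EFinM.
  apply: ae_eqe_mul2l; apply: integral_ae_eq => //.
    by apply/measurable_EFinP; exact: measurable_normal_pdf.
  by move=> E _ mE; rewrite -(Radon_Nikodym_SigmaFinite.f_integral dom).
Qed.

(** Completing the square in the exponent turns the integrand into a constant times the density with
    mean [l * s ^+ 2], of total mass 1. *)
Lemma normal_mgf s l : s != 0 ->
  (\int[normal_prob 0 s]_x (expR (l * x))%:E = (expR (l ^+ 2 * s ^+ 2 / 2))%:E)%E.
Proof.
move=> s0; rewrite integral_normal_prob//; last first.
  by apply: measurableT_comp => //; exact: measurable_funM.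
transitivity (\int[leb]_x ((expR (l ^+ 2 * s ^+ 2 / 2))%:E *
    (normal_pdf (l * s ^+ 2) s x)%:E))%E.
  apply: eq_integral => x _; rewrite -EFinM; congr EFin.
  rewrite !normal_pdfE// mulrCA [RHS]mulrCA.
  congr (_ * _); rewrite -!expRD; congr expR.
  by field.
rewrite integralZl//; last exact: integrable_normal_pdf.
by rewrite integral_normal_pdf mule1.
Qed.

Lemma expR_norm_le (x : R) : expR `|x| <= expR x + expR (- x).
Proof.
have [x0|x0] := leP 0 x; first by rewrite ger0_norm// lerDl expR_ge0.
by rewrite ltr0_norm// lerDr expR_ge0.
Qed.

Lemma exprn_le_expR n (x : R) : `|x| ^+ n.+1 <= n.+1`!%:R * expR `|x|.
Proof.
have n0 : 0 < (n.+1)`!%:R :> R by rewrite ltr0n fact_gt0.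
rewrite -ler_pdivrMl// mulrC; apply: le_trans (expR_ge1Dxn n (normr_ge0 x)).
by rewrite lerDr.
Qed.

Let dexp : derivative (@expR R) expR.
Proof. by move=> x; exact: is_derive_expR. Qed.

Lemma expR_taylor1 (x : R) : `|expR x - 1 - x| <= expR `|x| * x ^+ 2.
Proof.
have := @taylor1 R expR expR expR (expR `|x|) 0 x dexp dexp.
rewrite add0r expR0 mul1r real_normK ?num_real//; apply => z.
by rewrite subr0 => zx; rewrite ger0_norm ?expR_ge0// ler_expR (le_trans _ zx)// ler_norm.
Qed.

Lemma expR_taylor2 (x : R) :
  `|expR x - 1 - x - x ^+ 2 / 2| <= expR `|x| * `|x| ^+ 3.
Proof.
have := @taylor2 R expR expR expR expR (expR `|x|) 0 x dexp dexp dexp.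
rewrite add0r expR0 !mul1r; apply => z.
by rewrite subr0 => zx; rewrite ger0_norm ?expR_ge0// ler_expR (le_trans _ zx)// ler_norm.
Qed.

Lemma le_linear_eq0 (a K : R) : (forall l, 0 < l <= 1 -> `|a| <= K * l) -> a = 0.
Proof.
move=> H; apply/eqP; rewrite -normr_le0; apply/ler_addgt0Pl => e e0; rewrite addr0.
have K0 : 0 <= K by have := H 1; rewrite mulr1 ltr01 lexx => /(_ isT); apply: le_trans.
pose l := Num.min 1 (e / (K + 1)).
have K1 : 0 < K + 1 by lra.
have l0 : 0 < l by rewrite lt_min ltr01 divr_gt0.
have l1 : l <= 1 by rewrite ge_min lexx.
apply: le_trans (H l _) _; first by rewrite l0.
have : l <= e / (K + 1) by rewrite ge_min lexx orbT.
rewrite ler_pdivlMr// => ?; nra.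
Qed.

End normal_moments.

Section gaussian.
Context d (T : measurableType d) (R : realType) (P : probability T R).
Variables (X : T -> R) (s : R).
Hypothesis mX : measurable_fun setT X.
Hypothesis s0 : 0 < s.
Hypothesis lawX : forall B : set R, measurable B -> P (X @^-1` B) = normal_prob 0 s B.

Lemma gaussian_integral (f : R -> R) : measurable_fun setT f ->
  (forall x, 0 <= f x) ->
  (\int[P]_w (f (X w))%:E = \int[normal_prob 0 s]_x (f x)%:E)%E.
Proof.
move=> mf f0.
have mX' : @measurable_fun _ _ T (measurableTypeR R) setT X by [].
pose X' : {mfun T >-> measurableTypeR R} :=
  MeasurableFun.Pack (MeasurableFun.Class (isMeasurableFun.Build _ _ _ _ _ mX')).
transitivity (\int[distribution P X']_x (f x)%:E)%E.
  by rewrite ge0_integral_distribution//; exact/measurable_EFinP.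
by apply: eq_measure_integral => A mA _; rewrite /= -lawX.
Qed.

Lemma gaussian_mgf l : integrable1 P (fun w => expR (l * X w)) /\
  mean P (fun w => expR (l * X w)) = expR (l ^+ 2 * s ^+ 2 / 2).
Proof.
have mf : measurable_fun setT (fun x : R => expR (l * x)).
  by apply: measurableT_comp => //; exact: measurable_funM.
have mfX : measurable_fun setT (fun w => expR (l * X w)).
  by apply: measurableT_comp => //; exact: measurable_funM.
have H : (\int[P]_w (expR (l * X w))%:E = (expR (l ^+ 2 * s ^+ 2 / 2))%:E)%E.
  by rewrite (gaussian_integral mf) ?normal_mgf ?gt_eqF// => x; exact: expR_ge0.
split; last by rewrite /mean /Rintegral H.
apply/integrableP; split; first exact/measurable_EFinP.
under eq_integral do rewrite /= ger0_norm ?expR_ge0//.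
by rewrite H ltry.
Qed.

Let cosh2 l w := expR (l * X w) + expR (- l * X w).

Let int_cosh2 l : integrable1 P (cosh2 l).
Proof. by apply: integrable1D; have [] := gaussian_mgf l; have [] := gaussian_mgf (- l). Qed.

Lemma gaussian_integrableX n : integrable1 P (fun w => X w ^+ n).
Proof.
case: n => [|n]; first exact: integrable1_cst.
apply: (@integrable1_le _ _ _ _ _ (fun w => n.+1`!%:R * cosh2 1 w)).
- exact: measurable_funX.
- move=> w; rewrite normrX (le_trans (exprn_le_expR _ _))// ler_wpM2l//.
  by rewrite /cosh2 mulN1r mul1r expR_norm_le.
- exact: integrable1Z.
Qed.

Lemma gaussian_square_integrable : square_integrable P X.
Proof. by split=> //; exact: gaussian_integrableX. Qed.

(** Both moments are read off the expansion of the moment generating function to second order in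
    [l]: adding the estimates for [l] and [- l] isolates the variance, and the mean follows. *)
Lemma gaussian_mean_sqr : mean P X = 0 /\ mean P (fun w => X w ^+ 2) = s ^+ 2.
Proof.
pose m := mean P X; pose v := mean P (fun w => X w ^+ 2).
have i1 : integrable1 P X by exact: square_integrable1 gaussian_square_integrable.
have i2 : integrable1 P (fun w => X w ^+ 2) := gaussian_integrableX 2.
(* For [|l| <= 1] the Taylor remainder is at most [|l|^3 * expR |X| * |X|^3], and
   [|X|^3 <= 3! * expR |X|]; whence the 6 and the exponent [2 |X|]. *)
pose K1 := 6 * mean P (cosh2 2).
have K10 : 0 <= K1 by rewrite mulr_ge0// mean_ge0// => w; rewrite addr_ge0// expR_ge0.
have main1 l : `|l| <= 1 ->
    `|expR (l ^+ 2 * s ^+ 2 / 2) - 1 - l * m - l ^+ 2 / 2 * v| <= K1 * `|l| ^+ 3.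
  move=> l1; have [ie <-] := gaussian_mgf l.
  have i3 := integrable1B (integrable1B (integrable1B ie (integrable1_cst P 1))
    (integrable1Z l i1)) (integrable1Z (l ^+ 2 / 2) i2).
  have <- : mean P (fun w => expR (l * X w) - 1 - l * X w - l ^+ 2 / 2 * X w ^+ 2) =
      mean P (fun w => expR (l * X w)) - 1 - l * m - l ^+ 2 / 2 * v.
    rewrite meanB ?meanB ?meanB ?meanZ ?mean_cst//;
      do ?[apply: integrable1B|apply: integrable1Z|exact: integrable1_cst|by []].
  apply: le_trans (mean_norm i3) _.
  have -> : K1 * `|l| ^+ 3 = mean P (fun w => 6 * `|l| ^+ 3 * cosh2 2 w).
    by rewrite meanZ// /K1; ring.
  apply: le_mean; [exact: integrable1_norm|exact: integrable1Z|move=> w].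
  have := expR_taylor2 (l * X w); rewrite exprMn mulrAC => /le_trans; apply.
  rewrite normrM exprMn mulrCA (_ : 6 * _ * _ = `|l| ^+ 3 * (6 * cosh2 2 w)).
    rewrite ler_wpM2l ?exprn_ge0//.
    have e1 : expR (`|l| * `|X w|) <= expR `|X w| by rewrite ler_expR ler_piMl.
    have e2 := exprn_le_expR 2 (X w).
    have : expR (2 * `|X w|) <= cosh2 2 w.
      rewrite -[2 in X in X <= _](@ger0_norm _ 2)// -normrM /cosh2 mulNr.
      exact: expR_norm_le.
    rewrite mulr2n mulrDl !mul1r expRD => e3.
    have x0 : 0 <= `|X w| ^+ 3 by rewrite exprn_ge0.
    have := expR_ge0 `|X w| => p0.
    apply: le_trans (ler_wpM2r x0 e1) _; apply: le_trans (ler_wpM2l p0 e2) _.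
    rewrite mulrCA (_ : 3`!%:R = 6%:R)// ler_wpM2l//.
  by ring.
pose K2 := expR (s ^+ 2 / 2) * (s ^+ 2 / 2) ^+ 2.
have K20 : 0 <= K2 by rewrite mulr_ge0 ?expR_ge0 ?sqr_ge0.
have main2 l : `|l| <= 1 ->
    `|expR (l ^+ 2 * s ^+ 2 / 2) - 1 - l ^+ 2 * s ^+ 2 / 2| <= K2 * `|l| ^+ 3.
  move=> l1; apply: le_trans (expR_taylor1 _) _.
  have s20 : 0 <= s ^+ 2 / 2 by rewrite divr_ge0 ?sqr_ge0.
  have l20 : 0 <= `|l| ^+ 2 by rewrite sqr_ge0.
  have l21 : `|l| ^+ 2 <= 1 by rewrite exprn_ile1.
  rewrite -mulrA; have -> : l ^+ 2 = `|l| ^+ 2 by rewrite real_normK ?num_real.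
  rewrite ger0_norm; last by rewrite mulr_ge0.
  have e1 : expR (`|l| ^+ 2 * (s ^+ 2 / 2)) <= expR (s ^+ 2 / 2).
    by rewrite ler_expR ler_piMl.
  have -> : K2 * `|l| ^+ 3 = expR (s ^+ 2 / 2) * ((s ^+ 2 / 2) ^+ 2 * `|l| ^+ 3).
    by rewrite /K2 mulrA.
  apply: ler_pM e1 _; [exact: expR_ge0|exact: sqr_ge0|].
  rewrite (_ : (`|l| ^+ 2 * (s ^+ 2 / 2)) ^+ 2 = (s ^+ 2 / 2) ^+ 2 * `|l| ^+ 4); last by ring.
  by apply: ler_wpM2l; [exact: sqr_ge0|rewrite ler_wiXn2l].
have main l : `|l| <= 1 ->
    `|l * m + l ^+ 2 / 2 * (v - s ^+ 2)| <= (K1 + K2) * `|l| ^+ 3.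
  move=> l1; have := lerD (main1 l l1) (main2 l l1).
  rewrite -mulrDl; apply: le_trans; rewrite [leRHS]addrC.
  apply: le_trans (ler_normB _ _); rewrite le_eqVlt; apply/orP; left.
  by apply/eqP; congr `|_|; field.
have vs : v - s ^+ 2 = 0.
  apply: (@le_linear_eq0 _ _ (2 * (K1 + K2))) => l /andP[l0 l1].
  have l1' : `|l| <= 1 by rewrite gtr0_norm.
  have := main l l1'; have := main (- l); rewrite normrN => /(_ l1').
  rewrite (gtr0_norm l0) sqrrN mulNr => h1 h2.
  have := lerD h1 h2 => /(le_trans (ler_normD _ _)).
  have -> : - (l * m) + l ^+ 2 / 2 * (v - s ^+ 2) +
    (l * m + l ^+ 2 / 2 * (v - s ^+ 2)) = l ^+ 2 * (v - s ^+ 2) by field.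
  rewrite normrM ger0_norm ?sqr_ge0// => h3.
  have l20 : 0 < l ^+ 2 by rewrite exprn_gt0.
  rewrite -(ler_pM2l l20); apply: le_trans h3 _.
  by rewrite le_eqVlt; apply/orP; left; apply/eqP; ring.
split; last by apply/eqP; rewrite -subr_eq0; apply/eqP.
apply: (@le_linear_eq0 _ _ (K1 + K2)) => l /andP[l0 l1].
have := main l; rewrite vs mulr0 addr0 normrM (gtr0_norm l0) => /(_ l1) h.
rewrite -(ler_pM2l l0); apply: le_trans h _.
have -> : l * ((K1 + K2) * l) = (K1 + K2) * l ^+ 2 by ring.
by rewrite ler_wpM2l ?addr_ge0// ler_wiXn2l// ltW.
Qed.

(** The bound [x^4 <= 4! * expR |x|] is used at [x = X / s], where the generating function equals
    [expR 2^-1]. The two signs of [x] double 24 to 48. *)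
Lemma gaussian_mean4 :
  mean P (fun w => X w ^+ 4) <= 48 * expR 2^-1 * s ^+ 4.
Proof.
have [i1 e1] := gaussian_mgf s^-1; have [i2 e2] := gaussian_mgf (- s^-1).
have -> : 48 * expR 2^-1 * s ^+ 4 = mean P (fun w => 24 * s ^+ 4 * cosh2 s^-1 w).
  rewrite meanZ// meanD// e1 e2 sqrrN.
  rewrite (_ : s^-1 ^+ 2 * s ^+ 2 = 1) ?mul1r; first by ring.
  by rewrite -exprMn mulVf ?expr1n// gt_eqF.
apply: le_mean; [exact: gaussian_integrableX|exact: integrable1Z|move=> w].
have := exprn_le_expR 3 (s^-1 * X w); rewrite -normrX ger0_norm ?exprn_even_ge0//.
rewrite exprMn exprVn ler_pdivrMl ?exprn_gt0// => /le_trans; apply.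
rewrite mulrCA mulrA (_ : 4`!%:R = 24%:R)//; apply: ler_wpM2l.
  by rewrite mulr_ge0// exprn_ge0// ltW.
by rewrite /cosh2 mulNr expR_norm_le.
Qed.

End gaussian.

(** * Independence of an increment from the past *)

Section independence_extension.
Context d (T : measurableType d) (R : realType) (P : probability T R).

(** As functions of [A], both sides are finite measures, [P] restricted to [E] and a multiple of
    [P]. They agree on the pi-system [G], hence on the sigma-algebra it generates. *)
Lemma independent_sigma_algebra (G : set (set T)) (E : set T) :
  G `<=` measurable -> G setT -> setI_closed G -> measurable E ->
  (forall A, G A -> P (A `&` E) = (P A * P E)%E) ->
  forall A, <<s G >> A -> P (A `&` E) = (P A * P E)%E.
Proof.
move=> Gm GT GI mE PAE A sGA.
have PE0 : 0 <= fine (P E) by rewrite fine_ge0.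
have PEfin : P E \is a fin_num by exact: fin_num_measure.
pose m1 : {measure set T -> \bar R} := mrestr P mE.
pose m2 : {measure set T -> \bar R} := mscale (NngNum PE0) P.
have cover : \bigcup_(k in @setT nat) (@setT T) = setT.
  by rewrite bigcup_const; [|exists 0%N].
have m12 B : G B -> m1 B = m2 B.
  by move=> GB; rewrite /m1/= /mrestr PAE// /mscale/= fineK// muleC.
have m1oo (k : nat) : (m1 setT < +oo)%E.
  by rewrite -ge0_fin_numE// /m1/= /mrestr setTI.
have := @g_sigma_algebra_measure_unique _ R T G Gm (fun=> setT) (fun=> GT)
  cover m1 m2 GI m12 m1oo A sGA.
by rewrite /= /mrestr /mscale/= fineK// muleC.
Qed.

End independence_extension.

Section brownian.
Variables (R : realType) (P : probability (wiener_space R) R).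
Hypothesis hP : wiener_measure P.
Local Notation Om := (wiener_space R).

(** The topology of [path_space] is initial for the inclusion, and uniform convergence on compact
    sets implies pointwise convergence. *)
Lemma continuous_evaluation (t : R) :
  continuous (fun w : path_space R => (set_val w : R -> R) t).
Proof.
move=> w.
have c1 := @initial_continuous (path_space R) _
  (set_val : path_space R -> {family compact, R -> R}) w.
have c2 := @pointwise_cvg_compact_family R R (set_val @ w) (set_val w) _ c1.
have c3 := @proj_continuous R (fun=> R) t (set_val w).
apply: (cvg_comp _ _ (c2 _) c3).
apply: (@fmap_filter _ _ _ (nbhs w)).
Qed.

Lemma measurable_bm t : measurable_fun setT (bm t : Om -> R).
Proof.
apply: (measurability _ (RGenOInfty.measurableE R)) => _ [_ [x ->] <-].
rewrite setTI; apply: sub_sigma_algebra.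
have /continuousP := @continuous_evaluation t; apply.
exact: interval_open.
Qed.

Lemma bm0 (w : Om) : bm 0 w = 0.
Proof.
have [_] : is_path (set_val w) by apply: set_mem; exact: (valP w).
by apply.
Qed.

Definition increment s t (w : Om) : R := bm t w - bm s w.

Lemma measurable_increment s t : measurable_fun setT (increment s t).
Proof. by apply: measurable_funB; exact: measurable_bm. Qed.

Lemma increment_law s t (B : set R) : 0 <= s -> s < t -> measurable B ->
  P (increment s t @^-1` B) = normal_prob 0 (Num.sqrt (t - s)) B.
Proof.
move=> s0 st mB.
(* [wiener_measure] speaks of an infinite increasing sequence of times, so [s < t] is completed to
   an arithmetic progression. *)
have := @hP 1 (fun i => s + i%:R * (t - s)) (fun=> B).
rewrite mul0r addr0 big_ord1 /= mul0r mul1r addr0 subrKC => <- //.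
- congr (P _); apply/seteqP; split => w /=.
    by move=> wB [|//] _; rewrite mul0r mul1r addr0 subrKC.
  by move=> /(_ 0%N isT); rewrite mul0r mul1r addr0 subrKC.
- by move=> i; rewrite ltrD2l ltr_pM2r ?subr_gt0// ltr_nat.
Qed.

Section grid.
Variables (tau : nat -> R) (n : nat) (t : R) (B : set R).
Hypotheses (tau0 : tau 0 = 0) (tauS : forall i, tau i < tau i.+1).
Hypotheses (taut : tau n < t) (mB : measurable B).

Let tau_ge0 i : 0 <= tau i.
Proof. by elim: i => [|i IHi]; rewrite ?tau0//; apply: le_trans IHi (ltW _). Qed.

Let rect (D : nat -> set R) :=
  [set w : Om | forall i, (i < n)%N -> D i (increment (tau i) (tau i.+1) w)].

Let rects := [set A | exists D, (forall i, measurable (D i)) /\ A = rect D].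

Let measurable_rect D : (forall i, measurable (D i)) -> measurable (rect D).
Proof.
move=> mD; rewrite (_ : rect D = \bigcap_(i in `I_n)
    (increment (tau i) (tau i.+1) @^-1` D i)) //.
apply: bigcap_measurableType => i _.
by rewrite -[X in measurable X]setTI; exact: measurable_increment.
Qed.

Let indep_rect D : (forall i, measurable (D i)) ->
  P (rect D `&` increment (tau n) t @^-1` B) =
  (P (rect D) * P (increment (tau n) t @^-1` B))%E.
Proof.
move=> mD.
(* The grid is followed up to [tau n] and then continued with step [t - tau n], so that increment
   number [n] is the one from [tau n] to [t]. *)
pose tau' i := if (i <= n)%N then tau i else tau n + (i - n)%:R * (t - tau n).
pose D' i := if (i < n)%N then D i else B.
have t'0 : 0 <= tau' 0 by rewrite /tau' leq0n tau0.
have t'S i : tau' i < tau' i.+1.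
  rewrite /tau'; case: (ltngtP i n) => [//|ni|->].
    by rewrite ltrD2l ltr_pM2r ?subr_gt0// ltr_nat ltn_sub2r// ltnS ltnW.
  by rewrite subSnn mul1r subrKC.
have mD' i : measurable (D' i) by rewrite /D'; case: ifP.
have -> : rect D `&` increment (tau n) t @^-1` B =
    [set w | forall i, (i < n.+1)%N -> D' i (bm (tau' i.+1) w - bm (tau' i) w)].
  apply/seteqP; split => [w [wD wB] i|w wD].
    rewrite ltnS /D' /tau'; case: ltngtP => // [ni _|-> _]; first exact: wD.
    by rewrite subSnn mul1r subrKC.
  split=> [i ni|].
    by have := wD i (ltnW ni); rewrite /D' /tau' ni (ltnW ni).
  by have := wD n (leqnn _); rewrite /D' /tau' ltnn leqnn subSnn mul1r subrKC.
rewrite (hP _ t'0 t'S mD') big_ord_recr/= /D' ltnn /tau' ltnn leqnn subSnn mul1r subrKC.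
rewrite increment_law//; congr (_ * _)%E.
have t00 : 0 <= tau 0 by rewrite tau0.
have -> : P (rect D) =
    (\prod_(i < n) normal_prob 0 (Num.sqrt (tau i.+1 - tau i)) (D i))%E.
  exact: (hP n t00 tauS mD).
apply: eq_bigr => i _.
by rewrite ltn_ord (ltnW (ltn_ord i)).
Qed.

(** Since paths start at 0, the value at a grid time is a sum of earlier increments. It is therefore
    measurable for the sigma-algebra generated by the rectangles, a pi-system independent of the
    next increment. *)
Lemma grid_independent (k : nat) (u : nat -> R) (D : nat -> set R) :
  (forall j, (j < k)%N -> exists2 i, (i <= n)%N & u j = tau i) ->
  (forall j, measurable (D j)) ->
  let A := [set w : Om | forall j, (j < k)%N -> D j (bm (u j) w)] in
  P (A `&` increment (tau n) t @^-1` B) =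
  (P A * P (increment (tau n) t @^-1` B))%E.
Proof.
move=> uk mD A.
have mE : measurable (increment (tau n) t @^-1` B).
  by rewrite -[X in measurable X]setTI; exact: measurable_increment.
apply: (@independent_sigma_algebra _ _ _ P rects) => //.
- by move=> _ [D' [mD' ->]]; exact: measurable_rect.
- by exists (fun=> setT); split=> //; apply/seteqP; split.
- move=> _ _ [D1 [mD1 ->]] [D2 [mD2 ->]]; exists (fun i => D1 i `&` D2 i).
  split=> [i|]; first exact: measurableI.
  by apply/seteqP; split=> w /= => [[h1 h2] i ni|h]; [split; [exact: h1|exact: h2]|
    split=> i ni; have [] := h i ni].
- by move=> _ [D' [mD' ->]]; exact: indep_rect.
have mW i : (i <= n)%N ->
    @measurable_fun _ _ (g_sigma_algebraType rects) R setT (bm (tau i)).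
  elim: i => [_|i IHi ni].
    rewrite (_ : bm (tau 0) = cst 0)//.
    by apply/funext => w; rewrite tau0 bm0.
  rewrite (_ : bm (tau i.+1) =
      (fun w => increment (tau i) (tau i.+1) w + bm (tau i) w)); last first.
    by apply/funext => w; rewrite /increment subrK.
  apply: measurable_funD; last exact: IHi (ltnW ni).
  move=> _ C mC; rewrite setTI; apply: sub_sigma_algebra.
  exists (fun j => if j == i then C else setT); split=> [j|]; first by case: ifP.
  apply/seteqP; split=> w /=; first by move=> wC j _; case: eqP => [->|].
  by move=> /(_ i ni); rewrite eqxx.
have -> : A = \bigcap_(j in `I_k) (bm (u j) @^-1` D j) by [].
suff : @measurable _ (g_sigma_algebraType rects) (\bigcap_(j in `I_k) (bm (u j) @^-1` D j)) by [].
apply: bigcap_measurableType => j /uk [i ni ->].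
by rewrite -[X in measurable X]setTI; exact: mW.
Qed.

End grid.

(** The given times are sorted together with 0 and [s], without repetition; unit steps beyond [s]
    make the sequence infinite. *)
Lemma exists_grid (s : R) (us : seq R) : 0 <= s ->
  (forall u, u \in us -> 0 <= u <= s) ->
  exists tau n, [/\ tau 0 = 0, forall i, tau i < tau i.+1, tau n = s &
    forall u, u \in us -> exists2 i, (i <= n)%N & u = tau i].
Proof.
move=> s0 us0; pose l := sort <=%R (undup [:: 0, s & us]).
have lP u : (u \in l) = (u \in [:: 0, s & us]) by rewrite mem_sort mem_undup.
have lb u : u \in l -> 0 <= u <= s.
  by rewrite lP !inE => /or3P[/eqP->|/eqP->|/us0//]; rewrite lexx ?s0.
have l_gt0 : (0 < size l)%N.
  by have : 0 \in l; [rewrite lP inE eqxx|case: (l)].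
have l_sorted : sorted <%R l by rewrite sort_lt_sorted undup_uniq.
have lmem i : (i < size l)%N -> nth 0 l i \in l by exact: mem_nth.
have lmono : {in [pred i | (i < size l)%N] &, {mono nth 0 l : i j / (i <= j)%N >-> i <= j}}.
  exact: lt_sorted_leq_nth.
pose n := (size l).-1.
have nl : (n < size l)%N by rewrite /n prednK.
pose tau i := if (i <= n)%N then nth 0 l i else s + (i - n)%:R.
exists tau, n.
have idx u : u \in l -> exists2 i, (i <= n)%N & u = tau i.
  move=> ul; exists (index u l).
    by rewrite -ltnS /n prednK// index_mem.
  by rewrite /tau -ltnS /n prednK// index_mem ul nth_index.
have taun : tau n = s.
  rewrite /tau leqnn; apply/eqP; rewrite eq_le.
  have /andP[_ ->] := lb _ (lmem _ nl).
  have [|i ni] := idx s; first by rewrite lP !inE eqxx orbT.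
  rewrite /tau ni => ->; rewrite lmono// inE//.
  by rewrite (leq_ltn_trans ni).
split=> //.
- rewrite /tau leq0n; apply/eqP; rewrite eq_le.
  have /andP[-> _] := lb _ (lmem 0%N l_gt0); rewrite andbT.
  have [|i ni] := idx 0; first by rewrite lP !inE eqxx.
  rewrite /tau ni => e; rewrite [leRHS]e lmono// inE//.
  by rewrite (leq_ltn_trans ni).
- move=> i; have [ni|ni] := ltnP i n.
    rewrite /tau ni (ltnW ni) lt_sorted_ltn_nth// inE//.
      exact: ltn_trans ni nl.
    exact: leq_ltn_trans nl.
  rewrite {2}/tau ltnNge ni/=; move: ni; rewrite leq_eqVlt => /predU1P[<-|ni].
    by rewrite taun subSnn ltrDl.
  by rewrite /tau leqNgt ni/= ltrD2l ltr_nat subSn// ltnW.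
- by move=> u uus; apply: idx; rewrite lP !inE uus !orbT.
Qed.

(** Unlike the sets that constrain the path at a single time, these are stable under intersection,
    and they generate the filtration up to null sets. *)
Definition cylinders (s : R) : set (set Om) :=
  [set A | exists k (u : nat -> R) (D : nat -> set R),
    [/\ forall j, 0 <= u j <= s, forall j, measurable (D j) &
        A = [set w | forall j, (j < k)%N -> D j (bm (u j) w)]]].

Lemma measurable_cylinders s : cylinders s `<=` measurable.
Proof.
move=> _ [k [u [D [_ mD ->]]]].
rewrite (_ : [set w | _] = \bigcap_(j in `I_k) (bm (u j) @^-1` D j))//.
apply: bigcap_measurableType => j _.
by rewrite -[X in measurable X]setTI; exact: measurable_bm.
Qed.

Lemma cylinders_independent s t (B : set R) A : 0 <= s -> s < t -> measurable B ->
  <<s cylinders s >> A ->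
  P (A `&` increment s t @^-1` B) = (P A * P (increment s t @^-1` B))%E.
Proof.
move=> s0 st mB; apply: independent_sigma_algebra.
- exact: measurable_cylinders.
- exists 0%N, (fun=> 0), (fun=> setT); split=> //; first by rewrite lexx s0.
  by apply/seteqP; split.
- move=> _ _ [k1 [u1 [D1 [hu1 mD1 ->]]]] [k2 [u2 [D2 [hu2 mD2 ->]]]].
  exists (k1 + k2)%N, (fun j => if (j < k1)%N then u1 j else u2 (j - k1)%N),
    (fun j => if (j < k1)%N then D1 j else D2 (j - k1)%N); split.
  + by move=> j; case: ifP.
  + by move=> j; case: ifP.
  + apply/seteqP; split=> [w [h1 h2] j jk|w h].
      case: ifPn => [|]; first exact: h1.
      by rewrite -leqNgt => kj; apply: h2; rewrite ltn_subLR.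
    split=> j jk /=; first by have := h j (ltn_addr _ jk); rewrite jk.
    have := h (k1 + j)%N; rewrite ltn_add2l => /(_ jk).
    by rewrite ltnNge leq_addr/= addKn.
- by rewrite -[X in measurable X]setTI; exact: measurable_increment.
- move=> _ [k [u [D [hu mD ->]]]].
  have [|tau [n [tau0 tauS taun taui]]] := @exists_grid s (mkseq u k) s0.
    by move=> v /mapP[j _ ->].
  rewrite -taun; apply: grid_independent => //; first by rewrite taun.
  by move=> j jk; apply: taui; apply/mapP; exists j => //; rewrite mem_iota.
Qed.

(** The generating class of [brownian_filtration], isolated in order to build a measurable type from
    it: the closure rules for measurable functions then hold for functions known at time [t]. *)
Definition filtration_generators (t : R) : set (set Om) :=
  [set A | (exists s (B : set (measurableTypeR R)),
              [/\ 0 <= s <= t, measurable B & A = bm s @^-1` B])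
           \/ P.-negligible A].

Definition filtration_type (t : R) := g_sigma_algebraType (filtration_generators t).

Definition filtration_measurable t (X : Om -> R) :=
  @measurable_fun _ _ (filtration_type t) R setT X.

Definition symdiff (A B : set Om) := (A `\` B) `|` (B `\` A).

(** The sets that differ from a member of [<<s cylinders t >>] by a null set form a sigma-algebra,
    and it contains both kinds of generators. *)
Lemma filtration_symdiff t A : brownian_filtration P t A ->
  exists2 A', <<s cylinders t >> A' & P.-negligible (symdiff A A').
Proof.
pose K := [set B | exists2 A', <<s cylinders t >> A' & P.-negligible (symdiff B A')].
suff : brownian_filtration P t `<=` K by apply.
apply: smallest_sub => {A}; last first.
  move=> B' [[s [B [st mB ->]]]|negA].
    exists (bm s @^-1` B); last by rewrite /symdiff setDv setU0; exact: negligible_set0.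
    apply: sub_sigma_algebra; exists 1%N, (fun=> s), (fun=> B); split=> //.
    by apply/seteqP; split=> w /=; [move=> ? []|move/(_ 0%N isT)].
  by exists set0; [exact: sigma_algebra0|rewrite /symdiff setD0 set0D setU0].
split.
- exists set0; first exact: sigma_algebra0.
  by rewrite /symdiff setDv setU0; exact: negligible_set0.
- move=> A [A' sA' neg]; exists (~` A').
    by rewrite -setTD; exact: sigma_algebraCD.
  rewrite (_ : symdiff _ _ = symdiff A A')//.
  rewrite /symdiff; apply/seteqP; split=> w /=;
    by have [Aw|nAw] := pselect (A w); have [A'w|nA'w] := pselect (A' w); tauto.
- move=> F HF.
  have [F' F'P] : {F' : nat -> set Om & forall n,
      <<s cylinders t >> (F' n) /\ P.-negligible (symdiff (F n) (F' n))}.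
    by apply: (@choice _ _ (fun n A' => <<s cylinders t >> A' /\ P.-negligible (symdiff (F n) A'))) => n; have [A' ? ?] := HF n; exists A'.
  exists (\bigcup_n F' n).
    by apply: sigma_algebra_bigcup => n; have [] := F'P n.
  apply: (@negligibleS _ _ _ P (\bigcup_n symdiff (F n) (F' n))); last first.
    by apply: negligible_bigcup => n; have [] := F'P n.
  move=> w [[[n _ Fn] nF']|[[n _ F'n] nF]]; exists n => //.
    by left; split=> // F'n; apply: nF'; exists n.
  by right; split=> // Fn; apply: nF; exists n.
Qed.

Lemma symdiff_measure A B : measurable A -> measurable B ->
  P.-negligible (symdiff A B) -> P A = P B.
Proof.
move=> mA mB.
have mAB : measurable (symdiff A B) by apply: measurableU; exact: measurableD.
move/(negligibleP _ mAB) => PAB.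
apply/eqP; rewrite eq_le; apply/andP; split.
  rewrite -[leRHS]adde0 -PAB; apply: (@le_trans _ _ (P (B `|` symdiff A B))).
    apply: le_measure; rewrite ?inE//; first exact: measurableU.
    by move=> w Aw; have [Bw|nBw] := pselect (B w); [left|right; left].
  exact: measureU2.
rewrite -[leRHS]adde0 -PAB; apply: (@le_trans _ _ (P (A `|` symdiff A B))).
  apply: le_measure; rewrite ?inE//; first exact: measurableU.
  by move=> w Bw; have [Aw|nAw] := pselect (A w); [left|right; right].
exact: measureU2.
Qed.

(** Only the class of [A] modulo null sets matters, so [A] is replaced by a set generated by
    cylinders. Measurability of [A] is a separate assumption, for a null set adjoined to the
    filtration need not be Borel. *)
Lemma filtration_independent s t A (B : set R) : 0 <= s -> s < t ->
  brownian_filtration P s A -> measurable A -> measurable B ->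
  P (A `&` increment s t @^-1` B) = (P A * P (increment s t @^-1` B))%E.
Proof.
move=> s0 st /filtration_symdiff [A' sA' neg] mA mB.
have mA' : measurable A'.
  apply: (smallest_sub _ _ sA'); first exact: sigma_algebra_measurable.
  exact: measurable_cylinders.
have mE : measurable (increment s t @^-1` B).
  by rewrite -[X in measurable X]setTI; exact: measurable_increment.
rewrite (symdiff_measure mA mA' neg) -cylinders_independent//.
apply: symdiff_measure; [exact: measurableI|exact: measurableI|].
by apply: negligibleS neg => w; rewrite /symdiff/=; tauto.
Qed.

Lemma increment_independent s t X : 0 <= s -> s < t ->
  measurable_fun setT X -> filtration_measurable s X ->
  independent2 P X (increment s t).
Proof.
move=> s0 st mX fX A B mA mB; apply: filtration_independent => //.
  by have := fX measurableT A mA; rewrite setTI.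
by rewrite -[X in measurable X]setTI; exact: mX.
Qed.

End brownian.

(** * Limits in probability with bounded second moments *)

Section limits_in_mean.
Context d (T : measurableType d) (R : realType) (P : probability T R).
Implicit Types X Y S I : T -> R.

Lemma mean_fatou (F : nat -> T -> R) (G : T -> R) (K : R) :
  (forall n, measurable_fun setT (F n)) -> (forall n w, 0 <= F n w) ->
  (forall n, integrable1 P (F n)) -> (forall n, mean P (F n) <= K) ->
  (forall w, F ^~ w @ \oo --> G w) ->
  integrable1 P G /\ mean P G <= K.
Proof.
move=> mF F0 iF FK FG.
have G0 w : 0 <= G w.
  rewrite -(cvg_lim _ (FG w))//; apply: limr_ge; first exact: cvgP (FG w).
  exact: nearW.
have mG : measurable_fun setT G.
  by apply: (measurable_fun_cvg mF) => w _; exact: FG.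
have le : (\int[P]_w (G w)%:E <= K%:E)%E.
  have := @fatou _ _ _ P setT measurableT (fun n w => (F n w)%:E).
  move=> /(_ (fun n => (measurable_EFinP _ _).2 (mF n)) _)/=.
  have -> : (fun w => limn_einf (fun n => (F n w)%:E)) = (fun w => (G w)%:E).
    apply/funext => w; have H : (F n w)%:E @[n --> \oo] --> (G w)%:E.
      by apply: cvg_EFin; [exact: nearW|exact: FG].
    by have [-> _] := cvg_limn_einf_sup H.
  move=> /(_ _)/le_trans; apply.
    by move=> n w _; rewrite lee_fin.
  rewrite limn_einf_lim; apply: lime_le; first exact: is_cvg_einfs.
  apply: nearW => n; apply: ereal_inf_le.
  exists (\int[P]_w (F n w)%:E)%E; first by exists n => /=.
  by rewrite mean_EFin// lee_fin.
have iG : integrable1 P G.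
  apply/integrableP; split; first exact/measurable_EFinP.
  under eq_integral do rewrite /= ger0_norm//.
  by rewrite (le_lt_trans le)// ltry.
by split=> //; move: le; rewrite mean_EFin// lee_fin.
Qed.

Lemma mean_indic (A : set T) : measurable A ->
  integrable1 P (\1_A) /\ (mean P (\1_A : T -> R))%:E = P A.
Proof.
move=> mA; split.
  apply: (@integrable1_bounded _ _ _ _ _ 1); first exact: measurable_indic.
  by move=> w; rewrite indicE; case: (_ \in _); rewrite ?normr1 ?normr0.
by rewrite /mean /Rintegral integral_indic// setIT fineK// fin_num_measure.
Qed.

(* [Q] carries a property shared by the approximations [S] of [I] *)
Definition approximable (K : R) (Q : (T -> R) -> Prop) I :=
  forall e k : R, 0 < e -> 0 < k -> exists S,
    [/\ square_integrable P S, mean P (fun w => S w ^+ 2) <= K, Q S &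
        (P [set w | e <= `|S w - I w|]%R <= k%:E)%E].

Lemma measurable_deviation X Y (e : R) : measurable_fun setT X -> measurable_fun setT Y ->
  measurable [set w | e <= `|X w - Y w|].
Proof.
move=> mX mY; rewrite -[X in measurable X]setTI.
apply: (@measurable_fun_le _ _ _ setT (cst e) (fun w => `|X w - Y w|)) => //.
by apply: measurableT_comp => //; exact: measurable_funB.
Qed.

Lemma le0_linear_eq (a b C : R) : (forall e, 0 < e -> a <= b + C * e) -> a <= b.
Proof.
move=> H; apply/ler_addgt0Pl => e e0.
pose c := `|C| + 1; have c0 : 0 < c by rewrite ltr_wpDl.
have := H (e / c) (divr_gt0 e0 c0); rewrite addrC => /le_trans; apply.
rewrite lerD2r mulrA ler_pdivrMr// mulrC ler_pM2l//.
by rewrite (le_trans (ler_norm _))// lerDl.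
Qed.

(** The second moment of the truncation of [I] at level [n] is compared with that of an
    approximation, the bad event contributing at most [n^2] times its probability; Fatou's lemma
    removes the truncation. The factor 2 comes from [sqrD_le]. *)
Lemma approximable_square K Q I : measurable_fun setT I -> approximable K Q I ->
  square_integrable P I /\ mean P (fun w => I w ^+ 2) <= 2 * K.
Proof.
move=> mI appr.
pose F n w := Num.min `|I w| n%:R ^+ 2.
have mmin n : measurable_fun setT (fun w => Num.min `|I w| n%:R).
  by apply: measurable_minr => //; exact: measurableT_comp.
have mF n : measurable_fun setT (F n) by exact: measurable_funX.
have F0 n w : 0 <= F n w by exact: sqr_ge0.
have iF n : integrable1 P (F n).
  apply: (@integrable1_bounded _ _ _ _ _ (n%:R ^+ 2)) => // w.
  have m0 : 0 <= Num.min `|I w| n%:R by rewrite le_min normr_ge0 ler0n.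
  by rewrite ger0_norm// lerXn2r ?nnegrE// ge_min lexx orbT.
have FK n : mean P (F n) <= 2 * K.
  apply: (@le0_linear_eq _ _ (2 + 2 * n%:R ^+ 2)) => e e0.
  pose e' := Num.min e 1.
  have e'0 : 0 < e' by rewrite lt_min e0 ltr01.
  have [S [sS SK _ PS]] := appr e' e e'0 e0.
  have [mS iS] := sS.
  have mA := measurable_deviation e' mS mI.
  set A := [set w | _] in PS mA.
  have [i1 m1] := mean_indic mA.
  have m1e : mean P (\1_A : T -> R) <= e by rewrite -lee_fin m1.
  have bound w : F n w <= 2 * S w ^+ 2 + (2 * e + 2 * n%:R ^+ 2 * \1_A w).
    have n0 : 0 <= n%:R :> R by [].
    have tri : `|I w| <= `|S w| + `|S w - I w|.
      have {1}-> : I w = S w - (S w - I w) by ring.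
      exact: ler_normB.
    have mn : 0 <= Num.min `|I w| n%:R by rewrite le_min normr_ge0.
    have [Aw|nAw] := pselect (A w); rewrite indicE.
      rewrite mem_set// mulr1.
      have : F n w <= n%:R ^+ 2.
        by rewrite lerXn2r ?nnegrE// ge_min lexx orbT.
      have := sqr_ge0 (S w); have : 0 <= n%:R ^+ 2 :> R by rewrite sqr_ge0.
      by move: (n%:R ^+ 2) (F n w) (S w ^+ 2) => *; lra.
    rewrite memNset// mulr0 addr0.
    have lt1 : `|S w - I w| <= e' by move/negP : nAw; rewrite -ltNge => /ltW.
    have e'e : e' ^+ 2 <= e.
      have h1 : e' <= e by rewrite ge_min lexx.
      have h2 : e' <= 1 by rewrite ge_min lexx orbT.
      by rewrite expr2; nra.
    have h : Num.min `|I w| n%:R <= `|S w| + e'.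
      by rewrite ge_min (le_trans tri)// lerD2l.
    have : F n w <= (`|S w| + e') ^+ 2.
      by rewrite lerXn2r ?nnegrE// addr_ge0// ltW.
    move/le_trans; apply; apply: le_trans (sqrD_le _ _) _.
    by rewrite real_normK ?num_real// lerD2l ler_wpM2l.
  have iR : integrable1 P (fun w => 2 * e + 2 * n%:R ^+ 2 * \1_A w).
    by apply: integrable1D; [exact: integrable1_cst|exact: integrable1Z].
  have := le_mean (iF n) (integrable1D (integrable1Z 2 iS) iR) bound.
  rewrite (meanD (integrable1Z 2 iS) iR) (meanZ 2 iS).
  rewrite (meanD (integrable1_cst P (2 * e)) (integrable1Z _ i1)) mean_cst (meanZ _ i1).
  move=> /le_trans; apply.
  have -> : (2 + 2 * n%:R ^+ 2) * e = 2 * e + 2 * n%:R ^+ 2 * e by ring.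
  apply: lerD; first by rewrite ler_wpM2l.
  by rewrite lerD2l ler_wpM2l// mulr_ge0// sqr_ge0.
have FI w : F ^~ w @ \oo --> I w ^+ 2.
  apply: cvg_near_cst; near=> n.
  rewrite /F (min_idPl _) ?real_normK ?num_real//.
  by near: n; exact: nbhs_infty_ger.
by have [] := mean_fatou mF F0 iF FK FI.
Unshelve. all: by end_near. Qed.

(** Convergence in probability with bounded second moments implies convergence in mean: where the
    deviation [x] is at least [e], one has [x <= e x^2 + 1 / (4 e)], and this event has probability
    at most [4 e^2], which contributes at most [e]. *)
Lemma approximable_orthogonal K (zeta : T -> R) (c : R) I :
  measurable_fun setT zeta -> (forall w, `|zeta w| <= c) ->
  measurable_fun setT I ->
  approximable K (fun S => mean P (fun w => zeta w * S w) = 0) I ->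
  mean P (fun w => zeta w * I w) = 0.
Proof.
move=> mz zc mI appr.
have [sI IK] := approximable_square mI appr.
have zc' w : `|zeta w| <= `|c| by apply: le_trans (zc w) (ler_norm _).
apply/eqP; rewrite -normr_le0.
apply: (@le0_linear_eq _ _ (`|c| * (6 * K + 2))) => e e0; rewrite add0r.
have e20 : 0 < 4 * e ^+ 2 by rewrite mulr_gt0// exprn_gt0.
have [S [sS SK QS PS]] := appr e (4 * e ^+ 2) e0 e20.
have [mS iS] := sS.
have mA := measurable_deviation e mS mI.
set A := [set w | _] in PS mA.
have [i1 m1] := mean_indic mA.
have m1e : mean P (\1_A : T -> R) <= 4 * e ^+ 2 by rewrite -lee_fin m1.
have sz := square_integrable_bounded P mz zc'.
have izI := square_integrableM sz sI; have izS := square_integrableM sz sS.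
have sSI := square_integrableB sS sI.
have iSI := square_integrable1 sSI.
have -> : mean P (fun w => zeta w * I w) = - mean P (fun w => zeta w * (S w - I w)).
  have -> : (fun w => zeta w * (S w - I w)) = (fun w => zeta w * S w - zeta w * I w).
    by apply/funext => w; rewrite mulrBr.
  by rewrite meanB// QS sub0r opprK.
rewrite normrN; apply: le_trans (mean_norm _) _.
  exact: square_integrableM.
have sq_le : mean P (fun w => (S w - I w) ^+ 2) <= 6 * K.
  have : mean P (fun w => (S w - I w) ^+ 2) <=
         mean P (fun w => 2 * S w ^+ 2 + 2 * I w ^+ 2).
    apply: le_mean; [by case: sSI| |].
      by apply: integrable1D; apply: integrable1Z => //; case: sI.
    by move=> w; have := sqrD_le (S w) (- I w); rewrite sqrrN.
  move/le_trans; apply; rewrite meanD; [|by apply: integrable1Z|by apply: integrable1Z; case: sI].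
  rewrite !meanZ//; last by case: sI.
  by lra.
have bound w : `|zeta w * (S w - I w)| <=
    `|c| * (e + (e * (S w - I w) ^+ 2 + (4 * e)^-1 * \1_A w)).
  rewrite normrM; apply: ler_pM => //.
  have e4 : 0 < 4 * e by rewrite mulr_gt0.
  have [Aw|nAw] := pselect (A w); rewrite indicE.
    rewrite mem_set// mulr1.
    set x := `|_|; have -> : (S w - I w) ^+ 2 = x ^+ 2 by rewrite real_normK ?num_real.
    have : 0 <= (4 * e) * (e * x ^+ 2 + (4 * e)^-1 - x).
      rewrite mulrBr mulrDr mulfV ?gt_eqF//.
      have := sqr_ge0 (2 * e * x - 1); rewrite !expr2; by lra.
    rewrite (pmulr_rge0 _ e4); move: ((4 * e)^-1) (e * x ^+ 2) => u v h; lra.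
  rewrite memNset// mulr0 addr0 -[leLHS]addr0 lerD//.
    by move/negP : nAw; rewrite -ltNge => /ltW.
  by rewrite mulr_ge0 ?sqr_ge0// ltW.
have iQ : integrable1 P (fun w => e * (S w - I w) ^+ 2).
  by apply: integrable1Z; case: sSI.
have iA : integrable1 P (fun w => (4 * e)^-1 * \1_A w) by exact: integrable1Z.
apply: le_trans (le_mean (integrable1_norm _) (integrable1Z _ _) bound) _.
- exact: square_integrableM.
- by apply: integrable1D; [exact: integrable1_cst|exact: integrable1D].
rewrite meanZ; last by apply: integrable1D; [exact: integrable1_cst|exact: integrable1D].
rewrite meanD; [|exact: integrable1_cst|exact: integrable1D].
rewrite (meanD iQ iA) mean_cst (meanZ _ i1) (meanZ e (proj2 sSI)).
rewrite -mulrA; apply: ler_wpM2l => //.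
have : (4 * e)^-1 * mean P (\1_A : T -> R) <= e.
  by rewrite ler_pdivrMl ?mulr_gt0// (le_trans m1e)// expr2 mulrA.
have : e * mean P (fun w => (S w - I w) ^+ 2) <= e * (6 * K) by rewrite ler_wpM2l// ltW.
by lra.
Qed.

End limits_in_mean.

(** * Ito sums and one-step estimates *)

Section ito_sums.
Variables (R : realType) (P : probability (wiener_space R) R).
Hypothesis hP : wiener_measure P.
Local Notation Om := (wiener_space R).
Implicit Types (X zeta : Om -> R) (H : R -> Om -> R).

Lemma filtration_measurable_le s t X : s <= t ->
  filtration_measurable P s X -> filtration_measurable P t X.
Proof.
move=> st fX mT B mB; have := fX measurableT B mB.
apply: smallest_sub; first exact: smallest_sigma_algebra.
move=> A [[u [C [/andP[u0 us] mC ->]]]|negA]; apply: sub_sigma_algebra; [left|by right].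
by exists u, C; split=> //; rewrite u0 (le_trans us).
Qed.

Lemma filtration_measurable_increment s t : 0 <= s -> s <= t ->
  filtration_measurable P t (increment s t).
Proof.
move=> s0 st; have H u : 0 <= u <= t -> filtration_measurable P t (bm u).
  move=> ut _ B mB; rewrite setTI; apply: sub_sigma_algebra; left.
  by exists u, B.
by apply: measurable_funB; apply: H; rewrite ?lexx ?s0 ?(le_trans s0).
Qed.

Section increment_moments.
Variables s t : R.
Hypotheses (s0 : 0 <= s) (st : s < t).

Let sd0 : 0 < Num.sqrt (t - s).
Proof. by rewrite sqrtr_gt0 subr_gt0. Qed.

Let law (B : set R) : measurable B ->
  P (increment s t @^-1` B) = normal_prob 0 (Num.sqrt (t - s)) B.
Proof. by move=> mB; apply: increment_law. Qed.

Let mI := @measurable_increment R s t.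

Let sdX : Num.sqrt (t - s) ^+ 2 = t - s.
Proof. by rewrite sqr_sqrtr// subr_ge0 ltW. Qed.

Lemma increment_square_integrable : square_integrable P (increment s t).
Proof. exact: gaussian_square_integrable mI sd0 law. Qed.

Lemma increment_mean : mean P (increment s t) = 0.
Proof. by have [] := gaussian_mean_sqr mI sd0 law. Qed.

Lemma increment_mean_sqr : mean P (fun w => increment s t w ^+ 2) = t - s.
Proof. by have [_ ->] := gaussian_mean_sqr mI sd0 law. Qed.

Lemma increment_integrable4 : integrable1 P (fun w => increment s t w ^+ 4).
Proof. exact: gaussian_integrableX mI sd0 law 4. Qed.

Lemma increment_mean4 :
  mean P (fun w => increment s t w ^+ 4) <= 48 * expR 2^-1 * (t - s) ^+ 2.
Proof.
apply: le_trans (gaussian_mean4 mI sd0 law) _.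
by rewrite -{2}sdX -exprM.
Qed.

Lemma increment_orthogonal X : integrable1 P X -> filtration_measurable P s X ->
  integrable1 P (fun w => X w * increment s t w) /\
  mean P (fun w => X w * increment s t w) = 0.
Proof.
move=> iX fX.
have [i ->] := independent2_mean iX (square_integrable1 increment_square_integrable)
  (increment_independent hP s0 st (integrable1_measurable iX) fX).
by rewrite increment_mean mulr0.
Qed.

Lemma increment_sqr_factor X : integrable1 P X -> filtration_measurable P s X ->
  integrable1 P (fun w => X w * increment s t w ^+ 2) /\
  mean P (fun w => X w * increment s t w ^+ 2) = mean P X * (t - s).
Proof.
move=> iX fX; rewrite -increment_mean_sqr; apply: independent2_mean => //.
  by have [] := increment_square_integrable.
move=> A B mA mB.
have mB2 : measurable ((fun x : R => x ^+ 2) @^-1` B).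
  have m2 : measurable_fun setT (fun x : R => x ^+ 2) by [].
  by have := m2 measurableT _ mB; rewrite setTI.
exact: (increment_independent hP s0 st (integrable1_measurable iX) fX mA mB2).
Qed.

End increment_moments.

(** The recursion splits off the first interval, so that an induction can use the orthogonality of
    the later sum to whatever is known at its starting time. *)
Fixpoint ito_sum H (a : R) (l : seq R) (w : Om) : R :=
  if l is b :: l' then H a w * increment a b w + ito_sum H b l' w else 0.

Lemma path_last_ge (a : R) l : path <%R a l -> a <= last a l.
Proof.
elim: l a => [|b l IHl] a //= /andP[ab /IHl]; apply: le_trans; exact: ltW.
Qed.

(** The Ito isometry, as an inequality. The orthogonality clause drives the induction: the cross
    term in the square is the later sum times a factor known at time [b]. *)
Lemma ito_sum_moments H c K (a : R) l : 0 <= a -> path <%R a l ->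
  (forall u, a <= u -> measurable_fun setT (H u)) ->
  (forall u, a <= u -> filtration_measurable P u (H u)) ->
  (forall u w, a <= u -> `|H u w| <= c) ->
  (forall u, a <= u <= last a l -> mean P (fun w => H u w ^+ 2) <= K) ->
  [/\ square_integrable P (ito_sum H a l),
      forall zeta, square_integrable P zeta -> filtration_measurable P a zeta ->
        mean P (fun w => zeta w * ito_sum H a l w) = 0 &
      mean P (fun w => ito_sum H a l w ^+ 2) <= K * (last a l - a)].
Proof.
elim: l a => [|b l IHl] a a0 /=.
  move=> _ _ _ _ _; split.
  - by apply: (@square_integrable_bounded _ _ _ _ _ 0) => // w; rewrite normr0.
  - move=> zeta _ _; rewrite -[RHS](mean_cst P 0); congr mean.
    by apply/funext => w; rewrite mulr0.
  - by rewrite subrr mulr0 expr0n/= mean_cst.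
move=> /andP[ab pl] mH fH cH KH.
have b0 : 0 <= b by rewrite (le_trans a0)// ltW.
have abW : a <= b := ltW ab.
have [] := IHl b b0 pl.
- by move=> u bu; apply: mH; exact: le_trans bu.
- by move=> u bu; apply: fH; exact: le_trans bu.
- by move=> u w bu; apply: cH; exact: le_trans bu.
- by move=> u /andP[bu ul]; apply: KH; rewrite ul (le_trans abW).
set S' := ito_sum H b l => sS' orth bnd.
have sI := increment_square_integrable a0 ab.
have sHI : square_integrable P (fun w => H a w * increment a b w).
  by apply: (square_integrable_bounded_mul (c := c)) => //; [exact: mH|move=> w; exact: cH].
have fHI : filtration_measurable P b (fun w => H a w * increment a b w).
  apply: measurable_funM; last exact: filtration_measurable_increment.
  by apply: (filtration_measurable_le abW); exact: fH.
split.
- exact: square_integrableD.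
- move=> zeta sz fz.
  have sHz : square_integrable P (fun w => H a w * zeta w).
    by apply: (square_integrable_bounded_mul (c := c)) => //; [exact: mH|move=> w; exact: cH].
  have [|i1 e1] := increment_orthogonal a0 ab (square_integrable1 sHz).
    by apply: measurable_funM => //; exact: fH.
  have e : (fun w => zeta w * (H a w * increment a b w + S' w)) =
           (fun w => H a w * zeta w * increment a b w + zeta w * S' w).
    by apply/funext => w; ring.
  rewrite e meanD//; last exact: square_integrableM.
  by rewrite e1 add0r; apply: orth => //; exact: filtration_measurable_le fz.
- have iH2 : integrable1 P (fun w => H a w ^+ 2).
    apply: (@integrable1_bounded _ _ _ _ _ (c ^+ 2)).
      by apply: measurable_funX; exact: mH.
    move=> w; rewrite normrX lerXn2r ?nnegrE ?cH//.
    by apply: le_trans (cH a w _).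
  have [|i1 e1] := increment_sqr_factor a0 ab iH2.
    by apply: measurable_funX; exact: fH.
  have i2 := square_integrableM sHI sS'.
  have i3 := proj2 sS'.
  have e : (fun w => (H a w * increment a b w + S' w) ^+ 2) =
           (fun w => H a w ^+ 2 * increment a b w ^+ 2 +
              (2 * (H a w * increment a b w * S' w) + S' w ^+ 2)).
    by apply/funext => w; ring.
  rewrite e (meanD i1 (integrable1D (integrable1Z 2 i2) i3)).
  rewrite (meanD (integrable1Z 2 i2) i3) (meanZ 2 i2) orth// e1 mulr0 add0r.
  have -> : K * (last b l - a) = K * (b - a) + K * (last b l - b) by ring.
  apply: lerD => //; rewrite ler_wpM2r ?subr_ge0//.
  by apply: KH; rewrite lexx (le_trans abW)// path_last_ge.
Qed.

Lemma ito_sum_cat H a l1 l2 w :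
  ito_sum H a (l1 ++ l2) w = ito_sum H a l1 w + ito_sum H (last a l1) l2 w.
Proof. by elim: l1 a => [|b l IHl] a /=; rewrite ?add0r// IHl addrA. Qed.

Lemma ito_sum_bigE H a l w : \sum_(i < size l)
    H (a :: l)`_i w * (bm l`_i w - bm (a :: l)`_i w) = ito_sum H a l w.
Proof.
elim: l a => [|b l IHl] a /=; first by rewrite big_ord0.
by rewrite big_ord_recl /= -IHl.
Qed.

Fixpoint mesh_lt (e a : R) (l : seq R) : bool :=
  if l is b :: l' then (b - a < e) && mesh_lt e b l' else true.

Lemma mesh_lt_nth e a l : mesh_lt e a l ->
  forall i, (i < size l)%N -> l`_i - (a :: l)`_i < e.
Proof.
elim: l a => [|b l IHl] a //= /andP[h /IHl hl] [|i] //=.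
by rewrite ltnS; exact: hl.
Qed.

Lemma mesh_lt_cat e a l1 l2 :
  mesh_lt e a (l1 ++ l2) = mesh_lt e a l1 && mesh_lt e (last a l1) l2.
Proof. by elim: l1 a => [|b l IHl] a //=; rewrite IHl andbA. Qed.

Lemma exists_fine_partition (a b e : R) : a <= b -> 0 < e ->
  exists l, [/\ path <%R a l, last a l = b & mesh_lt e a l].
Proof.
rewrite le_eqVlt => /predU1P[->|ab] e0; first by exists [::].
pose unif := fix unif h (n : nat) a := if n is m.+1 then a + h :: unif h m (a + h) else [::] : seq R.
have unifP h n c : 0 < h -> h < e ->
    [/\ path <%R c (unif h n c), last c (unif h n c) = c + n%:R * h & mesh_lt e c (unif h n c)].
  move=> h0 he; elim: n c => [|n IHn] c /=; first by rewrite mul0r addr0.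
  have [p1 p2 p3] := IHn (c + h); split.
  - by rewrite ltrDl h0.
  - by rewrite p2 -addrA -[in RHS]natr1 mulrDl mul1r [h + _]addrC.
  - by rewrite addrAC subrr add0r he.
pose n := (Num.trunc ((b - a) / e)).+1.
have n0 : 0 < n%:R :> R by [].
have ba : 0 < b - a by rewrite subr_gt0.
have hlt : (b - a) / n%:R < e.
  rewrite ltr_pdivrMr// mulrC -ltr_pdivrMr//.
  by rewrite /n; exact: truncnS_gt.
have [p1 p2 p3] := unifP ((b - a) / n%:R) n a (divr_gt0 ba n0) hlt.
exists (unif ((b - a) / n%:R) n a); split=> //.
by rewrite p2 mulrC divfK ?gt_eqF// subrKC.
Qed.

(** One fine partition of [[0, s]] is used for the integral up to [s] and, prolonged to [t], for the
    integral up to [t]; the two sums differ exactly by a sum over [[s, t]]. *)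
Lemma ito_integral_approx H (s t : R) (Is It : Om -> R) :
  0 <= s -> s <= t ->
  measurable_fun setT Is -> measurable_fun setT It ->
  (forall u, 0 <= u -> measurable_fun setT (H u)) ->
  ito_integral P H s Is -> ito_integral P H t It ->
  forall e k : R, 0 < e -> 0 < k -> exists l,
    [/\ path <%R s l, last s l = t &
      (P [set w | e <= `|ito_sum H s l w - (It w - Is w)|]%R <= k%:E)%E].
Proof.
move=> s0 st mIs mIt mH itos itot e k e0 k0.
have e20 : 0 < e / 2 by rewrite divr_gt0.
have k20 : 0 < k / 2 by rewrite divr_gt0.
have [d1 d10 h1] := itos _ _ e20 k20.
have [d2 d20 h2] := itot _ _ e20 k20.
pose d := Num.min d1 d2; have d0 : 0 < d by rewrite lt_min d10.
have [l1 [p1 q1 r1]] := exists_fine_partition s0 d0.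
have [l2 [p2 q2 r2]] := exists_fine_partition st d0.
have msum a l : 0 <= a -> path <%R a l -> measurable_fun setT (ito_sum H a l).
  elim: l a => [|b l IHl] a a0 //= /andP[ab pl].
  apply: measurable_funD; last by apply: IHl => //; rewrite (le_trans a0)// ltW.
  by apply: measurable_funM; [exact: mH|exact: measurable_increment].
have part1 : itv_partition 0 s l1 by split=> //; rewrite q1.
have part2 : itv_partition 0 t (l1 ++ l2).
  by split; [rewrite cat_path p1 q1|rewrite last_cat q1 q2].
have {}h1 := h1 _ part1 _.
have {}h2 := h2 _ part2 _.
exists l2; split=> //.
set A1 := [set w | e / 2 <= `|ito_sum H 0 l1 w - Is w|].
set A2 := [set w | e / 2 <= `|ito_sum H 0 (l1 ++ l2) w - It w|].
have PA1 : (P A1 <= (k / 2)%:E)%E.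
  rewrite (_ : A1 = [set w | e / 2 <= `|\sum_(i < size l1)
    H (0 :: l1)`_i w * (bm l1`_i w - bm (0 :: l1)`_i w) - Is w|]).
    apply: h1 => i il; apply: lt_le_trans (mesh_lt_nth r1 il) _.
    by rewrite ge_min lexx.
  by apply/seteqP; split=> w; rewrite /A1/= ito_sum_bigE.
have PA2 : (P A2 <= (k / 2)%:E)%E.
  rewrite (_ : A2 = [set w | e / 2 <= `|\sum_(i < size (l1 ++ l2))
    H (0 :: l1 ++ l2)`_i w * (bm (l1 ++ l2)`_i w - bm (0 :: l1 ++ l2)`_i w) - It w|]).
    apply: h2 => i il.
    have r12 : mesh_lt d 0 (l1 ++ l2) by rewrite mesh_lt_cat r1 q1.
    by apply: lt_le_trans (mesh_lt_nth r12 il) _; rewrite ge_min lexx orbT.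
  by apply/seteqP; split=> w; rewrite /A2/= ito_sum_bigE.
have mA1 : measurable A1 by apply: measurable_deviation => //; exact: msum.
have mA2 : measurable A2.
  by apply: measurable_deviation => //; apply: msum => //; case: part2.
apply: (@le_trans _ _ (P (A1 `|` A2))).
  apply: le_measure; rewrite ?inE.
  - apply: measurable_deviation; first exact: msum.
    exact: measurable_funB.
  - exact: measurableU.
  move=> w /= ew; have [|n1] := pselect (A1 w); [by left|].
  have [|n2] := pselect (A2 w); [by right|].
  move: n1 n2 => /negP; rewrite -ltNge => n1 /negP; rewrite -ltNge => n2.
  rewrite ito_sum_cat q1 in n2.
  have : `|ito_sum H s l2 w - (It w - Is w)| < e.
    rewrite (_ : _ - _ = (ito_sum H 0 l1 w + ito_sum H s l2 w - It w) -
      (ito_sum H 0 l1 w - Is w)); last by ring.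
    by apply: le_lt_trans (ler_normB _ _) _; rewrite [e]splitr ltrD.
  by rewrite ltNge ew.
apply: (le_trans (measureU2 P mA1 mA2)).
by rewrite [k]splitr EFinD leeD.
Qed.

End ito_sums.

(** * Integrals over time of random functions *)

Section time_integral.
Context d (T : measurableType d) (R : realType) (P : probability T R).
Local Notation leb := (@lebesgue_measure R).
Variables (s t : R).
Hypothesis st : s <= t.

Definition time_integral (Y : T -> R -> R) (w : T) : R :=
  \int[leb]_(u in `]s, t]) Y w u.

Let mI : measurable (`]s, t] : set (measurableTypeR R)). Proof. exact: measurable_itv. Qed.

Let lebI : leb `]s, t] = (t - s)%:E.
Proof.
rewrite lebesgue_measure_itv/= lte_fin; case: ltP => [//|ts].
by have -> : t = s; [apply/eqP; rewrite eq_le ts st|rewrite subrr].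
Qed.

Section bounded.
Variables (Y : T -> R -> R) (c : R).
Hypothesis mY : measurable_fun setT (fun z : T * R => Y z.1 z.2).
Hypothesis Yc : forall w u, `|Y w u| <= c.

Lemma time_integrable w : leb.-integrable `]s, t] (EFin \o Y w).
Proof.
apply: measurable_bounded_integrable => //.
- by rewrite [X in (X < _)%E]lebI ltry.
- apply: measurable_funTS.
  rewrite (_ : Y w = (fun z => Y z.1 z.2) \o pair w)//.
  exact: measurableT_comp.
- exists c; split; first exact: num_real.
  by move=> x cx u _ /=; apply: le_trans (Yc w u) (ltW cx).
Qed.

Lemma time_integral_bound w : `|time_integral Y w| <= c * (t - s).
Proof.
have h := @le_normr_Rintegral _ _ _ leb _ _ mI (time_integrable w).
apply: le_trans h _.
have -> : c * (t - s) = \int[leb]_(u in `]s, t]) c.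
  by rewrite Rintegral_cst//= lebI.
apply: le_Rintegral => //.
- exact: (integrable_norm (time_integrable w)).
- apply: measurable_bounded_integrable => //.
    by rewrite [X in (X < _)%E]lebI ltry.
  exists c; split; first exact: num_real.
  move=> x cx u _ /=; rewrite ger0_norm; first exact: ltW.
  exact: le_trans (Yc w s).
Qed.

Lemma time_integral_norm w :
  `|time_integral Y w| <= time_integral (fun w u => `|Y w u|) w.
Proof. exact: (@le_normr_Rintegral _ _ _ leb _ _ mI (time_integrable w)). Qed.

End bounded.

Section nonnegative.
Variables (Y : T -> R -> R) (c : R).
Hypothesis mY : measurable_fun setT (fun z : T * R => Y z.1 z.2).
Hypothesis Yc : forall w u, `|Y w u| <= c.
Hypothesis Y0 : forall w u, 0 <= Y w u.

Let g (z : T * measurableTypeR R) : \bar R := (\1_(`]s, t] : set R) z.2 * Y z.1 z.2)%:E.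

Let mg : measurable_fun setT g.
Proof.
apply/measurable_EFinP; apply: measurable_funM => //.
by apply: measurableT_comp => //; exact: measurable_indic.
Qed.

Let g0 z : (0 <= g z)%E.
Proof. by rewrite lee_fin mulr_ge0. Qed.

Let gE w : (time_integral Y w)%:E = (\int[leb]_u g (w, u))%E.
Proof.
rewrite /time_integral /Rintegral fineK; last first.
  exact: (integrable_fin_num mI (time_integrable mY Yc w)).
rewrite integral_mkcond; apply: eq_integral => u _.
rewrite patchE /g/= indicE; case: ifPn => uI; first by rewrite mul1r.
by rewrite mul0r.
Qed.

Lemma ge0_measurable_time_integral : measurable_fun setT (time_integral Y).
Proof.
apply/measurable_EFinP.
rewrite (_ : EFin \o _ = fubini_F leb g); last by apply/funext => w; exact: gE.
exact: measurable_fun_fubini_tonelli_F.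
Qed.

Lemma ge0_mean_time_integral K : (forall u, s < u <= t -> mean P (Y ^~ u) <= K) ->
  mean P (time_integral Y) <= K * (t - s).
Proof.
move=> YK; have mG := ge0_measurable_time_integral.
have iG : integrable1 P (time_integral Y).
  by apply: (integrable1_bounded _ mG) => w; exact: time_integral_bound.
rewrite -lee_fin -mean_EFin//.
have -> : (\int[P]_w (time_integral Y w)%:E = \int[leb]_u \int[P]_w g (w, u))%E.
  rewrite -(@fubini_tonelli _ _ _ _ _ P leb g mg g0).
  by apply: eq_integral => w _; exact: gE.
apply: (@le_trans _ _ (\int[leb]_u (\1_(`]s, t] : set R) u * K)%:E)%E).
  have m1 : measurable_fun setT (fun u : R => (\int[P]_w g (w, u))%E).
    exact: (@measurable_fun_fubini_tonelli_G _ _ _ _ _ P g mg g0).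
  have iY u : integrable1 P (Y ^~ u).
    apply: (integrable1_bounded _ _ (fun w => Yc w u)).
    rewrite (_ : Y ^~ u = (fun z => Y z.1 z.2) \o pair^~ u)//.
    exact: measurableT_comp.
  have e u : (\int[P]_w g (w, u) = (\1_(`]s, t] : set R) u * mean P (Y ^~ u))%:E)%E.
    rewrite /g/= EFinM -(mean_EFin (iY u)) -integralZl//; last exact: iY.
  under eq_integral do rewrite e.
  apply: ge0_le_integral => //.
  - by move=> u _; rewrite lee_fin mulr_ge0// mean_ge0.
  - by move: m1; under eq_fun do rewrite e.
  - by apply/measurable_EFinP; apply: measurable_funM => //; exact: measurable_indic.
  - move=> u _; rewrite lee_fin indicE; case: (boolP (u \in _)) => uI; rewrite ?mul0r// !mul1r.
    by apply: YK; move: uI; rewrite inE/= in_itv.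
under eq_integral do rewrite EFinM.
rewrite integralZr//; last exact: integrable_indic_itv.
by rewrite integral_indic// setIT [X in (X * _)%E]lebI -EFinM lee_fin mulrC.
Qed.

End nonnegative.

(** Adding the constant [c] makes the integrand nonnegative, a case settled by Tonelli's theorem. *)
Lemma measurable_time_integral (Y : T -> R -> R) (c : R) :
  measurable_fun setT (fun z : T * R => Y z.1 z.2) ->
  (forall w u, `|Y w u| <= c) -> measurable_fun setT (time_integral Y).
Proof.
move=> mY Yc.
have mc : measurable_fun setT (fun z : T * R => Y z.1 z.2 + c).
  exact: measurable_funD.
have Yc2 w u : `|Y w u + c| <= c + c.
  apply: le_trans (ler_normD _ _) _; apply: lerD => //; rewrite ger0_norm//.
  exact: le_trans (Yc w u).
have Yc0 w u : 0 <= Y w u + c.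
  by have := Yc w u; rewrite ler_norml => /andP[+ _]; rewrite -subr_ge0 opprK addrC.
have := ge0_measurable_time_integral mc Yc2 Yc0.
have e w : time_integral Y w = time_integral (fun w u => Y w u + c) w - c * (t - s).
  rewrite /time_integral RintegralD//; last 2 first.
  - exact: (time_integrable mY Yc).
  - apply: (@time_integrable (fun _ _ => c) `|c|) => // *.
  by rewrite Rintegral_cst//= lebI/= addrK.
move=> m; rewrite (_ : time_integral Y =
  (fun w => time_integral (fun w u => Y w u + c) w - c * (t - s))); last exact/funext.
exact: measurable_funB.
Qed.

Lemma mean_time_integral (Y : T -> R -> R) (c K : R) :
  measurable_fun setT (fun z : T * R => Y z.1 z.2) ->
  (forall w u, `|Y w u| <= c) ->
  (forall u, s < u <= t -> mean P (fun w => `|Y w u|) <= K) ->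
  mean P (fun w => `|time_integral Y w|) <= K * (t - s).
Proof.
move=> mY Yc YK.
have mY' : measurable_fun setT (fun z : T * R => `|Y z.1 z.2|) by exact: measurableT_comp.
have Yc' w u : `| `|Y w u| | <= c by rewrite normr_id.
have Y0 w u : 0 <= `|Y w u| by [].
apply: le_trans (ge0_mean_time_integral mY' Yc' Y0 YK).
have m1 := measurable_time_integral mY Yc.
have m2 := ge0_measurable_time_integral mY' Yc' Y0.
apply: le_mean.
- apply: (@integrable1_bounded _ _ _ _ _ (c * (t - s))); first exact: measurableT_comp.
  by move=> w; rewrite normr_id; exact: time_integral_bound.
- apply: (@integrable1_bounded _ _ _ _ _ (c * (t - s))) => // w.
  exact: time_integral_bound.
- by move=> w; exact: (time_integral_norm mY Yc).
Qed.

End time_integral.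

(** * Moments of a solution over a short interval *)

Section one_step.
Variables (R : realType) (P : probability (wiener_space R) R).
Hypothesis hP : wiener_measure P.
Local Notation Om := (wiener_space R).
Local Notation leb := (@lebesgue_measure R).
Variables (f b : R -> R) (C : R) (X : R -> Om -> R) (x0 : R).
Hypothesis C1 : 1 <= C.
Hypotheses (fC : forall x, `|f x| <= C) (bC : forall x, `|b x| <= C).
Hypotheses (flip : forall x y, `|f x - f y| <= C * `|x - y|).
Hypotheses (blip : forall x y, `|b x - b y| <= C * `|x - y|).
Hypotheses (mf : measurable_fun setT f) (mb : measurable_fun setT b).
Hypothesis mX : measurable_fun setT (fun z : Om * R => X (Num.max 0 z.2) z.1).
Hypothesis fX : forall u, 0 <= u -> filtration_measurable P u (X u).
Hypothesis ito : forall t, 0 <= t -> ito_integral P (fun u w => f (X u w)) t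
  (fun w => X t w - x0 - \int[leb]_(u in `[0, t]) b (X u w)).

Let C0 : 0 <= C. Proof. exact: le_trans C1. Qed.

Let mXu u : 0 <= u -> measurable_fun setT (X u).
Proof.
move=> u0; have : measurable_fun setT ((fun z : Om * R => X (Num.max 0 z.2) z.1) \o pair^~ u).
  by apply: measurableT_comp => //; exact: pair2_measurable.
by congr (measurable_fun _ _); apply/funext => w /=; rewrite (max_idPr u0).
Qed.

(** For negative times the process is frozen at its value at time 0, so that joint measurability
    makes sense on the whole line. *)
Let Y (w : Om) (u : R) := b (X (Num.max 0 u) w).

Let mY : measurable_fun setT (fun z : Om * R => Y z.1 z.2).
Proof. exact: measurableT_comp. Qed.

Let YC w u : `|Y w u| <= C. Proof. exact: bC. Qed.

Let drift t w := \int[leb]_(u in `[0, t]) b (X u w).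

Let driftE t w : 0 <= t -> drift t w = time_integral 0 t Y w.
Proof.
move=> t0; have i : leb.-integrable `]0, t] (EFin \o Y w) := time_integrable t0 mY YC w.
rewrite /time_integral Rintegral_itv_obnd_cbnd//.
apply: eq_Rintegral => u; rewrite inE/= in_itv/= => /andP[u0 _].
by rewrite /Y (max_idPr u0).
Qed.

Let m_drift t : 0 <= t -> measurable_fun setT (drift t).
Proof.
move=> t0; rewrite (_ : drift t = time_integral 0 t Y).
  exact: (measurable_time_integral t0 mY YC).
by apply/funext => w; exact: driftE.
Qed.

Let drift_sub s t w : 0 <= s -> s <= t -> drift t w - drift s w = time_integral s t Y w.
Proof.
move=> s0 st; have t0 := le_trans s0 st.
rewrite !driftE// /time_integral Rintegral_itvB//.
exact: (time_integrable t0 mY YC w).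
Qed.

Let I t w := X t w - x0 - drift t w.

Let mI t : 0 <= t -> measurable_fun setT (I t).
Proof.
move=> t0; apply: measurable_funB; last exact: m_drift.
by apply: measurable_funB => //; exact: mXu.
Qed.

Let H u w := f (X u w).

Let mH u : 0 <= u -> measurable_fun setT (H u).
Proof. by move=> u0; apply: measurableT_comp => //; exact: mXu. Qed.

Let fH u : 0 <= u -> filtration_measurable P u (H u).
Proof. by move=> u0; apply: measurableT_comp => //; exact: fX. Qed.

Section interval.
Variables (s t : R).
Hypotheses (s0 : 0 <= s) (st : s < t) (st1 : t - s <= 1).

Let stW := ltW st.
Let t0 := le_trans s0 stW.
Let h0 : 0 < t - s. Proof. by rewrite subr_gt0. Qed.
(** [N] is the martingale part of the increment and [G] below its drift part. *)
Let N w := I t w - I s w.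
Let G := time_integral s t Y.

Let mN : measurable_fun setT N.
Proof. by apply: measurable_funB; exact: mI. Qed.

Let NE w : X t w - X s w = N w + G w.
Proof. by rewrite /G -drift_sub// /N /I; ring. Qed.

Let GC w : `|G w| <= C * (t - s).
Proof. exact: (time_integral_bound stW mY YC). Qed.

Let mG : measurable_fun setT G.
Proof. exact: (measurable_time_integral stW mY YC). Qed.

Let sG : square_integrable P G.
Proof. exact: square_integrable_bounded mG GC. Qed.

Let G2 : mean P (fun w => G w ^+ 2) <= C ^+ 2 * (t - s) ^+ 2.
Proof.
have [_ i] := sG; rewrite -[leRHS](mean_cst P); apply: le_mean => //.
  exact: integrable1_cst.
move=> w; rewrite -exprMn -[leLHS]real_normK ?num_real// lerXn2r ?nnegrE//.
by rewrite mulr_ge0// ltW.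
Qed.

Let approx := ito_integral_approx s0 stW (mI s0) (mI t0) mH (ito s0) (ito t0).

Let approxN : approximable P (C ^+ 2 * (t - s)) (fun=> True) N.
Proof.
move=> e k e0 k0; have [l [pl ll Pl]] := approx e0 k0.
have [] := @ito_sum_moments _ P hP H C (C ^+ 2) s l s0 pl.
- by move=> u su; apply: mH; exact: le_trans su.
- by move=> u su; apply: fH; exact: le_trans su.
- by move=> u w _; exact: fC.
- move=> u /andP[su _]; rewrite -[leRHS](mean_cst P); apply: le_mean.
  + apply: (square_integrable_bounded P _ (fun w => fC (X u w))).2.
    by apply: mH; exact: le_trans su.
  + exact: integrable1_cst.
  + by move=> w; rewrite -[leLHS]real_normK ?num_real// lerXn2r ?nnegrE// fC.
move=> sS _ S2; exists (ito_sum H s l); split=> //.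
by move: S2; rewrite ll.
Qed.

(** The 6 is [2 * 2] for the martingale part, through [sqrD_le] and [approximable_square], plus 2
    for the drift part, whose square is of order [(t - s)^2 <= t - s]. *)
Lemma increment_moment2 : square_integrable P (fun w => X t w - X s w) /\
  mean P (fun w => (X t w - X s w) ^+ 2) <= 6 * C ^+ 2 * (t - s).
Proof.
have [sN N2] := approximable_square mN approxN.
rewrite (_ : (fun w => X t w - X s w) = (fun w => N w + G w)); last first.
  by apply/funext => w; exact: NE.
rewrite (_ : (fun w => (X t w - X s w) ^+ 2) = (fun w => (N w + G w) ^+ 2)); last first.
  by apply/funext => w; rewrite NE.
have sNG := square_integrableD sN sG; split=> //.
have i1 := integrable1Z 2 sN.2; have i2 := integrable1Z 2 sG.2.
have := le_mean sNG.2 (integrable1D i1 i2) (fun w => sqrD_le (N w) (G w)).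
rewrite (meanD i1 i2) (meanZ 2 sN.2) (meanZ 2 sG.2).
have : C ^+ 2 * (t - s) ^+ 2 <= C ^+ 2 * (t - s).
  by rewrite ler_wpM2l ?sqr_ge0// expr2 ler_piMl// ltW.
move: G2 N2; lra.
Qed.

End interval.

(** The degenerate case [u = s] is included because Ito sums evaluate the integrand at the left end
    of the interval. *)
Let sqX s u : 0 <= s -> s <= u -> u - s <= 1 ->
  square_integrable P (fun w => X u w - X s w) /\
  mean P (fun w => (X u w - X s w) ^+ 2) <= 6 * C ^+ 2 * (u - s).
Proof.
move=> s0; rewrite le_eqVlt => /predU1P[<- _|su us1]; last exact: increment_moment2.
rewrite subrr mulr0.
have -> : (fun w => X s w - X s w) = (fun=> 0) by apply/funext => w; rewrite subrr.
have -> : (fun w => (X s w - X s w) ^+ 2) = (fun=> 0).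
  by apply/funext => w; rewrite subrr expr0n.
by split; [apply: (@square_integrable_bounded _ _ _ _ _ 0) => // w; rewrite normr0|rewrite mean_cst].
Qed.

Section remainder.
Variables (s t : R).
Hypotheses (s0 : 0 <= s) (st : s < t) (st1 : t - s <= 1).

Let stW := ltW st.
Let t0 := le_trans s0 stW.
Let h0 : 0 < t - s. Proof. by rewrite subr_gt0. Qed.
Let N w := I t w - I s w.
Let G := time_integral s t Y.
Let N' w := N w - f (X s w) * increment s t w.
Let H' u w := f (X u w) - f (X s w).

(** The drift is left inside: in mean square it has the same order [t - s] as the error made by
    freezing the coefficient of the noise. *)
Definition remainder w := X t w - X s w - f (X s w) * increment s t w.

Let mN' : measurable_fun setT N'.
Proof.
apply: measurable_funB; first by apply: measurable_funB; exact: mI.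
by apply: measurable_funM; [exact: mH|exact: measurable_increment].
Qed.

Let ito_sum_sub a l w : ito_sum H' a l w =
  ito_sum H a l w - f (X s w) * increment a (last a l) w.
Proof.
elim: l a => [|c l IHl] a /=; first by rewrite /increment subrr mulr0 subr0.
by rewrite IHl /H' /H /increment; ring.
Qed.

Let approx := ito_integral_approx s0 stW (mI s0) (mI t0) mH (ito s0) (ito t0).

(** [N'] is the Ito integral of [f (X u) - f (X s)], an integrand of mean square at most
    [6 C^4 (t - s)]. The property carried to the limit is orthogonality to the past. *)
Let approxN' : approximable P (6 * C ^+ 4 * (t - s) ^+ 2)
  (fun S => forall zeta, square_integrable P zeta -> filtration_measurable P s zeta ->
     mean P (fun w => zeta w * S w) = 0) N'.
Proof.
move=> e k e0 k0; have [l [pl ll Pl]] := approx e0 k0.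
have mH' u : s <= u -> measurable_fun setT (H' u).
  by move=> su; apply: measurable_funB; apply: mH => //; exact: le_trans su.
have H'C u w : s <= u -> `|H' u w| <= C + C.
  by move=> _; apply: le_trans (ler_normB _ _) _; exact: lerD.
have [] := @ito_sum_moments _ P hP H' (C + C) (6 * C ^+ 4 * (t - s)) s l s0 pl mH' _ H'C.
- move=> u su; apply: measurable_funB; first by apply: fH; exact: le_trans su.
  by apply: (filtration_measurable_le su); exact: fH.
- move=> u /andP[su]; rewrite ll => ut.
  have us1 : u - s <= 1 by apply: le_trans st1; rewrite lerD2r.
  have [[mD iD] D2] := sqX s0 su us1.
  apply: (@le_trans _ _ (mean P (fun w => C ^+ 2 * (X u w - X s w) ^+ 2))).
    apply: le_mean.
    + exact: (square_integrable_bounded P (mH' u su) (fun w => H'C u w su)).2.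
    + exact: integrable1Z.
    + move=> w; rewrite -exprMn -[leLHS]real_normK ?num_real//.
      rewrite -[leRHS]real_normK ?num_real// lerXn2r ?nnegrE//.
      by rewrite normrM (ger0_norm C0) flip.
  rewrite meanZ//; apply: (@le_trans _ _ (C ^+ 2 * (6 * C ^+ 2 * (u - s)))).
    by rewrite ler_wpM2l// sqr_ge0.
  have -> : C ^+ 2 * (6 * C ^+ 2 * (u - s)) = 6 * C ^+ 4 * (u - s) by ring.
  by rewrite ler_wpM2l ?mulr_ge0 ?exprn_ge0// lerD2r.
rewrite ll => sS oS S2; exists (ito_sum H' s l); split=> //.
  by move: S2; rewrite expr2 mulrA.
rewrite (_ : [set w | _] = [set w | e <= `|ito_sum H s l w - (I t w - I s w)|])//.
apply/seteqP; split=> w; rewrite /= ito_sum_sub ll /N' /N;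
  by rewrite (_ : ito_sum H s l w - _ - _ = ito_sum H s l w - (I t w - I s w)) //; ring.
Qed.

Let sN' : square_integrable P N' /\
  mean P (fun w => N' w ^+ 2) <= 2 * (6 * C ^+ 4 * (t - s) ^+ 2).
Proof. exact: approximable_square mN' approxN'. Qed.

Let mG : measurable_fun setT G.
Proof. exact: (measurable_time_integral stW mY YC). Qed.

Let GC w : `|G w| <= C * (t - s).
Proof. exact: (time_integral_bound stW mY YC). Qed.

Let sG : square_integrable P G.
Proof. exact: square_integrable_bounded mG GC. Qed.

Let remainderE : remainder = fun w => N' w + G w.
Proof.
apply/funext => w; rewrite /remainder /G -drift_sub// /N' /N /I; ring.
Qed.

(** Here [26 = 2 * 12 + 2]: twice the bound for the martingale part [N'] plus twice the bound for
    the drift. *)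
Lemma remainder_moment2 : square_integrable P remainder /\
  mean P (fun w => remainder w ^+ 2) <= 26 * C ^+ 4 * (t - s) ^+ 2.
Proof.
have [sN N2] := sN'; rewrite remainderE.
have sNG := square_integrableD sN sG; split=> //.
have i1 := integrable1Z 2 sN.2; have i2 := integrable1Z 2 sG.2.
have := le_mean sNG.2 (integrable1D i1 i2) (fun w => sqrD_le (N' w) (G w)).
rewrite (meanD i1 i2) (meanZ 2 sN.2) (meanZ 2 sG.2) => /le_trans; apply.
have G2 : mean P (fun w => G w ^+ 2) <= C ^+ 4 * (t - s) ^+ 2.
  rewrite -[leRHS](mean_cst P); apply: le_mean; [exact: sG.2|exact: integrable1_cst|].
  move=> w; apply: (@le_trans _ _ ((C * (t - s)) ^+ 2)).
    rewrite -[leLHS]real_normK ?num_real// lerXn2r ?nnegrE//.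
    by rewrite mulr_ge0// ltW.
  by rewrite exprMn ler_wpM2r ?sqr_ge0// ler_weXn2l.
by move: G2 N2; lra.
Qed.

(** A bounded factor known at time [s] is orthogonal to the martingale part [N']. What is left is
    the variation of the drift over [[s, t]], of order [(t - s)^(1/2)] in mean, integrated over the
    interval. *)
Lemma remainder_mean (zeta : Om -> R) : measurable_fun setT zeta ->
  filtration_measurable P s zeta -> (forall w, `|zeta w| <= 1) ->
  `|mean P (fun w => zeta w * remainder w) -
    (t - s) * mean P (fun w => zeta w * b (X s w))| <=
  4 * C ^+ 3 * (t - s) * Num.sqrt (t - s).
Proof.
move=> mz fz z1.
have sz := square_integrable_bounded P mz z1.
have mbs : measurable_fun setT (fun w => b (X s w)).
  by apply: measurableT_comp => //; exact: mXu.
have sb := square_integrable_bounded P mbs (fun w => bC (X s w)).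
have zN : mean P (fun w => zeta w * N' w) = 0.
  apply: (approximable_orthogonal mz z1 mN' (K := 6 * C ^+ 4 * (t - s) ^+ 2)).
  move=> e k e0 k0; have [S [? ? oS ?]] := approxN' e0 k0.
  by exists S; split=> //; exact: oS.
have izb := square_integrableM sz sb.
have izG := square_integrableM sz sG.
have izN := square_integrableM sz sN'.1.
pose Z w u := Y w u - b (X s w).
have mbs1 : measurable_fun setT ((fun w => b (X s w)) \o (fst : Om * R -> Om)).
  by apply: (measurableT_comp mbs); exact: measurable_fst.
have mZ : measurable_fun setT (fun z : Om * R => Z z.1 z.2).
  exact: measurable_funB.
have ZC w u : `|Z w u| <= C + C by apply: le_trans (ler_normB _ _) _; exact: lerD.
have ZG w : G w - (t - s) * b (X s w) = time_integral s t Z w.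
  rewrite /time_integral RintegralB//; last 2 first.
  - exact: (time_integrable stW mY YC).
  - exact: (@time_integrable _ _ _ s t stW (fun w _ => b (X s w)) C
      mbs1 (fun w _ => bC _) w).
  rewrite Rintegral_cst//= lebesgue_measure_itv/= lte_fin st/= mulrC//.
have -> : mean P (fun w => zeta w * remainder w) -
    (t - s) * mean P (fun w => zeta w * b (X s w)) =
    mean P (fun w => zeta w * time_integral s t Z w).
  have -> : (fun w => zeta w * remainder w) = (fun w => zeta w * N' w + zeta w * G w).
    by apply/funext => w; rewrite remainderE mulrDr.
  rewrite meanD// zN add0r -meanZ// -meanB//; last exact: integrable1Z.
  by congr mean; apply/funext => w; rewrite -ZG; ring.
have mT := measurable_time_integral stW mZ ZC.
have TC w := time_integral_bound stW mZ ZC w.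
have sT := square_integrable_bounded P mT TC.
apply: le_trans (mean_norm (square_integrableM sz sT)) _.
apply: (@le_trans _ _ (mean P (fun w => `|time_integral s t Z w|))).
  apply: le_mean.
  - exact: integrable1_norm (square_integrableM sz sT).
  - exact: integrable1_norm (square_integrable1 sT).
  - by move=> w; rewrite normrM ler_piMl.
have -> : 4 * C ^+ 3 * (t - s) * Num.sqrt (t - s) =
  (4 * C ^+ 3 * Num.sqrt (t - s)) * (t - s) by ring.
apply: (mean_time_integral stW mZ ZC) => u /andP[su ut].
have u0 : 0 <= u by rewrite (le_trans s0)// ltW.
have us1 : u - s <= 1 by apply: le_trans st1; rewrite lerD2r.
have [[mD iD] D2] := sqX s0 (ltW su) us1.
set q := Num.sqrt (t - s).
have q0 : 0 < q by rewrite sqrtr_gt0.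
have q2 : q ^+ 2 = t - s by rewrite sqr_sqrtr// ltW.
have iQ : integrable1 P (fun w => (2 * q)^-1 * (X u w - X s w) ^+ 2) by exact: integrable1Z.
(* Young's inequality at the scale [q = sqrt (t - s)] of the increments takes the place of the
   Cauchy-Schwarz inequality. *)
have bound w : `|Z w u| <= C * (q / 2 + (2 * q)^-1 * (X u w - X s w) ^+ 2).
  rewrite /Z /Y (max_idPr u0); apply: le_trans (blip _ _) _.
  rewrite ler_wpM2l//; set v := X u w - X s w.
  rewrite -(real_normK (num_real v)); set a := `|v|.
  have q4 : 0 < 2 * q by rewrite mulr_gt0.
  rewrite -(ler_pM2l q4).
  have -> : 2 * q * (q / 2 + (2 * q)^-1 * a ^+ 2) = q ^+ 2 + a ^+ 2.
    by field; rewrite gt_eqF.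
  have := sqr_ge0 (a - q); rewrite !expr2; nra.
have mZu : measurable_fun setT (Z^~ u).
  rewrite (_ : Z ^~ u = (fun z => Z z.1 z.2) \o pair^~ u)//.
  exact: measurableT_comp.
apply: le_trans (le_mean _ _ bound) _.
- apply: (@integrable1_bounded _ _ _ _ _ (C + C)); first exact: measurableT_comp.
  by move=> w; rewrite normr_id.
- by apply: integrable1Z; apply: integrable1D => //; exact: integrable1_cst.
rewrite meanZ; last by apply: integrable1D => //; exact: integrable1_cst.
rewrite meanD//; last exact: integrable1_cst.
rewrite mean_cst meanZ//.
have -> : 4 * C ^+ 3 * q = C * (q * (4 * C ^+ 2)) by ring.
rewrite ler_wpM2l//.
have h1 : (2 * q)^-1 * mean P (fun w => (X u w - X s w) ^+ 2) <= 3 * C ^+ 2 * q.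
  rewrite ler_pdivrMl ?mulr_gt0//.
  apply: le_trans D2 _; have -> : 2 * q * (3 * C ^+ 2 * q) = 6 * C ^+ 2 * q ^+ 2 by ring.
  by rewrite q2 ler_wpM2l ?mulr_ge0 ?sqr_ge0// lerD2r.
have h2 : q <= q * C ^+ 2 by rewrite ler_peMr ?(ltW q0)// exprn_ege1.
move: h1 h2; lra.
Qed.

End remainder.
End one_step.

(** * Dynkin's inequality *)

Section product_taylor.
Variable R : realType.

(** [d] and [e] are the increments of [y - x] and of [x], driven by the same noise [w]. For
    [th = sqrt h] each term on the right has mean of order [h^(3/2)]. The remainders [rx] and [ry]
    are controlled only in mean square, so no higher power of them may appear. *)
Lemma product_taylor (M C th B B1 B2 B' V V1 V2 V' w rx ry p q : R) :
  let d := (q - p) * w + (ry - rx) in let e := p * w + rx in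
  1 <= C -> 0 <= M -> 0 < th -> th <= 1 ->
  `|B| <= M -> `|B1| <= M -> `|B2| <= M -> `|V| <= M -> `|V1| <= M -> `|V2| <= M ->
  `|B'| <= M -> `|V'| <= M -> `|p| <= C -> `|q| <= C ->
  `|B' - B| <= M * `|d| -> `|B' - B - B1 * d| <= M * `|d| ^+ 2 ->
  `|B' - B - B1 * d - B2 * d ^+ 2 / 2| <= M * `|d| ^+ 3 ->
  `|V' - V| <= M * `|e| -> `|V' - V - V1 * e| <= M * `|e| ^+ 2 ->
  `|V' - V - V1 * e - V2 * e ^+ 2 / 2| <= M * `|e| ^+ 3 ->
  `|B' * V' - (B * V + (B1 * V * ry + (B * V1 - B1 * V) * rx)
      + (B1 * V * (q - p) + B * V1 * p) * w
      + (B2 * V * (q - p) ^+ 2 / 2 + B * V2 * p ^+ 2 / 2 + B1 * V1 * (q - p) * p) * w ^+ 2)|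
  <= 1000 * M ^+ 2 * C ^+ 3 * (th * w ^+ 2 + w ^+ 4 / th + (rx ^+ 2 + ry ^+ 2) / th).
Proof.
move=> d e C1 M0 th0 th1 hB hB1 hB2 hV hV1 hV2 hB' hV' hp hq b0 b1 b2 v0 v1 v2.
pose a := `|w|; pose r := `|rx| + `|ry|; pose Q := 2 * C * (a + r).
have a0 : 0 <= a := normr_ge0 w; have r0 : 0 <= r by rewrite addr_ge0.
have C0 : 0 <= C := le_trans ler01 C1.
have Q0 : 0 <= Q by rewrite !mulr_ge0// addr_ge0.
have hpq : `|q - p| <= 2 * C.
  by apply: le_trans (ler_normB _ _) _; rewrite mulr_natl mulr2n lerD.
have hr : `|ry - rx| <= r by apply: le_trans (ler_normB _ _) _; rewrite addrC.
have hrx : `|rx| <= r by rewrite lerDl.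
have dQ : `|d| <= Q.
  apply: le_trans (ler_normD _ _) _; rewrite normrM /Q mulrDr lerD//.
    by rewrite ler_wpM2r.
  by apply: le_trans hr _; rewrite ler_peMl//; clear -C1; lra.
have eQ : `|e| <= Q.
  apply: le_trans (ler_normD _ _) _; rewrite normrM /Q mulrDr lerD//.
    by rewrite ler_wpM2r// (le_trans hp)//; clear -C0; lra.
  by apply: le_trans hrx _; rewrite ler_peMl//; clear -C1; lra.
have dQn n : `|d| ^+ n <= Q ^+ n by rewrite lerXn2r ?nnegrE.
have eQn n : `|e| ^+ n <= Q ^+ n by rewrite lerXn2r ?nnegrE.
(* Each Taylor error has a cubic and a quadratic bound. The cubic one serves when the noise
   dominates ([r <= a]), the quadratic one when the remainders do. *)
pose m := Num.min (Q ^+ 3) (2 * Q ^+ 2).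
have m0 : 0 <= m by rewrite le_min exprn_ge0//= mulr_ge0// sqr_ge0.
have le_m x : x <= M ^+ 2 * Q ^+ 3 -> x <= M ^+ 2 * (2 * Q ^+ 2) -> x <= M ^+ 2 * m.
  by move=> x1 x2; rewrite /m /Num.min; case: ifP.
have MM x y : `|x| <= M -> `|y| <= M -> `|x * y| <= M ^+ 2.
  by move=> hx hy; rewrite normrM expr2 ler_pM.
have T1b (U A A1 A2 A' c : R) : `|U| <= M -> `|A1| <= M -> `|A2| <= M -> `|c| <= Q ->
    `|A' - A - A1 * c| <= M * `|c| ^+ 2 ->
    `|A' - A - A1 * c - A2 * c ^+ 2 / 2| <= M * `|c| ^+ 3 ->
    `|U * (A' - A - A1 * c - A2 * c ^+ 2 / 2)| <= M ^+ 2 * m.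
  move=> hU hA1 hA2 cQ h1 h2.
  have cQn n : `|c| ^+ n <= Q ^+ n by rewrite lerXn2r ?nnegrE.
  have [cQ2 cQ3] := (cQn 2, cQn 3).
  rewrite normrM; apply: le_m.
    have -> : M ^+ 2 * Q ^+ 3 = M * (M * Q ^+ 3) by ring.
    by apply: ler_pM => //; rewrite (le_trans h2)// ler_wpM2l.
  have -> : M ^+ 2 * (2 * Q ^+ 2) = M * (M * (2 * Q ^+ 2)) by ring.
  apply: ler_pM => //; apply: le_trans (ler_normB _ _) _.
  rewrite [2 * _]mulr_natl mulr2n mulrDr; apply: lerD.
    by rewrite (le_trans h1)// ler_wpM2l.
  rewrite 2!normrM normrX [`|2^-1|]ger0_norm ?invr_ge0//.
  have : `|A2| * `|c| ^+ 2 <= M * Q ^+ 2 by rewrite ler_pM// exprn_ge0.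
  have : 0 <= `|A2| * `|c| ^+ 2 by rewrite mulr_ge0// exprn_ge0.
  by move: (`|A2| * _) (M * _) => x1 x2; clear; lra.
have T1 := T1b V B B1 B2 B' d hV hB1 hB2 dQ b1 b2.
have T2 := T1b B V V1 V2 V' e hB hV1 hV2 eQ v1 v2.
have T3a : `|(B' - B - B1 * d) * (V' - V)| <= M ^+ 2 * m.
  have h1 : `|B' - B - B1 * d| <= M * Q ^+ 2 by rewrite (le_trans b1)// ler_wpM2l.
  have h2 : `|V' - V| <= M * Q by rewrite (le_trans v0)// ler_wpM2l.
  have h3 : `|V' - V| <= M * 2.
    by apply: le_trans (ler_normB _ _) _; rewrite mulr_natr mulr2n lerD.
  rewrite normrM; apply: le_m.
    have -> : M ^+ 2 * Q ^+ 3 = (M * Q ^+ 2) * (M * Q) by ring.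
    exact: ler_pM.
  have -> : M ^+ 2 * (2 * Q ^+ 2) = (M * Q ^+ 2) * (M * 2) by ring.
  exact: ler_pM.
have T3b : `|B1 * d * (V' - V - V1 * e)| <= M ^+ 2 * m.
  have h1 : `|B1 * d| <= M * Q by rewrite normrM ler_pM.
  have h2 : `|V' - V - V1 * e| <= M * Q ^+ 2 by rewrite (le_trans v1)// ler_wpM2l.
  have h3 : `|V' - V - V1 * e| <= M * (2 * Q).
    apply: le_trans (ler_normB _ _) _.
    have -> : M * (2 * Q) = M * Q + M * Q by ring.
    apply: lerD; first by rewrite (le_trans v0)// ler_wpM2l.
    by rewrite normrM ler_pM.
  rewrite normrM; apply: le_m.
    have -> : M ^+ 2 * Q ^+ 3 = (M * Q) * (M * Q ^+ 2) by ring.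
    exact: ler_pM.
  have -> : M ^+ 2 * (2 * Q ^+ 2) = (M * Q) * (M * (2 * Q)) by ring.
  exact: ler_pM.
(* [g] measures the cost of replacing [d ^+ 2], [e ^+ 2] and [d * e] by their pure noise parts. *)
pose g := a * r + r ^+ 2.
have g0 : 0 <= g by rewrite addr_ge0 ?mulr_ge0 ?sqr_ge0.
have ar0 : 0 <= a * r by rewrite mulr_ge0.
have r20 : 0 <= r ^+ 2 by rewrite sqr_ge0.
have Cr : r ^+ 2 <= C * r ^+ 2 by rewrite ler_peMl.
have D1 : `|d ^+ 2 - (q - p) ^+ 2 * w ^+ 2| <= 4 * C * g.
  have -> : d ^+ 2 - (q - p) ^+ 2 * w ^+ 2 =
    (ry - rx) * (2 * ((q - p) * w) + (ry - rx)) by rewrite /d; ring.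
  rewrite normrM; apply: (@le_trans _ _ (r * (2 * (2 * C * a) + r))).
    apply: ler_pM => //; apply: le_trans (ler_normD _ _) _; apply: lerD => //.
    by rewrite normrM ger0_norm// ler_wpM2l// normrM ler_wpM2r.
  rewrite /g mulrDr -[r * r]expr2.
  have -> : 4 * C * (a * r + r ^+ 2) = r * (2 * (2 * C * a)) + 4 * (C * r ^+ 2) by ring.
  by rewrite lerD2l; clear -Cr r20; lra.
have D2 : `|e ^+ 2 - p ^+ 2 * w ^+ 2| <= 4 * C * g.
  have -> : e ^+ 2 - p ^+ 2 * w ^+ 2 = rx * (2 * (p * w) + rx) by rewrite /e; ring.
  rewrite normrM; apply: (@le_trans _ _ (r * (2 * (C * a) + r))).
    apply: ler_pM => //; apply: le_trans (ler_normD _ _) _; apply: lerD => //.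
    by rewrite normrM ger0_norm// ler_wpM2l// normrM ler_wpM2r.
  rewrite /g mulrDr -[r * r]expr2.
  have -> : 4 * C * (a * r + r ^+ 2) = r * (2 * (C * a)) + (2 * C * (a * r) + 4 * (C * r ^+ 2)) by ring.
  rewrite lerD2l.
  have h : 0 <= C * (a * r) by rewrite mulr_ge0.
  by clear -h Cr r20 ar0; lra.
have D3 : `|d * e - (q - p) * p * w ^+ 2| <= 4 * C * g.
  have -> : d * e - (q - p) * p * w ^+ 2 =
    (q - p) * w * rx + (p * w * (ry - rx) + (ry - rx) * rx) by rewrite /d /e; ring.
  apply: (@le_trans _ _ (2 * C * a * r + (C * a * r + r * r))).
    apply: le_trans (ler_normD _ _) _; apply: lerD.
      by rewrite !normrM ler_pM// ?mulr_ge0// ler_pM.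
    apply: le_trans (ler_normD _ _) _; apply: lerD.
      by rewrite !normrM ler_pM// ?mulr_ge0// ler_pM.
    by rewrite normrM ler_pM.
  rewrite -expr2 /g.
  have -> : 4 * C * (a * r + r ^+ 2) = 2 * C * a * r + (C * a * r + (C * (a * r) + 4 * (C * r ^+ 2))) by ring.
  rewrite !lerD2l.
  have h : 0 <= C * (a * r) by rewrite mulr_ge0.
  by clear -h Cr r20 ar0; lra.
have T4a (U c : R) : `|U| <= M ^+ 2 -> `|c| <= 4 * C * g -> `|U * c| <= M ^+ 2 * (4 * C * g).
  by move=> hU hc; rewrite normrM ler_pM.
have T4a1 := T4a _ _ (MM _ _ hB2 hV) D1.
have T4a2 := T4a _ _ (MM _ _ hB hV2) D2.
have T4a3 := T4a _ _ (MM _ _ hB1 hV1) D3.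
(* An exact splitting: the Taylor remainders of the two factors, the mixed terms of order three, and
   the passage from quadratic terms to their noise parts. *)
have -> : B' * V' - (B * V + (B1 * V * ry + (B * V1 - B1 * V) * rx)
      + (B1 * V * (q - p) + B * V1 * p) * w
      + (B2 * V * (q - p) ^+ 2 / 2 + B * V2 * p ^+ 2 / 2 + B1 * V1 * (q - p) * p) * w ^+ 2) =
  V * (B' - B - B1 * d - B2 * d ^+ 2 / 2) + B * (V' - V - V1 * e - V2 * e ^+ 2 / 2) +
  ((B' - B - B1 * d) * (V' - V) + B1 * d * (V' - V - V1 * e)) +
  (B2 * V * (d ^+ 2 - (q - p) ^+ 2 * w ^+ 2) / 2 +
   B * V2 * (e ^+ 2 - p ^+ 2 * w ^+ 2) / 2 +
   B1 * V1 * (d * e - (q - p) * p * w ^+ 2)).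
  by rewrite /d /e; field.
set S := th * w ^+ 2 + w ^+ 4 / th + (rx ^+ 2 + ry ^+ 2) / th.
have a2 : w ^+ 2 = a ^+ 2 by rewrite real_normK ?num_real.
have a4 : w ^+ 4 = a ^+ 4 by rewrite -[4%N]/(2 * 2)%N !exprM a2.
have rr : r ^+ 2 <= 2 * (rx ^+ 2 + ry ^+ 2).
  have := sqrD_le `|rx| `|ry|; rewrite !real_normK ?num_real// mulrDr; exact.
pose u := (rx ^+ 2 + ry ^+ 2) / th; pose v := a ^+ 4 / th; pose y := th * a ^+ 2.
have SE : S = y + v + u by rewrite /S a2 a4.
have u0 : 0 <= u by rewrite divr_ge0 ?addr_ge0 ?sqr_ge0// ltW.
have v00 : 0 <= v by rewrite divr_ge0 ?exprn_ge0// ltW.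
have y0 : 0 <= y by rewrite mulr_ge0 ?sqr_ge0// ltW.
have rth : r ^+ 2 <= 2 * u * th by rewrite /u -mulrA divfK ?gt_eqF.
have ruS : r ^+ 2 <= 2 * u by apply: le_trans rth _; rewrite ler_piMr// mulr_ge0.
have arS : a * r <= y + u.
  have h : 0 <= (th * a - r) ^+ 2 by exact: sqr_ge0.
  rewrite -(ler_pM2l th0) /y.
  have -> : th * (th * a ^+ 2 + u) = th ^+ 2 * a ^+ 2 + u * th by ring.
  have e1 : (th * a - r) ^+ 2 = th ^+ 2 * a ^+ 2 - 2 * (th * (a * r)) + r ^+ 2 by ring.
  rewrite e1 in h.
  have : 0 <= th ^+ 2 * a ^+ 2 by rewrite mulr_ge0 ?sqr_ge0.
  have -> : u * th = th * u by ring.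
  have : r ^+ 2 <= 2 * (th * u) by rewrite [th * u]mulrC mulrA.
  have : 0 <= th * (a * r) by rewrite mulr_ge0// ltW.
  by clear -h; lra.
have a3S : a ^+ 3 <= y + v.
  have vth : v * th = a ^+ 4 by rewrite /v divfK ?gt_eqF.
  rewrite -(ler_pM2l th0).
  have h : 0 <= (th * a - a ^+ 2) ^+ 2 by exact: sqr_ge0.
  have e1 : (th * a - a ^+ 2) ^+ 2 = th * y - 2 * (th * a ^+ 3) + a ^+ 4 by rewrite /y; ring.
  rewrite e1 -vth in h.
  have : 0 <= th * a ^+ 3 by rewrite mulr_ge0 ?exprn_ge0// ltW.
  by rewrite mulrDr => h2; clear -h h2; lra.
have gS : g <= 4 * S by rewrite /g SE; clear -arS ruS v00 y0 u0; lra.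
have CC : C ^+ 2 <= C ^+ 3 by rewrite ler_weXn2l.
have C3 : C <= C ^+ 3 by rewrite -{1}[C]expr1 ler_weXn2l.
have S0 : 0 <= S by rewrite SE !addr_ge0.
have mS : m <= 64 * C ^+ 3 * (2 * S).
  have C30 : 0 <= C ^+ 3 by rewrite exprn_ge0.
  have [ra|ar] := leP r a.
    apply: (@le_trans _ _ (Q ^+ 3)); first by rewrite ge_min lexx.
    apply: (@le_trans _ _ ((4 * C * a) ^+ 3)).
      have h : Q <= 4 * C * a.
        rewrite /Q (_ : 4 * C * a = 2 * C * (a + a)); last by ring.
        by rewrite ler_wpM2l ?mulr_ge0// lerD2l.
      by rewrite lerXn2r ?nnegrE// (le_trans Q0 h).
    have -> : (4 * C * a) ^+ 3 = 64 * C ^+ 3 * a ^+ 3 by ring.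
    by rewrite ler_wpM2l ?mulr_ge0// (le_trans a3S)// SE; clear -y0 v00 u0; lra.
  apply: (@le_trans _ _ (2 * Q ^+ 2)); first by rewrite ge_min lexx orbT.
  apply: (@le_trans _ _ (2 * (4 * C * r) ^+ 2)).
    have h : Q <= 4 * C * r.
      rewrite /Q (_ : 4 * C * r = 2 * C * (r + r)); last by ring.
      by rewrite ler_wpM2l ?mulr_ge0// lerD2r ltW.
    by rewrite ler_wpM2l// lerXn2r ?nnegrE// (le_trans Q0 h).
  have -> : 2 * (4 * C * r) ^+ 2 = 32 * (C ^+ 2 * r ^+ 2) by ring.
  apply: (@le_trans _ _ (32 * (C ^+ 3 * (2 * S)))).
    rewrite ler_wpM2l// ler_pM ?sqr_ge0//.
    by rewrite (le_trans ruS)// SE; clear -y0 v00 u0; lra.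
  have h : 0 <= C ^+ 3 * (2 * S) by rewrite !mulr_ge0.
  by clear -h; lra.
have M20 : 0 <= M ^+ 2 by rewrite sqr_ge0.
have f1 : M ^+ 2 * m <= 128 * (M ^+ 2 * C ^+ 3 * S).
  have -> : 128 * (M ^+ 2 * C ^+ 3 * S) = M ^+ 2 * (64 * C ^+ 3 * (2 * S)) by ring.
  by rewrite ler_wpM2l.
have f2 : M ^+ 2 * (4 * C * g) <= 16 * (M ^+ 2 * C ^+ 3 * S).
  have -> : 16 * (M ^+ 2 * C ^+ 3 * S) = M ^+ 2 * (4 * C ^+ 3 * (4 * S)) by ring.
  by rewrite ler_wpM2l// ler_pM ?mulr_ge0// ler_wpM2l.
have nh (x : R) : `|x / 2| <= `|x|.
  by rewrite normrM [X in _ * X]ger0_norm ?invr_ge0//; have := normr_ge0 x; clear; lra.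
have tri (x1 x2 x3 x4 y1 y2 y3 A D : R) : `|x1| <= A -> `|x2| <= A -> `|x3| <= A ->
    `|x4| <= A -> `|y1| <= D -> `|y2| <= D -> `|y3| <= D ->
    `|x1 + x2 + (x3 + x4) + (y1 / 2 + y2 / 2 + y3)| <= 4 * A + 3 * D.
  move=> h1 h2 h3 h4 k1 k2 k3.
  have := ler_normD (x1 + x2 + (x3 + x4)) (y1 / 2 + y2 / 2 + y3).
  have := ler_normD (x1 + x2) (x3 + x4); have := ler_normD x1 x2.
  have := ler_normD x3 x4; have := ler_normD (y1 / 2 + y2 / 2) y3.
  have := ler_normD (y1 / 2) (y2 / 2); have := nh y1; have := nh y2.
  by clear -h1 h2 h3 h4 k1 k2 k3; lra.
apply: le_trans (tri _ _ _ _ _ _ _ _ _ T1 T2 T3a T3b T4a1 T4a2 T4a3) _.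
have -> : 1000 * M ^+ 2 * C ^+ 3 * S = 1000 * (M ^+ 2 * C ^+ 3 * S) by ring.
have h : 0 <= M ^+ 2 * C ^+ 3 * S by rewrite !mulr_ge0// exprn_ge0.
by clear -h f1 f2; lra.
Qed.

End product_taylor.

Section elementary.
Variable R : realFieldType.
Implicit Types x y K q : R.

Lemma norm_half_le x : `|x / 2| <= `|x|.
Proof.
rewrite normrM [X in _ * X]ger0_norm ?invr_ge0//.
by have := normr_ge0 x; lra.
Qed.

Lemma add_le_double x y K q : x <= K * q -> y <= K * q -> x + y <= 2 * K * q.
Proof. by move=> hx hy; rewrite -mulrA mulr_natl mulr2n lerD. Qed.

Lemma collect_errors h (m1 m2 b1 b2 c F S M K k : R) :
  m1 <= h * b1 + M * K -> m2 <= h * b2 + 2 * M * K -> S <= k ->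
  F + (m1 + m2) + c * h + S <= F + h * (b1 + b2 + c) + (3 * M * K + k).
Proof.
move=> h1 h2 h3.
have -> : F + h * (b1 + b2 + c) + (3 * M * K + k) =
  F + ((h * b1 + M * K) + (h * b2 + 2 * M * K)) + c * h + k by ring.
by apply: lerD => //; rewrite lerD2r lerD2l lerD.
Qed.

End elementary.

(** * The one-step inequality for the two-point motion *)

Section dynkin.
Variables (R : realType) (P : probability (wiener_space R) R).
Hypothesis hP : wiener_measure P.
Local Notation Om := (wiener_space R).

(** The bounds of lower order stand beside the cubic one because [product_taylor] chooses between
    them. *)
Definition taylor_bounded (M : R) (B B1 B2 : R -> R) := forall z d : R,
  [/\ [/\ `|B z| <= M, `|B1 z| <= M & `|B2 z| <= M],
      `|B (z + d) - B z| <= M * `|d|,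
      `|B (z + d) - B z - B1 z * d| <= M * `|d| ^+ 2 &
      `|B (z + d) - B z - B1 z * d - B2 z * d ^+ 2 / 2| <= M * `|d| ^+ 3].

(** The discrete counterpart of an Ito equation: the drift [b] is visible only through the mean of
    the remainder against bounded factors known at time [s]. *)
Definition diffusion_step (f b : R -> R) (K : R) (X : R -> Om -> R) :=
  [/\ forall u, 0 <= u -> measurable_fun setT (X u),
      forall u, 0 <= u -> filtration_measurable P u (X u) &
      forall s t, 0 <= s -> s < t -> t - s <= 1 ->
      [/\ square_integrable P (remainder f X s t),
          mean P (fun w => remainder f X s t w ^+ 2) <= K * (t - s) ^+ 2 &
          forall zeta, measurable_fun setT zeta -> filtration_measurable P s zeta ->
            (forall w, `|zeta w| <= 1) ->
            `|mean P (fun w => zeta w * remainder f X s t w) -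
              (t - s) * mean P (fun w => zeta w * b (X s w))| <=
            K * (t - s) * Num.sqrt (t - s)]].

(** The Ito generator of the two-point motion, both points driven by the same noise, applied to the
    function [B (y - x) * V x]. *)
Definition generator (f b B B1 B2 V V1 V2 : R -> R) (x y : R) : R :=
  B1 (y - x) * V x * (b y - b x) + B (y - x) * V1 x * b x +
  B2 (y - x) * V x * (f y - f x) ^+ 2 / 2 + B (y - x) * V2 x * f x ^+ 2 / 2 +
  B1 (y - x) * V1 x * (f y - f x) * f x.

Variables (f b B B1 B2 V V1 V2 : R -> R) (C K M : R) (X Y : R -> Om -> R).
Hypotheses (C1 : 1 <= C) (K0 : 0 <= K) (M0 : 0 < M).
Hypotheses (fC : forall x, `|f x| <= C) (bC : forall x, `|b x| <= C).
Hypotheses (mf : measurable_fun setT f) (mb : measurable_fun setT b).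
Hypotheses (mB : measurable_fun setT B) (mB1 : measurable_fun setT B1)
  (mB2 : measurable_fun setT B2) (mV : measurable_fun setT V)
  (mV1 : measurable_fun setT V1) (mV2 : measurable_fun setT V2).
Hypotheses (tB : taylor_bounded M B B1 B2) (tV : taylor_bounded M V V1 V2).
Hypotheses (dX : diffusion_step f b K X) (dY : diffusion_step f b K Y).

Definition test_mean u := mean P (fun w => B (Y u w - X u w) * V (X u w)).

Definition generator_mean u :=
  mean P (fun w => generator f b B B1 B2 V V1 V2 (X u w) (Y u w)).

Let scaled_remainder_mean (Z : R -> Om -> R) s t zeta c : diffusion_step f b K Z ->
  0 <= s -> s < t -> t - s <= 1 -> 0 < c ->
  measurable_fun setT zeta -> filtration_measurable P s zeta ->
  (forall w, `|zeta w| <= c) ->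
  integrable1 P (fun w => zeta w * remainder f Z s t w) /\
  mean P (fun w => zeta w * remainder f Z s t w) <=
  (t - s) * mean P (fun w => zeta w * b (Z s w)) + c * (K * (t - s) * Num.sqrt (t - s)).
Proof.
move=> [mZ fZ dZ] s0 st st1 c0 mz fz zc; have [sR _ H] := dZ s t s0 st st1.
have sz := square_integrable_bounded P mz zc.
have mbZ : measurable_fun setT (fun w => b (Z s w)).
  by apply: measurableT_comp => //; exact: mZ.
have sbZ := square_integrable_bounded P mbZ (fun w => bC (Z s w)).
have i1 := square_integrableM sz sR; split=> //.
have := H (fun w => c^-1 * zeta w) _ _ _.
have -> : (fun w => c^-1 * zeta w * remainder f Z s t w) =
  (fun w => c^-1 * (zeta w * remainder f Z s t w)) by apply/funext => w; rewrite mulrA.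
have -> : (fun w => c^-1 * zeta w * b (Z s w)) =
  (fun w => c^-1 * (zeta w * b (Z s w))) by apply/funext => w; rewrite mulrA.
rewrite (meanZ _ i1) (meanZ _ (square_integrableM sz sbZ)).
set m1 := mean P _; set m2 := mean P _ => h.
have {}h : `|c^-1 * m1 - (t - s) * (c^-1 * m2)| <= K * (t - s) * Num.sqrt (t - s).
  apply: h.
  - by apply: measurable_funM.
  - by apply: measurable_funM.
  - move=> w; rewrite normrM gtr0_norm ?invr_gt0//.
    by rewrite ler_pdivrMl// mulr1.
have {}h := le_trans (ler_norm _) h.
rewrite -(ler_pM2l (_ : 0 < c^-1)) ?invr_gt0// mulrDr [c^-1 * (c * _)]mulrA mulVf ?gt_eqF// mul1r.
have -> : c^-1 * ((t - s) * m2) = (t - s) * (c^-1 * m2) by ring.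
by rewrite addrC -lerBlDr.
Qed.

Let K1 := 1000 * M ^+ 2 * C ^+ 3.

Let K10 : 0 <= K1.
Proof.
apply: mulr_ge0; last by apply: exprn_ge0; exact: le_trans C1.
by apply: mulr_ge0; [exact: ler0n|exact: sqr_ge0].
Qed.

(** In the mean of the expansion [product_taylor] with [th = sqrt (t - s)], the term linear in the
    noise vanishes, its square contributes a factor [t - s], and the remainders contribute the
    drift. *)
Lemma dynkin_step s t : 0 <= s -> s < t -> t - s <= 1 ->
  test_mean t <= test_mean s + (t - s) * generator_mean s +
    (3 * M ^+ 2 * K + K1 * (1 + 48 * expR 2^-1 + 2 * K)) * (t - s) * Num.sqrt (t - s).
Proof.
move=> s0 st st1; have t0 : 0 <= t by rewrite (le_trans s0)// ltW.
have [mX fX hX] := dX; have [mY fY hY] := dY.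
have [sx x2 _] := hX s t s0 st st1; have [sy y2 _] := hY s t s0 st st1.
have h0 : 0 < t - s by rewrite subr_gt0.
set q := Num.sqrt (t - s).
have q0 : 0 < q by rewrite sqrtr_gt0.
have qq : q ^+ 2 = t - s by rewrite sqr_sqrtr// ltW.
have q1 : q <= 1 by rewrite -sqrtr1 ler_sqrt.
pose rx := remainder f X s t; pose ry := remainder f Y s t.
pose w_ := @increment R s t.
pose x w := X s w; pose z w := Y s w - X s w.
have mz : measurable_fun setT z by apply: measurable_funB; [exact: mY|exact: mX].
have fz : filtration_measurable P s z.
  by apply: measurable_funB; [exact: fY|exact: fX].
have mx : measurable_fun setT x by exact: mX.
have fx : filtration_measurable P s x by exact: fX.
have my : measurable_fun setT (Y s) by exact: mY.
have fy : filtration_measurable P s (Y s) by exact: fY.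
have mc (g : R -> R) (U : Om -> R) : measurable_fun setT g -> measurable_fun setT U ->
  measurable_fun setT (fun w => g (U w)) by move=> mg mU; exact: measurableT_comp.
have fc (g : R -> R) (U : Om -> R) : measurable_fun setT g -> filtration_measurable P s U ->
  filtration_measurable P s (fun w => g (U w)) by move=> mg mU; exact: measurableT_comp.
have bB z := (tB z 0); have bV z := (tV z 0).
have hB v : `|B v| <= M by have [[]] := bB v.
have hB1 v : `|B1 v| <= M by have [[]] := bB v.
have hB2 v : `|B2 v| <= M by have [[]] := bB v.
have hV v : `|V v| <= M by have [[]] := bV v.
have hV1 v : `|V1 v| <= M by have [[]] := bV v.
have hV2 v : `|V2 v| <= M by have [[]] := bV v.
have M00 := ltW M0.
pose z1 w := B1 (z w) * V (x w).
pose z2 w := B (z w) * V1 (x w) - B1 (z w) * V (x w).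
pose c1 w := B1 (z w) * V (x w) * (f (Y s w) - f (x w)) + B (z w) * V1 (x w) * f (x w).
pose c2 w := B2 (z w) * V (x w) * (f (Y s w) - f (x w)) ^+ 2 / 2 +
  B (z w) * V2 (x w) * f (x w) ^+ 2 / 2 + B1 (z w) * V1 (x w) * (f (Y s w) - f (x w)) * f (x w).
have mz1 : measurable_fun setT z1 by apply: measurable_funM; exact: mc.
have fz1 : filtration_measurable P s z1 by apply: measurable_funM; exact: fc.
have mz2 : measurable_fun setT z2.
  by apply: measurable_funB => //; apply: measurable_funM; exact: mc.
have fz2 : filtration_measurable P s z2.
  by apply: measurable_funB => //; apply: measurable_funM; exact: fc.
have mdf : measurable_fun setT (fun w => f (Y s w) - f (x w)).
  by apply: measurable_funB; exact: mc.
have fdf : filtration_measurable P s (fun w => f (Y s w) - f (x w)).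
  by apply: measurable_funB; exact: fc.
have mc1 : measurable_fun setT c1.
  apply: measurable_funD; first exact: measurable_funM.
  by apply: measurable_funM; [apply: measurable_funM|]; exact: mc.
have fc1 : filtration_measurable P s c1.
  apply: measurable_funD; first exact: measurable_funM.
  by apply: measurable_funM; [apply: measurable_funM|]; exact: fc.
have mc2 : measurable_fun setT c2.
  apply: measurable_funD; first apply: measurable_funD.
  - apply: measurable_funM => //; apply: measurable_funM; last exact: measurable_funX.
    by apply: measurable_funM; exact: mc.
  - apply: measurable_funM => //; apply: measurable_funM.
      by apply: measurable_funM; exact: mc.
    by apply: measurable_funX; exact: mc.
  - apply: measurable_funM; last exact: mc.
    by apply: measurable_funM => //; apply: measurable_funM; exact: mc.
have fc2 : filtration_measurable P s c2.
  apply: measurable_funD; first apply: measurable_funD.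
  - apply: measurable_funM => //; apply: measurable_funM; last exact: measurable_funX.
    by apply: measurable_funM; exact: fc.
  - apply: measurable_funM => //; apply: measurable_funM.
      by apply: measurable_funM; exact: fc.
    by apply: measurable_funX; exact: fc.
  - apply: measurable_funM; last exact: fc.
    by apply: measurable_funM => //; apply: measurable_funM; exact: fc.
have MM u v : `|u| <= M -> `|v| <= M -> `|u * v| <= M ^+ 2.
  by move=> hu hv; rewrite normrM expr2 ler_pM.
have bz1 w : `|z1 w| <= M ^+ 2 by exact: MM.
have bz2 w : `|z2 w| <= 2 * M ^+ 2.
  apply: le_trans (ler_normB _ _) _.
  by rewrite mulr_natl mulr2n; apply: lerD; exact: MM.
have bdf w : `|f (Y s w) - f (x w)| <= 2 * C.
  by apply: le_trans (ler_normB _ _) _; rewrite mulr_natl mulr2n; exact: lerD.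
have C00 : 0 <= C by exact: le_trans C1.
have bc1 w : `|c1 w| <= M ^+ 2 * (2 * C) + M ^+ 2 * C.
  apply: le_trans (ler_normD _ _) _; rewrite normrM [X in _ + X]normrM.
  by apply: lerD; apply: ler_pM => //; exact: MM.
have bc2 w : `|c2 w| <= M ^+ 2 * (2 * C) ^+ 2 + M ^+ 2 * C ^+ 2 + M ^+ 2 * (2 * C) * C.
  apply: le_trans (ler_normD _ _) _; apply: lerD.
    apply: le_trans (ler_normD _ _) _; apply: lerD; apply: le_trans (norm_half_le _) _.
      rewrite normrM normrX ler_pM//; [exact: MM|].
      by rewrite lerXn2r ?nnegrE// mulr_ge0.
    by rewrite normrM normrX ler_pM//; [exact: MM|rewrite lerXn2r ?nnegrE].
  rewrite normrM [X in X * _]normrM ler_pM// ?mulr_ge0//.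
  by rewrite ler_pM//; exact: MM.
have ic1 := integrable1_bounded P mc1 bc1.
have ic2 := integrable1_bounded P mc2 bc2.
have M20 : 0 < M ^+ 2 by rewrite exprn_gt0.
have [i1 e1] := scaled_remainder_mean dY s0 st st1 M20 mz1 fz1 bz1.
have M220 : 0 < 2 * M ^+ 2 by rewrite mulr_gt0.
have [i2 e2] := scaled_remainder_mean dX s0 st st1 M220 mz2 fz2 bz2.
have [i3 e3] := increment_orthogonal hP s0 st ic1 fc1.
have [i4 e4] := increment_sqr_factor hP s0 st ic2 fc2.
have sw := increment_square_integrable hP s0 st.
have w2 := increment_mean_sqr hP s0 st.
have iw4 := increment_integrable4 hP s0 st.
have w4 := increment_mean4 hP s0 st.
pose S w := q * w_ w ^+ 2 + w_ w ^+ 4 / q + (rx w ^+ 2 + ry w ^+ 2) / q.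
have iS1 : integrable1 P (fun w => q * w_ w ^+ 2) := integrable1Z q sw.2.
have iS2 : integrable1 P (fun w => q^-1 * w_ w ^+ 4) := integrable1Z q^-1 iw4.
have iS3' : integrable1 P (fun w => rx w ^+ 2 + ry w ^+ 2) := integrable1D sx.2 sy.2.
have iS3 : integrable1 P (fun w => q^-1 * (rx w ^+ 2 + ry w ^+ 2)) := integrable1Z q^-1 iS3'.
have SE : S = (fun w => q * w_ w ^+ 2 + q^-1 * w_ w ^+ 4 + q^-1 * (rx w ^+ 2 + ry w ^+ 2)).
  by apply/funext => w; rewrite /S [_ / q]mulrC [X in _ + X]mulrC.
have iS : integrable1 P S by rewrite SE; exact: integrable1D (integrable1D iS1 iS2) iS3.
have mS : mean P S <= (1 + 48 * expR 2^-1 + 2 * K) * (t - s) * q.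
  rewrite SE (meanD (integrable1D iS1 iS2) iS3) (meanD iS1 iS2).
  rewrite (meanZ _ sw.2) (meanZ _ iw4) (meanZ _ iS3') (meanD sx.2 sy.2) w2.
  have qi : q^-1 * (t - s) ^+ 2 = (t - s) * q.
    by rewrite -qq; field; rewrite gt_eqF.
  have g1 : q^-1 * mean P (fun w => w_ w ^+ 4) <= 48 * expR 2^-1 * ((t - s) * q).
    rewrite -qi [leRHS]mulrCA ler_wpM2l ?invr_ge0 ?(ltW q0)//.
  have g2 : q^-1 * (mean P (fun w => rx w ^+ 2) + mean P (fun w => ry w ^+ 2)) <=
      2 * K * ((t - s) * q).
    rewrite -qi [leRHS]mulrCA ler_wpM2l ?invr_ge0 ?(ltW q0)//.
    exact: add_le_double x2 y2.
  have -> : (1 + 48 * expR 2^-1 + 2 * K) * (t - s) * q =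
    q * (t - s) + 48 * expR 2^-1 * ((t - s) * q) + 2 * K * ((t - s) * q) by ring.
  by apply: lerD => //; apply: lerD.
pose Fs w := B (z w) * V (x w).
have mFs : measurable_fun setT Fs by apply: measurable_funM; exact: mc.
have iFs : integrable1 P Fs by apply: (integrable1_bounded P mFs) => w; exact: MM.
have mFt : measurable_fun setT (fun w => B (Y t w - X t w) * V (X t w)).
  by apply: measurable_funM; apply: mc => //; [apply: measurable_funB; [exact: mY|exact: mX]|exact: mX].
have iFt : integrable1 P (fun w => B (Y t w - X t w) * V (X t w)).
  by apply: (integrable1_bounded P mFt) => w; exact: MM.
have iz12 := integrable1D i1 i2.
have iA := integrable1D iFs iz12.
have iAB := integrable1D iA i3.
have iABC := integrable1D iAB i4.
have iK := integrable1Z K1 iS.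
have bound w : B (Y t w - X t w) * V (X t w) <=
    Fs w + (z1 w * ry w + z2 w * rx w) + c1 w * w_ w + c2 w * w_ w ^+ 2 + K1 * S w.
  have := @product_taylor R M C q (B (z w)) (B1 (z w)) (B2 (z w)) (B (Y t w - X t w))
    (V (x w)) (V1 (x w)) (V2 (x w)) (V (X t w)) (w_ w) (rx w) (ry w) (f (x w)) (f (Y s w)) C1 M00 q0 q1.
  have dE : Y t w - X t w = z w + ((f (Y s w) - f (x w)) * w_ w + (ry w - rx w)).
    by rewrite /z /x /ry /rx /remainder /w_; ring.
  have eE : X t w = x w + (f (x w) * w_ w + rx w).
    by rewrite /x /rx /remainder /w_; ring.
  have [_ b0 b1 b2] := tB (z w) ((f (Y s w) - f (x w)) * w_ w + (ry w - rx w)).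
  have [_ v0 v1 v2] := tV (x w) (f (x w) * w_ w + rx w).
  rewrite -!dE in b0 b1 b2; rewrite -!eE in v0 v1 v2.
  move=> /(_ (hB _) (hB1 _) (hB2 _) (hV _) (hV1 _) (hV2 _) (hB _) (hV _) (fC _) (fC _)).
  move=> /(_ b0 b1 b2 v0 v1 v2) /(le_trans (ler_norm _)).
  by rewrite lerBlDl addrC.
have := le_mean iFt (integrable1D iABC iK) bound.
rewrite (meanD iABC iK) (meanD iAB i4) (meanD iA i3) (meanD iFs iz12) (meanD i1 i2).
rewrite (meanZ K1 iS) e3 addr0 e4 => /le_trans; apply.
have sz1 := square_integrable_bounded P mz1 bz1.
have sz2 := square_integrable_bounded P mz2 bz2.
have sbX := square_integrable_bounded P (mc b x mb mx) (fun w => bC (x w)).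
have sbY := square_integrable_bounded P (mc b (Y s) mb my) (fun w => bC (Y s w)).
have ib1 := square_integrableM sz1 sbY; have ib2 := square_integrableM sz2 sbX.
have gE : generator_mean s = mean P (fun w => z1 w * b (Y s w)) +
    mean P (fun w => z2 w * b (x w)) + mean P c2.
  rewrite -(meanD ib1 ib2) -(meanD (integrable1D ib1 ib2) ic2).
  congr mean; apply/funext => w; rewrite /generator /z1 /z2 /c2 /z /x; ring.
have := ler_wpM2l K10 mS.
move=> e5; rewrite gE /test_mean -/q.
have -> : (3 * M ^+ 2 * K + K1 * (1 + 48 * expR 2^-1 + 2 * K)) * (t - s) * q =
  3 * M ^+ 2 * (K * (t - s) * q) + K1 * ((1 + 48 * expR 2^-1 + 2 * K) * (t - s) * q) by ring.
apply: collect_errors => //.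
Qed.

End dynkin.

(** * Gronwall's lemma for one-step inequalities *)

Section gronwall.
Variable R : realType.

(** The one-step inequality is iterated over [T / h] equal steps. The errors [K * h^(3/2)] add up to
    the order [h^(1/2)], which vanishes as [h] tends to 0. *)
Lemma gronwall (e g : R -> R) (al th K T : R) : 0 <= T -> 0 <= th -> 0 <= K -> 0 <= e 0 ->
  (forall s, 0 <= s -> s <= T -> g s <= al * e s + th) ->
  (forall s t, 0 <= s -> s < t -> t - s <= 1 ->
    e t <= e s + (t - s) * g s + K * (t - s) * Num.sqrt (t - s)) ->
  e T <= expR (al * T) * e 0 + expR (`|al| * T) * T * th.
Proof.
rewrite le_eqVlt => /predU1P[<-|T0] th0 K0 e0 gH H.
  by rewrite !mulr0 mul0r addr0 expR0 mul1r.
apply: (@le0_linear_eq _ _ _ (expR (`|al| * T) * T * K)) => d d0.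
(* The three bounds on the step give [sqrt h <= d], [h <= 1] for the one-step inequality, and
   [1 + al * h >= 0], which the induction needs to multiply inequalities when [al] is negative. *)
pose N := (Num.trunc (T / Num.min (d ^+ 2) (Num.min 1 (`|al| + 1)^-1))).+1.
pose m := Num.min (d ^+ 2) (Num.min 1 (`|al| + 1)^-1).
have al1 : 0 < `|al| + 1 by rewrite ltr_wpDl.
have m0 : 0 < m by rewrite !lt_min exprn_gt0// ltr01 invr_gt0.
have N0 : 0 < N%:R :> R by [].
pose h := T / N%:R.
have h0 : 0 < h by rewrite divr_gt0.
have hm : h <= m.
  rewrite /h ler_pdivrMr// mulrC -ler_pdivrMr// ltW//; exact: truncnS_gt.
have hd : h <= d ^+ 2 by apply: le_trans hm _; rewrite ge_min lexx.
have h1 : h <= 1 by apply: le_trans hm _; rewrite !ge_min lexx orbT.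
have ha : h * `|al| <= 1.
  have : h <= (`|al| + 1)^-1 by apply: le_trans hm _; rewrite !ge_min lexx !orbT.
  rewrite -(ler_pM2r al1) mulVf ?gt_eqF// => /(le_trans _); apply.
  by rewrite ler_pM2l// lerDl.
have a0 : 0 <= 1 + al * h.
  have : - (`|al| * h) <= al * h by rewrite -mulNr ler_pM2r// lerNnormlW.
  by rewrite mulrC in ha; lra.
have sh : Num.sqrt h <= d.
  by rewrite -[d]gtr0_norm// -sqrtr_sqr; exact: ler_wsqrtr.
pose del := h * (th + K * d).
have del0 : 0 <= del.
  by apply: mulr_ge0; [exact: ltW|rewrite addr_ge0// mulr_ge0// ltW].
have step (i : nat) : (i <= N)%N -> e (i%:R * h) <=
    expR (al * (i%:R * h)) * e 0 + i%:R * del * expR (`|al| * (i%:R * h)).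
  elim: i => [_|i IHi iN].
    by rewrite !mul0r !mulr0 addr0 expR0 mul1r.
  have {}IHi := IHi (ltnW iN).
  have iT : i%:R * h <= T.
    by rewrite /h mulrCA ger_pMr// ler_pdivrMr// mul1r ler_nat ltnW.
  have ih0 : 0 <= i%:R * h by rewrite mulr_ge0// ltW.
  have e1 : i.+1%:R * h - i%:R * h = h by rewrite -mulrBl -natrB// subSnn mul1r.
  have := H (i%:R * h) (i.+1%:R * h) ih0 _ _.
  rewrite e1 ltr_pM2r// ltr_nat => /(_ (ltnSn _) h1) /le_trans; apply.
  have g1 : h * g (i%:R * h) <= h * (al * e (i%:R * h) + th) by rewrite ler_pM2l// gH.
  have k1 : K * h * Num.sqrt h <= K * h * d by rewrite ler_wpM2l// mulr_ge0// ltW.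
  apply: (@le_trans _ _ ((1 + al * h) * e (i%:R * h) + del)); first by rewrite /del; lra.
  have ex1 : 1 + al * h <= expR (al * h) by exact: expR_ge1Dx.
  have ex2 : 1 + al * h <= expR (`|al| * h).
    by apply: le_trans ex1 _; rewrite ler_expR ler_pM2r// ler_norm.
  apply: (@le_trans _ _ ((1 + al * h) * (expR (al * (i%:R * h)) * e 0 +
      i%:R * del * expR (`|al| * (i%:R * h))) + del)).
    by rewrite lerD2r ler_wpM2l.
  have -> : i.+1%:R * h = h + i%:R * h by rewrite -natr1; ring.
  rewrite !(mulrDr _ h) !expRD; set E1 := expR (al * (_ * h)); set E2 := expR (_ * (_ * h)).
  have E10 : 0 <= E1 by exact: expR_ge0.
  have E20 : 1 <= expR (`|al| * h) * E2.
    by rewrite -expRD -[leLHS]expR0 ler_expR; apply: addr_ge0; apply: mulr_ge0 => //; exact: ltW.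
  have -> : (1 + al * h) * (E1 * e 0 + i%:R * del * E2) + del =
    (1 + al * h) * (E1 * e 0) + (i%:R * del * ((1 + al * h) * E2) + del) by ring.
  apply: lerD; first by rewrite mulrA ler_wpM2r// ler_wpM2r.
  rewrite -natr1 [(i%:R + 1) * del]mulrDl mul1r [leRHS]mulrDl; apply: lerD.
    apply: ler_wpM2l; first exact: mulr_ge0.
    by apply: ler_wpM2r => //; exact: expR_ge0.
  by rewrite ler_peMr.
have := step N (leqnn _); have -> : N%:R * h = T by rewrite /h mulrC divfK// gt_eqF.
move/le_trans; apply; rewrite -addrA lerD2l.
have -> : N%:R * del = T * (th + K * d) by rewrite /del /h; field; rewrite gt_eqF.
by rewrite le_eqVlt; apply/orP; left; apply/eqP; ring.
Qed.

End gronwall.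

Section taylor.
Variable R : realType.

Lemma taylor_bounded_le (M M' : R) B B1 B2 : M <= M' ->
  taylor_bounded M B B1 B2 -> taylor_bounded M' B B1 B2.
Proof.
move=> MM H z d; have [[h1 h2 h3] h4 h5 h6] := H z d; split; first split.
- exact: le_trans h1 MM.
- exact: le_trans h2 MM.
- exact: le_trans h3 MM.
- by apply: le_trans h4 _; rewrite ler_wpM2r.
- by apply: le_trans h5 _; rewrite ler_wpM2r// exprn_ge0.
- by apply: le_trans h6 _; rewrite ler_wpM2r// exprn_ge0.
Qed.

Lemma smooth_taylor_bounded (T : R) B B1 B2 : 0 < T -> periodic T B ->
  derivative B B1 -> derivative B1 B2 -> smooth 3 B ->
  exists2 M, 0 < M & taylor_bounded M B B1 B2.
Proof.
move=> T0 pB d1 d2 sB.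
have s1 := smooth_derivative d1 sB; have s2 := smooth_derivative d2 s1.
have [B3 d3 s3] := s2.
have p1 := derivative_periodic d1 pB; have p2 := derivative_periodic d2 p1.
have p3 := derivative_periodic d3 p2.
have [M0 h0] := periodic_bounded T0 (derivative_continuous d1) pB.
have [M1 h1] := periodic_bounded T0 (derivative_continuous d2) p1.
have [M2 h2] := periodic_bounded T0 (derivative_continuous d3) p2.
have [M3 h3] := periodic_bounded T0 s3 p3.
have M00 := le_trans (normr_ge0 _) (h0 0).
have M10 := le_trans (normr_ge0 _) (h1 0).
have M20 := le_trans (normr_ge0 _) (h2 0).
have M30 := le_trans (normr_ge0 _) (h3 0).
exists (1 + M0 + M1 + M2 + M3); first by lra.
move=> z d; split; first split.
- by apply: le_trans (h0 _) _; lra.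
- by apply: le_trans (h1 _) _; lra.
- by apply: le_trans (h2 _) _; lra.
- apply: (@le_trans _ _ (M1 * `|d|)); last by rewrite ler_wpM2r//; lra.
  have := @mean_value_bound _ B B1 M1 z (z + d) d1 (fun _ _ => h1 _).
  by rewrite [z + d - z]addrAC subrr add0r.
- apply: (@le_trans _ _ (M2 * `|d| ^+ 2)); last by rewrite ler_wpM2r ?exprn_ge0//; lra.
  exact: (taylor1 d1 d2).
- apply: (@le_trans _ _ (M3 * `|d| ^+ 3)); last by rewrite ler_wpM2r ?exprn_ge0//; lra.
  exact: (taylor2 d1 d2 d3).
Qed.

End taylor.

(** * The two-point motion *)

Section haversine.
Variable R : realType.
Implicit Types x z : R.

(* A smooth periodic substitute for [z ^+ 2 / 4] *)
Definition hav z : R := (1 - cos z) / 2.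

Lemma cos_hav z : cos z = 1 - 2 * hav z.
Proof. by rewrite /hav; field. Qed.

Lemma hav_ge0 z : 0 <= hav z.
Proof. by have := cos_le1 z; rewrite /hav; lra. Qed.

Lemma hav_le1 z : hav z <= 1.
Proof. by have := cos_geN1 z; rewrite /hav; lra. Qed.

Lemma sin_sqr_hav z : sin z ^+ 2 = 4 * hav z * (1 - hav z).
Proof. by have := sin2cos2 z; rewrite cos_hav => h; lra. Qed.

Lemma derivative_hav : derivative hav (fun z => sin z / 2).
Proof.
have d : derivative (fun z : R => (1 - cos z) * 2^-1) (fun z => (0 - - sin z) * 2^-1 + (1 - cos z) * 0).
  apply: derivativeM (derivative_cst _); apply: derivativeB; first exact: derivative_cst.
  by move=> x; exact: is_derive_cos.
by apply: derivative_eq d _ => z; ring.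
Qed.

Lemma derivative_half_sin : derivative (fun z => sin z / 2) (fun z : R => cos z / 2).
Proof.
have d : derivative (fun z : R => sin z * 2^-1) (fun z => cos z * 2^-1 + sin z * 0).
  by apply: derivativeM (derivative_cst _) => x; exact: is_derive_sin.
by apply: derivative_eq d _ => z; ring.
Qed.

Lemma derivative_half_cos : derivative (fun z => cos z / 2) (fun z : R => - sin z / 2).
Proof.
have d : derivative (fun z : R => cos z * 2^-1) (fun z => - sin z * 2^-1 + cos z * 0).
  by apply: derivativeM (derivative_cst _) => x; exact: is_derive_cos.
by apply: derivative_eq d _ => z; ring.
Qed.

Lemma smooth_hav n : smooth n hav.
Proof.
have : smooth n hav /\ smooth n (fun z : R => sin z / 2) /\ smooth n (fun z : R => cos z / 2).
  elim: n => [|n [h [s c]]].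
    split; first exact: derivative_continuous derivative_hav.
    split; first exact: derivative_continuous derivative_half_sin.
    exact: derivative_continuous derivative_half_cos.
  split; first exact: derivative_smooth derivative_hav s.
  split; first exact: derivative_smooth derivative_half_sin c.
  apply: (derivative_smooth derivative_half_cos).
  have -> : (fun z : R => - sin z / 2) = (fun z => - (sin z / 2)).
    by apply/funext => z; rewrite mulNr.
  exact: smoothN.
by case.
Qed.

Lemma norm_half_trig z : `|sin z / 2| <= 1 /\ `|cos z / 2| <= 1.
Proof.
have := sin_le1 z; have := sin_geN1 z; have := cos_le1 z; have := cos_geN1 z.
by move=> *; split; rewrite ler_norml; apply/andP; split; lra.
Qed.

Lemma hav_taylor z : `|hav z - z ^+ 2 / 4| <= `|z| ^+ 3.
Proof.
have := @taylor2 _ hav _ _ _ 1 0 z derivative_hav derivative_half_sin derivative_half_cos.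
rewrite add0r mul1r sin0 cos0 /hav cos0 subrr !mul0r !subr0.
have -> : 1 / 2 * z ^+ 2 / 2 = z ^+ 2 / 4 by field.
by apply=> y _; rewrite mulNr normrN; case: (norm_half_trig y).
Qed.

Lemma hav_le_sqr z : hav z <= z ^+ 2.
Proof.
have := @taylor1 _ hav _ _ 1 0 z derivative_hav derivative_half_sin.
rewrite add0r mul1r sin0 /hav cos0 subrr !mul0r !subr0 real_normK ?num_real//.
move=> H; apply: le_trans (ler_norm _) (H _) => y _.
by case: (norm_half_trig y).
Qed.

(** For [|z| <= 8^-1] Taylor's bound gives the constant 8. Beyond, monotonicity of the cosine gives
    [hav z >= hav 8^-1 >= 1 / 512], while [z ^+ 2 <= 16], and [16 * 512 = 8192]. *)
Lemma sqr_le_hav z : `|z| <= pi -> z ^+ 2 <= 8192 * hav z.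
Proof.
have small y : `|y| <= 8^-1 -> y ^+ 2 <= 8 * hav y.
  move=> h; have := hav_taylor y; rewrite ler_norml => /andP[t _].
  have : `|y| ^+ 3 <= y ^+ 2 / 8.
    by rewrite exprSr real_normK ?num_real// ler_wpM2l// sqr_ge0.
  by move: t; set a := `|y| ^+ 3; lra.
move=> zpi; have [h|h] := lerP `|z| 8^-1.
  by apply: le_trans (small _ h) _; have := hav_ge0 z; lra.
have hh : hav 8^-1 <= hav z.
  have cE : cos `|z| = cos z by case: (ger0P z) => _; rewrite ?cosN.
  suff : cos z <= cos 8^-1 by rewrite /hav; lra.
  rewrite -cE ltW// ltr_cos// in_itv/= ?normr_ge0//.
  by rewrite invr_ge0 ler0n/= (le_trans (ltW h)).
have := small 8^-1; rewrite ger0_norm// lexx => /(_ isT) h8.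
have : z ^+ 2 <= 16.
  rewrite -[z ^+ 2]real_normK ?num_real// (_ : 16 = 4 ^+ 2); last by rewrite -natrX.
  have pi4 : pi <= 4 :> R by have := @pihalf_lt2 R; lra.
  by rewrite lerXn2r// ?nnegrE// (le_trans zpi).
have e8 : 8^-1 ^+ 2 = 64^-1 :> R by rewrite exprVn -natrX.
rewrite e8 in h8 => zz; have h9 : 1 <= 512 * hav z by clear -hh h8; lra.
by clear -h9 zz; lra.
Qed.

Lemma exists_sqr_le_hav : exists2 k : R, 0 <= k & forall z, `|z| <= pi -> z ^+ 2 <= k * hav z.
Proof. by exists 8192; [rewrite ler0n|exact: sqr_le_hav]. Qed.

(** Everything is periodic in [z], which may thus be reduced to [[- pi, pi]]. There [hav z]
    dominates a multiple of [z ^+ 2], and [sin z], the periodic substitute for [z], differs from it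
    by at most [z ^+ 2]. *)
Lemma periodic_increment (psi psi1 psi2 : R -> R) : derivative psi psi1 -> derivative psi1 psi2 ->
  continuous psi2 -> periodic (2 * pi) psi ->
  exists2 c, 0 <= c & forall x z, (psi (x + z) - psi x) ^+ 2 <= c * hav z /\
    `|psi (x + z) - psi x - psi1 x * sin z| <= c * hav z.
Proof.
move=> d1 d2 c2 p; have T0 : 0 < 2 * pi :> R by rewrite mulr_gt0// pi_gt0.
have p1 := derivative_periodic d1 p; have p2 := derivative_periodic d2 p1.
have [M1 h1] := periodic_bounded T0 (derivative_continuous d2) p1.
have [M2 h2] := periodic_bounded T0 c2 p2.
have M10 := le_trans (normr_ge0 _) (h1 0).
have M20 := le_trans (normr_ge0 _) (h2 0).
have [k0 k00 sqr_le] := exists_sqr_le_hav; have c0 : 0 <= M1 ^+ 2 + M1 + M2 by rewrite !addr_ge0// sqr_ge0.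
exists (k0 * (M1 ^+ 2 + M1 + M2)); first exact: mulr_ge0.
move=> x z.
have [k] := reduce_period T0 (z + pi).
set y := z + k%:~R * (2 * pi) => hk.
have {hk} : `|y| <= pi by rewrite ler_norml; move: hk; rewrite addrAC -/y; lra.
have pc : periodic (2 * pi) (@cos R) by move=> u; rewrite mulr_natl mulr2n addrA !cosDpi opprK.
have ps : periodic (2 * pi) (@sin R) by move=> u; rewrite mulr_natl mulr2n addrA !sinDpi opprK.
have -> : hav z = hav y by rewrite /hav /y periodic_intmul.
have -> : sin z = sin y by rewrite /y periodic_intmul.
have -> : psi (x + z) = psi (x + y) by rewrite /y addrA periodic_intmul.
move=> /sqr_le yh.
have -> : k0 * (M1 ^+ 2 + M1 + M2) * hav y = (M1 ^+ 2 + M1 + M2) * (k0 * hav y) by ring.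
have m1 : `|psi (x + y) - psi x| <= M1 * `|y|.
  have := @mean_value_bound _ _ _ M1 x (x + y) d1 (fun _ _ => h1 _).
  by rewrite [x + y - x]addrAC subrr add0r.
have m2 : `|psi (x + y) - psi x - psi1 x * y| <= M2 * `|y| ^+ 2 by exact: taylor1 d1 d2 _.
have ms : `|sin y - y| <= `|y| ^+ 2.
  have := @taylor1 _ (@sin R) (@cos R) (fun u => - sin u) 1 0 y.
  rewrite add0r sin0 cos0 subr0 !mul1r; apply.
  - by move=> u; exact: is_derive_sin.
  - by move=> u; exact: is_derive_cos.
  - by move=> u _; rewrite normrN ler_norml sin_geN1 sin_le1.
have y2 : `|y| ^+ 2 = y ^+ 2 by rewrite real_normK ?num_real.
have y20 := sqr_ge0 y.
split; apply: (@le_trans _ _ ((M1 ^+ 2 + M1 + M2) * y ^+ 2)).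
- rewrite -[leLHS]real_normK ?num_real//.
  apply: (@le_trans _ _ ((M1 * `|y|) ^+ 2)).
    by rewrite lerXn2r// nnegrE// mulr_ge0.
  by rewrite exprMn y2 ler_wpM2r// -addrA lerDl addr_ge0.
- exact: ler_wpM2l.
- have -> : psi (x + y) - psi x - psi1 x * sin y =
    (psi (x + y) - psi x - psi1 x * y) - psi1 x * (sin y - y) by ring.
  apply: le_trans (ler_normB _ _) _; rewrite normrM.
  apply: (@le_trans _ _ (M2 * y ^+ 2 + M1 * y ^+ 2)).
    apply: lerD; first by rewrite -y2.
    by apply: ler_pM => //; rewrite -y2.
  by rewrite -mulrDl ler_wpM2r// [M2 + _]addrC -addrA lerDr sqr_ge0.
- exact: ler_wpM2l.
Qed.

End haversine.

(** * Regularized powers of the distance *)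

Section weight.
Variable R : realType.
Implicit Types s eta z : R.

(* The power [(eta + hav z) ^ s] *)
Definition weight s eta z := expR (s * ln (eta + hav z)).
Definition weight1 s eta z := s * (sin z / 2) / (eta + hav z) * weight s eta z.
Definition weight2 s eta z := (s * (cos z / 2) / (eta + hav z) +
  s * (s - 1) * (sin z / 2) ^+ 2 / (eta + hav z) ^+ 2) * weight s eta z.

Lemma weight_ge0 s eta z : 0 <= weight s eta z.
Proof. exact: expR_ge0. Qed.

Section positive.
Variable eta : R.
Hypothesis eta0 : 0 < eta.

Lemma addr_hav_gt0 z : 0 < eta + hav z.
Proof. by rewrite ltr_wpDr// hav_ge0. Qed.

Let u0 z : eta + hav z != 0.
Proof. by rewrite gt_eqF// addr_hav_gt0. Qed.

Let derivative_addr_hav : derivative (fun z => eta + hav z) (fun z => sin z / 2).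
Proof.
apply: derivative_eq (derivativeD (derivative_cst eta) (@derivative_hav R)) _ => z.
by rewrite add0r.
Qed.

Lemma derivative_weight s : derivative (weight s eta) (weight1 s eta).
Proof.
have d := derivative_expR (derivativeZ s (derivative_ln derivative_addr_hav addr_hav_gt0)).
by apply: derivative_eq d _ => z; rewrite /weight1 /weight !mulrA.
Qed.

Lemma derivative_weight1 s : derivative (weight1 s eta) (weight2 s eta).
Proof.
have d := derivativeM (derivativeM (derivativeZ s (@derivative_half_sin R))
  (derivative_inv derivative_addr_hav u0)) (derivative_weight s).
apply: derivative_eq d _ => z; rewrite /weight1 /weight2.
by field; rewrite u0.
Qed.

Lemma smooth_weight s n : smooth n (weight s eta).
Proof.
apply/smooth_expR/smoothM; first exact: smooth_cst.
apply: smooth_ln addr_hav_gt0; apply: smoothD (smooth_cst _ _) _.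
exact: smooth_hav.
Qed.

Lemma periodic_weight s : periodic (2 * pi) (weight s eta).
Proof.
move=> z; rewrite /weight /hav.
by rewrite mulr_natl mulr2n addrA !cosDpi opprK.
Qed.

Lemma weight1r z : weight 1 eta z = eta + hav z.
Proof. by rewrite /weight mul1r lnK// posrE addr_hav_gt0. Qed.

Lemma weightN1 z : weight (-1) eta z = (eta + hav z)^-1.
Proof. by rewrite /weight mulN1r expRN lnK// posrE addr_hav_gt0. Qed.

Lemma weight_le s z : 0 <= s -> s <= 1 -> weight s eta z <= 1 + (eta + hav z).
Proof.
move=> s0 s1; have v0 := addr_hav_gt0 z; rewrite /weight; set v := eta + _ in v0 *.
have v10 : 0 < 1 + v by rewrite addr_gt0.
have -> : 1 + v = expR (ln (1 + v)) by rewrite lnK.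
rewrite ler_expR.
have l0 : 0 <= ln (1 + v) by rewrite ln_ge0// lerDl ltW.
have l1 : ln v <= ln (1 + v) by rewrite ler_ln// lerDr.
apply: (@le_trans _ _ (s * ln (1 + v))); first exact: ler_wpM2l.
by rewrite ler_piMl.
Qed.

(** That is, [eta * v^(s - 1) <= eta^s] for [v = eta + hav z >= eta]. This absorbs the defect of the
    generator where [hav z] does not dominate [eta]: for [s > 0] the right-hand side vanishes with
    [eta]. *)
Lemma weight_quotient_le s z : s <= 1 ->
  weight s eta z * (eta / (eta + hav z)) <= weight s eta 0.
Proof.
move=> s1; have v0 := addr_hav_gt0 z; rewrite /weight {3}/hav cos0 subrr mul0r addr0.
rewrite -{2}[eta]lnK ?posrE// -[X in _ / X]lnK ?posrE// -expRN -!expRD ler_expR.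
have : ln eta <= ln (eta + hav z) by rewrite ler_ln ?posrE// lerDl hav_ge0.
set a := ln _; set c := ln _ => ac.
have : 0 <= (1 - s) * (c - a) by rewrite mulr_ge0// subr_ge0.
by lra.
Qed.

End positive.
End weight.

(** * Expansion of the generator near the diagonal *)

Section expansion.
Variable R : realFieldType.
Implicit Types S alpha beta a b c e G : R.

Let mul_bound x y a b : `|x| <= a -> `|y| <= b -> `|x * y| <= a * b.
Proof. by move=> h1 h2; rewrite normrM ler_pM. Qed.

(** [S] stands for [hav z], [s1] for [sin z / 2], and [a] for the derivative of a coefficient whose
    increment is [beta]. These expansions recover, up to a factor [e] of smallness, the coefficients
    of the linearized flow. *)
Lemma first_order_expansion S s1 e G c a beta : 0 <= S -> S <= e -> `|s1| <= e ->
  s1 ^+ 2 = S * (1 - S) -> `|a| <= G -> `|beta - a * (2 * s1)| <= c * S ->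
  `|s1 * beta - 2 * a * S| <= (2 * G + c) * e * S.
Proof.
move=> S0 Se se s1E aG r.
have -> : s1 * beta - 2 * a * S = s1 * (beta - a * (2 * s1)) - 2 * (a * S * S).
  have -> : s1 * beta = s1 * (beta - a * (2 * s1)) + 2 * a * s1 ^+ 2 by ring.
  by rewrite s1E; ring.
have -> : (2 * G + c) * e * S = e * (c * S) + 2 * (G * e * S) by ring.
apply: le_trans (ler_normB _ _) _; apply: lerD; first exact: mul_bound.
rewrite normrM [`|2|]ger0_norm// ler_pM2l//.
by apply: mul_bound; [apply: mul_bound|]; rewrite ?(ger0_norm S0).
Qed.

Lemma square_expansion S s1 e G c a alpha : 0 <= S -> S <= 1 -> S <= e -> `|s1| <= e -> 0 <= c ->
  s1 ^+ 2 = S * (1 - S) -> `|a| <= G -> `|alpha - a * (2 * s1)| <= c * S ->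
  `|alpha ^+ 2 - 4 * a ^+ 2 * S| <= (4 * G ^+ 2 + 4 * G * c + c ^+ 2) * e * S.
Proof.
move=> S0 S1 Se se c0 s1E aG r; have e0 := le_trans S0 Se.
have -> : alpha ^+ 2 - 4 * a ^+ 2 * S = (alpha - a * (2 * s1)) * (alpha - a * (2 * s1)) +
    4 * (a * s1 * (alpha - a * (2 * s1))) - 4 * (a * a * S * S).
  have -> : alpha ^+ 2 = (alpha - a * (2 * s1)) * (alpha - a * (2 * s1)) +
    4 * (a * s1 * (alpha - a * (2 * s1))) + 4 * (a * a * s1 ^+ 2) by ring.
  by rewrite s1E; ring.
have -> : (4 * G ^+ 2 + 4 * G * c + c ^+ 2) * e * S = c * e * (c * S) +
  4 * (G * e * (c * S)) + 4 * (G * G * e * S) by ring.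
apply: le_trans (ler_normB _ _) _; apply: lerD; last first.
  rewrite normrM [`|4|]ger0_norm// ler_pM2l//.
  by do 3 (apply: mul_bound; rewrite ?(ger0_norm S0)//).
apply: le_trans (ler_normD _ _) _; apply: lerD.
  by apply: mul_bound => //; apply: le_trans r _; exact: ler_wpM2l.
rewrite normrM [`|4|]ger0_norm// ler_pM2l//.
by apply: mul_bound => //; exact: mul_bound.
Qed.

Lemma cosine_expansion S e k c a alpha : 0 <= S -> S <= e -> 0 <= c -> 0 <= k ->
  alpha ^+ 2 <= c * S ->
  `|alpha ^+ 2 - 4 * a ^+ 2 * S| <= k * e * S ->
  `|(2^-1 - S) * alpha ^+ 2 - 2 * a ^+ 2 * S| <= (k + c) * e * S /\
  `|S * (1 - S) * alpha ^+ 2 - 4 * a ^+ 2 * S ^+ 2| <= (k + c) * e * S ^+ 2.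
Proof.
move=> S0 Se c0 k0 h r; have e0 := le_trans S0 Se.
have n2 : `|alpha ^+ 2| <= c * S by rewrite ger0_norm// sqr_ge0.
have nS : `|S| <= e by rewrite ger0_norm.
split.
  have -> : (2^-1 - S) * alpha ^+ 2 - 2 * a ^+ 2 * S =
    (alpha ^+ 2 - 4 * a ^+ 2 * S) / 2 - S * alpha ^+ 2 by field.
  have -> : (k + c) * e * S = k * e * S + e * (c * S) by ring.
  apply: le_trans (ler_normB _ _) _; apply: lerD; last exact: mul_bound.
  exact: le_trans (norm_half_le _) r.
have -> : S * (1 - S) * alpha ^+ 2 - 4 * a ^+ 2 * S ^+ 2 =
  S * (alpha ^+ 2 - 4 * a ^+ 2 * S) - S * S * alpha ^+ 2 by ring.
have -> : (k + c) * e * S ^+ 2 = S * (k * e * S) + S * e * (c * S) by ring.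
have nSS : `|S| <= S by rewrite ger0_norm.
by apply: le_trans (ler_normB _ _) _; apply: lerD; apply: mul_bound => //; exact: mul_bound.
Qed.

Lemma div_expansion S u x y K : 0 <= S -> S <= u -> 0 < u -> 0 <= K ->
  `|x - y * S| <= K * S -> `|x / u - y * (S / u)| <= K.
Proof.
move=> S0 Su u0 K0 h.
have -> : x / u - y * (S / u) = (x - y * S) / u by field; rewrite gt_eqF.
rewrite normrM [`|u^-1|]gtr0_norm ?invr_gt0// ler_pdivrMr// (le_trans h)//.
exact: ler_wpM2l.
Qed.

(** At [q = 1] and [s = e = 0] the multiples 1, 1 and -2 of [f1 ^+ 2] coming from [p1], [p2 / 2] and
    [- p3 / 2] cancel, and [f f2 + 2 L] remains, which the corrector makes negative. The rest is
    perturbation in [s], [1 - q] and [e]. *)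
Lemma quotient_bound s q e V L g g1 f f1 f2 p1 p2 p3 p4 c0 c G :
  0 <= s -> s <= 1 -> 0 <= q -> q <= 1 -> 0 <= e -> 0 <= c ->
  V = 1 + 2 * s * g -> `|V| <= 2 ->
  `|f| <= G -> `|f1| <= G -> `|f2| <= G -> `|g| <= G -> `|g1| <= G ->
  `|p1 - (f * f2 + f1 ^+ 2) * q| <= c * e -> `|p2 - 2 * f1 ^+ 2 * q| <= c * e ->
  `|p3 - 4 * f1 ^+ 2 * q ^+ 2| <= c * e -> `|p4 - 2 * f1 * f * q| <= c * e ->
  f * f2 + 2 * L <= - c0 ->
  V * (p1 + p2 / 2 + (s - 1) * p3 / 2) + 2 * L + 2 * s * p4 * g1 <=
  - c0 + (16 * G ^+ 2 + 10 * G ^+ 3 + 4 * c + 2 * G * c) * (s + (1 - q) + e).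
Proof.
move=> s0 s1 q0 q1 e0 c0' VE V2 fG f1G f2G gG g1G h1 h2 h3 h4 hL.
have G0 := le_trans (normr_ge0 _) fG; have ce0 : 0 <= c * e by rewrite mulr_ge0.
have ff2 : `|f * f2| <= G ^+ 2 by rewrite expr2; exact: mul_bound.
have f1f1 : `|f1 ^+ 2| <= G ^+ 2 by rewrite !expr2; exact: mul_bound.
have G20 : 0 <= G ^+ 2 by exact: sqr_ge0.
have G30 : 0 <= G ^+ 3 by exact: exprn_ge0.
have sn : `|s - 1| <= 1 by rewrite ler_norml; clear -s0 s1; apply/andP; split; lra.
have sn0 : `|s| <= s by rewrite ger0_norm.
have q1n : `|1 - q| <= 1 - q by rewrite ger0_norm// subr_ge0.
have q2n : `|1 - q ^+ 2| <= 2 * (1 - q).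
  have -> : 1 - q ^+ 2 = (1 + q) * (1 - q) by ring.
  by apply: mul_bound => //; clear -q0 q1; rewrite ger0_norm; lra.
(* The value of [A] below for [q = 1] and [e = 0]. *)
pose A0 := f * f2 + 2 * (s * f1 ^+ 2).
pose A := p1 + p2 / 2 + (s - 1) * p3 / 2.
have A0n : `|A0| <= 3 * G ^+ 2.
  have : `|s * f1 ^+ 2| <= 1 * G ^+ 2 by apply: mul_bound => //; rewrite ger0_norm.
  move: ff2; rewrite /A0 !ler_norml; clear => /andP[? ?] /andP[? ?]; apply/andP; split; lra.
have AA : `|A - A0| <= 2 * (c * e) + 7 * (G ^+ 2 * (1 - q)).
  pose r1 := p1 - (f * f2 + f1 ^+ 2) * q; pose r2 := p2 - 2 * f1 ^+ 2 * q.
  pose r3 := p3 - 4 * f1 ^+ 2 * q ^+ 2.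
  have -> : A - A0 = r1 + r2 / 2 + (s - 1) * r3 / 2 - f * f2 * (1 - q) -
      2 * (f1 ^+ 2 * (1 - q)) - 2 * ((s - 1) * (f1 ^+ 2 * (1 - q ^+ 2))).
    by rewrite /A /A0 /r1 /r2 /r3; field.
  have k1 : `|r1| <= c * e by [].
  have k2 : `|r2| <= c * e by [].
  have k3 : `|(s - 1) * r3| <= 1 * (c * e) by exact: mul_bound.
  have k4 : `|f * f2 * (1 - q)| <= G ^+ 2 * (1 - q) by exact: mul_bound.
  have k5 : `|f1 ^+ 2 * (1 - q)| <= G ^+ 2 * (1 - q) by exact: mul_bound.
  have k6 : `|(s - 1) * (f1 ^+ 2 * (1 - q ^+ 2))| <= 1 * (G ^+ 2 * (2 * (1 - q))).
    by apply: mul_bound => //; exact: mul_bound.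
  move: k1 k2 k3 k4 k5 k6; clear.
  set x1 := r1; set x2 := r2; set x3 := _ * r3; set x4 := _ * (1 - q).
  set x5 := f1 ^+ 2 * (1 - q); set x6 := (s - 1) * _; set y := G ^+ 2 * (2 * _).
  have -> : y = 2 * (G ^+ 2 * (1 - q)) by rewrite /y; ring.
  set z := G ^+ 2 * _; set w := c * e.
  clearbody x1 x2 x3 x4 x5 x6 z w.
  rewrite !ler_norml => /andP[? ?] /andP[? ?] /andP[? ?] /andP[? ?] /andP[? ?] /andP[? ?].
  by apply/andP; split; lra.
have gA : `|s * (g * A0)| <= s * (G * (3 * G ^+ 2)).
  by apply: mul_bound => //; exact: mul_bound.
have VA : `|V * (A - A0)| <= 2 * (2 * (c * e) + 7 * (G ^+ 2 * (1 - q))) by exact: mul_bound.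
have sf : `|s * f1 ^+ 2| <= s * G ^+ 2 by exact: mul_bound.
have p4n : `|s * ((p4 - 2 * f1 * f * q) * g1)| <= 1 * (c * e * G).
  by apply: mul_bound; [rewrite ger0_norm|exact: mul_bound].
have m4 : `|s * (f1 * f * q * g1)| <= s * (G * G * 1 * G).
  have qn : `|q| <= 1 by rewrite ger0_norm.
  by do 4 (apply: mul_bound => //).
have -> : V * (p1 + p2 / 2 + (s - 1) * p3 / 2) + 2 * L + 2 * s * p4 * g1 =
  (f * f2 + 2 * L) + 2 * (s * f1 ^+ 2) + 2 * (s * (g * A0)) + V * (A - A0) +
  2 * (s * ((p4 - 2 * f1 * f * q) * g1)) + 4 * (s * (f1 * f * q * g1)).
  by rewrite /A /A0 VE; field.
have -> : (16 * G ^+ 2 + 10 * G ^+ 3 + 4 * c + 2 * G * c) * (s + (1 - q) + e) =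
  2 * (s * G ^+ 2) + 2 * (s * (G * (3 * G ^+ 2))) + 2 * (2 * (c * e) + 7 * (G ^+ 2 * (1 - q))) +
  2 * (1 * (c * e * G)) + 4 * (s * (G * G * 1 * G)) +
  (14 * (s * G ^+ 2) + (4 * c + 2 * G * c) * s + (2 * G ^+ 2 + 10 * G ^+ 3 + 4 * c + 2 * G * c) * (1 - q) +
  (16 * G ^+ 2 + 10 * G ^+ 3) * e) by ring.
have rest : 0 <= 14 * (s * G ^+ 2) + (4 * c + 2 * G * c) * s + (2 * G ^+ 2 + 10 * G ^+ 3 + 4 * c + 2 * G * c) * (1 - q) +
  (16 * G ^+ 2 + 10 * G ^+ 3) * e.
  have gc : 0 <= G * c by exact: mulr_ge0.
  have q10 : 0 <= 1 - q by rewrite subr_ge0.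
  have k1 : 0 <= 4 * c + 2 * G * c by clear -gc c0'; lra.
  have k2 : 0 <= 2 * G ^+ 2 + 10 * G ^+ 3 + 4 * c + 2 * G * c by clear -k1 G20 G30; lra.
  have k3 : 0 <= 16 * G ^+ 2 + 10 * G ^+ 3 by clear -G20 G30; lra.
  have := mulr_ge0 k3 e0; have := mulr_ge0 k2 q10; have := mulr_ge0 k1 s0.
  by have := mulr_ge0 s0 G20; clear; lra.
move: (ler_normlW gA) (ler_normlW VA) (ler_normlW sf) (ler_normlW p4n) (ler_normlW m4) rest hL.
move: (s * (g * A0)) (V * (A - A0)) (s * f1 ^+ 2) (s * ((p4 - 2 * f1 * f * q) * g1)) => x1 x2 x3 x4.
move: (s * (f1 * f * q * g1)) (f * f2 + 2 * L) (1 * (c * e * G)) => x5 x6 x7.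
move: (s * (G * (3 * G ^+ 2))) (2 * (2 * (c * e) + 7 * (G ^+ 2 * (1 - q)))) => x8 x9.
move: (s * G ^+ 2) (s * (G * G * 1 * G)) (16 * G ^+ 2 + 10 * G ^+ 3) => x10 x11 x12.
by clear; lra.
Qed.

End expansion.

Section elementary.
Variable R : realFieldType.

Lemma norm_half_sub (S : R) : 0 <= S -> S <= 1 -> `|2^-1 - S| <= 1.
Proof. by move=> h1 h2; rewrite ler_norml; apply/andP; split; lra. Qed.

Lemma collect_terms (x y z a c : R) : 0 <= c -> x <= a -> y <= c -> z <= 2 * c ->
  x + (y + z) / 2 <= a + 2 * c.
Proof. by move=> h1 h2 h3 h4; lra. Qed.

Lemma quarter_half (s G : R) : 4 * G * s <= 1 -> 2 * s * G <= 2^-1.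
Proof. by move=> h; lra. Qed.

Lemma one_half_interval (x : R) : `|x| <= 2^-1 -> 2^-1 <= 1 + x <= 3 / 2.
Proof. by rewrite ler_norml => /andP[h1 h2]; apply/andP; split; lra. Qed.

Lemma three_half_le2 : 3 / 2 <= 2 :> R.
Proof. by lra. Qed.

Lemma norm_le_add_div (t S x : R) : 0 < t -> x ^+ 2 <= S -> `|x| <= t + S / t.
Proof.
move=> t0 h; have -> : t + S / t = (t ^+ 2 + S) / t by field; rewrite gt_eqF.
rewrite ler_pdivlMr//.
have := sqr_ge0 (`|x| - t); have := sqr_ge0 (`|x| + t).
have -> : (`|x| - t) ^+ 2 = x ^+ 2 - 2 * (`|x| * t) + t ^+ 2.
  by rewrite -[x ^+ 2]real_normK ?num_real//; ring.
have -> : (`|x| + t) ^+ 2 = x ^+ 2 + 2 * (`|x| * t) + t ^+ 2.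
  by rewrite -[x ^+ 2]real_normK ?num_real//; ring.
by move: h; move: (`|x| * t) (x ^+ 2) (sqr_ge0 x) (sqr_ge0 t) => *; lra.
Qed.

Lemma collect_decay (K s c p r : R) : 2 * K * s <= c ->
  - (2 * c) + K * (s + p + (s + r)) <= - c + K * p + K * r.
Proof. by move=> h; lra. Qed.

Lemma one_add_le3 (eta S : R) : eta <= 1 -> S <= 1 -> 1 + (eta + S) <= 3.
Proof. by move=> *; lra. Qed.

Lemma half_neg (a v w : R) : a * v <= a * (2 * w) -> - a * w <= - (a / 2) * v.
Proof. by move=> h; lra. Qed.

End elementary.

(** * The generator on weighted distances *)

Section weight_generator.
Variables (R : realType) (rho : R) (f f1 f2 : R -> R).
Hypotheses (df : derivative f f1) (df1 : derivative f1 f2).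
Hypotheses (sf : forall n, smooth n f) (pf : periodic (2 * pi) f).

Definition drift x := rho + 2^-1 * f1 x * f x.
Let b := drift.
Let b1 x := (f x * f2 x + f1 x ^+ 2) / 2.

Let T0 : 0 < 2 * pi :> R.
Proof. by rewrite mulr_gt0// pi_gt0. Qed.

Lemma derivative_drift : derivative drift b1.
Proof.
have d := derivativeD (derivative_cst rho) (derivativeM (derivativeZ 2^-1 df1) df).
by apply: derivative_eq d _ => x; rewrite /b1; field.
Qed.

Lemma periodic_drift : periodic (2 * pi) drift.
Proof. by move=> x; rewrite /drift pf (derivative_periodic df pf). Qed.

Lemma smooth_drift n : smooth n drift.
Proof.
apply: smoothD; first exact: smooth_cst.
apply: smoothM => //; apply: smoothM; first exact: smooth_cst.
by apply: smooth_derivative df _.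
Qed.

(** All terms share the factor [weight s eta z]; the quotients by [u] and [u ^+ 2] are the [p1],
    ..., [p4] of [quotient_bound]. *)
Let generator_weight s eta V V1 V2 x y : 0 < eta ->
  let z := y - x in let u := eta + hav z in
  generator f b (weight s eta) (weight1 s eta) (weight2 s eta) V V1 V2 x y =
  weight s eta z * (V x * (s * (sin z / 2 * (b y - b x) / u) +
    (s * ((2^-1 - hav z) * (f y - f x) ^+ 2 / u) +
     s * (s - 1) * (hav z * (1 - hav z) * (f y - f x) ^+ 2 / u ^+ 2)) / 2) +
    (V1 x * b x + V2 x * f x ^+ 2 / 2) + s * (f x * (sin z / 2 * (f y - f x)) / u) * V1 x).
Proof.
move=> eta0 z u; have u0 : u != 0 by rewrite gt_eqF// addr_hav_gt0.
have -> : hav z * (1 - hav z) = (sin z / 2) ^+ 2.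
  by rewrite exprMn sin_sqr_hav; field.
have -> : 2^-1 - hav z = cos z / 2 by rewrite /hav; field.
rewrite /generator /weight1 /weight2 -/z -/u; field; exact: u0.
Qed.

(** The squared increments of [f] and [drift] are of order [hav z], hence of order [u]. The case
    [s = 1] bounds the growth of the distance, and the case [s = -1] keeps the derivative of the
    flow from vanishing. *)
Lemma exists_weight_generator_bound : exists2 c, 0 <= c & forall s eta x y, `|s| <= 1 -> 0 < eta ->
  generator f drift (weight s eta) (weight1 s eta) (weight2 s eta)
    (fun=> 1) (fun=> 0) (fun=> 0) x y <= c * weight s eta (y - x).
Proof.
have cf2 : continuous f2.
  by have := smooth_derivative df1 (smooth_derivative df (sf 2)).
have sb1 := smooth_derivative derivative_drift (smooth_drift 2).
have [b2 db1 cb2] := sb1.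
have [cf cf0 hf] := periodic_increment df df1 cf2 pf.
have [cb cb0 hb] := periodic_increment derivative_drift db1 cb2 periodic_drift.
exists (1 + cb + 2 * cf); first by rewrite !addr_ge0// mulr_ge0.
move=> s eta x y s1 eta0.
have := generator_weight s (fun=> 1) (fun=> 0) (fun=> 0) x y eta0; cbv beta zeta => ->.
rewrite mul1r !(mul0r, mulr0, addr0) mulrC ler_wpM2r ?weight_ge0//.
have {}hf := (hf x (y - x)).1; have {}hb := (hb x (y - x)).1.
have xy : x + (y - x) = y by ring.
rewrite xy in hf hb; move: hf hb.
set z := y - x; set u := eta + hav z; set al := f y - f x; set be := b y - b x => hf hb.
have u0 : 0 < u by exact: addr_hav_gt0.
have S0 := hav_ge0 z; have S1 := hav_le1 z.
have Su : hav z <= u by rewrite lerDr ltW.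
have p1 : `|sin z / 2 * be / u| <= 1 + cb.
  rewrite normrM [`|u^-1|]gtr0_norm ?invr_gt0// ler_pdivrMr//.
  apply: le_trans (normM_le_sqrD _ _) _.
  have -> : (sin z / 2) ^+ 2 = hav z * (1 - hav z) by rewrite exprMn sin_sqr_hav; field.
  have h1 : hav z * (1 - hav z) <= hav z by rewrite ler_piMr// lerBlDr lerDl.
  by rewrite mulrDl mul1r lerD ?(le_trans h1)// (le_trans hb)// ler_wpM2l.
have p2 : `|(2^-1 - hav z) * al ^+ 2 / u| <= cf.
  rewrite normrM [`|u^-1|]gtr0_norm ?invr_gt0// ler_pdivrMr// normrM.
  rewrite -[leRHS]mul1r ler_pM//; first by exact: norm_half_sub.
  by rewrite ger0_norm ?sqr_ge0// (le_trans hf)// ler_wpM2l.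
have p3 : `|hav z * (1 - hav z) * al ^+ 2 / u ^+ 2| <= cf.
  rewrite normrM [`|(u ^+ 2)^-1|]gtr0_norm ?invr_gt0 ?exprn_gt0// ler_pdivrMr ?exprn_gt0// normrM.
  have -> : cf * u ^+ 2 = u * (cf * u) by ring.
  rewrite ler_pM//.
    by rewrite ger0_norm ?mulr_ge0 ?subr_ge0// (le_trans _ Su)// ler_piMr// lerBlDr lerDl.
  by rewrite ger0_norm ?sqr_ge0// (le_trans hf)// ler_wpM2l.
move: p1 p2 p3; set p1 := _ / u; set p2 := _ / u; set p3 := _ / u ^+ 2 => h1 h2 h3.
have k1 : s * p1 <= 1 + cb.
  by rewrite (le_trans (ler_norm _))// normrM -[leRHS]mul1r ler_pM.
have k2 : s * p2 <= cf.
  by rewrite (le_trans (ler_norm _))// normrM -[leRHS]mul1r ler_pM.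
have k3 : s * (s - 1) * p3 <= 2 * cf.
  rewrite (le_trans (ler_norm _))// normrM ler_pM// normrM -[leRHS]mul1r ler_pM//.
  by apply: le_trans (ler_normB _ _) _; rewrite normr1 mulr2n lerD.
exact: collect_terms cf0 k1 k2 k3.
Qed.

Variables (g g1 g2 : R -> R) (c0 : R).
Hypotheses (dg : derivative g g1) (dg1 : derivative g1 g2) (pg : periodic (2 * pi) g).
Hypotheses (c00 : 0 < c0).
Hypothesis hL : forall x,
  f x * f2 x / 2 + rho * g1 x + f x * (f1 x * g1 x + f x * g2 x) / 2 <= - c0.

(** Multiplied by the weight, the errors [1 - S / u] and [S / s] left by [quotient_bound] become the
    two terms on the right: the first is [eta / u], absorbed by [weight_quotient_le], and the second
    uses that the weight is at most 3. *)
Lemma exists_weight_generator_decay : exists s al K,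
  [/\ 0 < s, s <= 2^-1, 0 < al & 0 <= K] /\
  (forall x, 2^-1 <= 1 + 2 * s * g x <= 3 / 2) /\
  forall eta x y, 0 < eta -> eta <= 1 ->
  generator f drift (weight s eta) (weight1 s eta) (weight2 s eta)
    (fun x => 1 + 2 * s * g x) (fun x => 2 * s * g1 x) (fun x => 2 * s * g2 x) x y <=
  - al * (weight s eta (y - x) * (1 + 2 * s * g x)) + K * (weight s eta 0 + hav (y - x)).
Proof.
have cf2 : continuous f2.
  by have := smooth_derivative df1 (smooth_derivative df (sf 2)).
have [b2 db1 cb2] := smooth_derivative derivative_drift (smooth_drift 2).
have [cf cf0 hf] := periodic_increment df df1 cf2 pf.
have [cb cb0 hb] := periodic_increment derivative_drift db1 cb2 periodic_drift.
have pf1 := derivative_periodic df pf; have pf2 := derivative_periodic df1 pf1.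
have pb1 := derivative_periodic derivative_drift periodic_drift.
have pg1 := derivative_periodic dg pg.
have [G0 h0] := periodic_bounded T0 (derivative_continuous df) pf.
have [G1 h1] := periodic_bounded T0 (derivative_continuous df1) pf1.
have [G2 h2] := periodic_bounded T0 cf2 pf2.
have [G3 h3] := periodic_bounded T0 (derivative_continuous db1) pb1.
have [G4 h4] := periodic_bounded T0 (derivative_continuous dg) pg.
have [G5 h5] := periodic_bounded T0 (derivative_continuous dg1) pg1.
have n0 := le_trans (normr_ge0 _) (h0 0); have n1 := le_trans (normr_ge0 _) (h1 0).
have n2 := le_trans (normr_ge0 _) (h2 0); have n3 := le_trans (normr_ge0 _) (h3 0).
have n4 := le_trans (normr_ge0 _) (h4 0); have n5 := le_trans (normr_ge0 _) (h5 0).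
have [G [GG0 k0 k1 k2 [k3 k4 k5]]] : exists G, [/\ 0 <= G, G0 <= G, G1 <= G, G2 <= G &
    [/\ G3 <= G, G4 <= G & G5 <= G]].
  by exists (G0 + G1 + G2 + G3 + G4 + G5); split; [..|split]; lra.
have {h0 k0} fG x : `|f x| <= G := le_trans (h0 x) k0.
have {h1 k1} f1G x : `|f1 x| <= G := le_trans (h1 x) k1.
have {h2 k2} f2G x : `|f2 x| <= G := le_trans (h2 x) k2.
have {h3 k3} b1G x : `|b1 x| <= G := le_trans (h3 x) k3.
have {h4 k4} gG x : `|g x| <= G := le_trans (h4 x) k4.
have {h5 k5} g1G x : `|g1 x| <= G := le_trans (h5 x) k5.
clear n0 n1 n2 n3 n4 n5.
have [c [c_ge0 cfc cbc]] : exists c, [/\ 0 <= c, cf <= c & cb <= c].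
  by exists (cf + cb); split; lra.
pose k := 4 * G ^+ 2 + 4 * G * c + c ^+ 2.
have k_ge0 : 0 <= k.
  by rewrite !addr_ge0// ?sqr_ge0// mulr_ge0// ?sqr_ge0// mulr_ge0.
pose cc := (2 * G + c) + (k + c) + G * (2 * G + c).
have Gc0 : 0 <= 2 * G + c by rewrite addr_ge0// mulr_ge0.
have GGc0 : 0 <= G * (2 * G + c) by rewrite mulr_ge0.
have kc0 : 0 <= k + c by rewrite addr_ge0.
have cc0 : 0 <= cc by apply: addr_ge0 => //; exact: addr_ge0.
pose K := 16 * G ^+ 2 + 10 * G ^+ 3 + 4 * cc + 2 * G * cc.
have K0 : 0 <= K.
  apply: addr_ge0; last by apply: mulr_ge0 => //; exact: mulr_ge0.
  apply: addr_ge0; last exact: mulr_ge0.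
  by apply: addr_ge0; apply: mulr_ge0 => //; exact: exprn_ge0.
(* [2 * K * s <= c0] lets the errors of order [s] consume half of the gain [2 * c0], and
   [4 * G * s <= 1] keeps [V] between [1/2] and [3/2]. *)
pose s := Num.min 2^-1 (Num.min (c0 / (2 * K + 1)) (4 * G + 1)^-1).
have K20 : 0 < 2 * K + 1 by rewrite ltr_wpDl// mulr_ge0.
have G40 : 0 < 4 * G + 1 by rewrite ltr_wpDl// mulr_ge0.
have s0 : 0 < s by rewrite !lt_min invr_gt0 ltr0n/= divr_gt0// invr_gt0.
have s2 : s <= 2^-1 by rewrite ge_min lexx.
have s1 : s <= 1 by apply: le_trans s2 _; rewrite invf_le1// ler1n.
have sK : 2 * K * s <= c0.
  have : s <= c0 / (2 * K + 1) by rewrite !ge_min lexx orbT.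
  rewrite ler_pdivlMr// mulrDr mulr1 mulrC => /(le_trans _); apply.
  by rewrite lerDl ltW.
have sG : 4 * G * s <= 1.
  have : s <= (4 * G + 1)^-1 by rewrite !ge_min lexx !orbT.
  rewrite -(ler_pM2r G40) mulVf ?gt_eqF// mulrDr mulr1 mulrC => /(le_trans _); apply.
  by rewrite lerDl ltW.
have sg x : `|2 * s * g x| <= 2^-1.
  apply: (@le_trans _ _ (2 * s * G)); last by move: sG; exact: quarter_half.
  by rewrite normrM ger0_norm ?mulr_ge0 ?(ltW s0)// ler_wpM2l ?mulr_ge0 ?(ltW s0).
have Vb x : 2^-1 <= 1 + 2 * s * g x <= 3 / 2.
  by have := sg x; exact: one_half_interval.
exists s, (s * c0 / 2), (3 * K); split; first by split; rewrite ?mulr_gt0 ?mulr_ge0.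
split=> // eta x y eta0 eta1.
have := generator_weight s (fun x => 1 + 2 * s * g x) (fun x => 2 * s * g1 x)
  (fun x => 2 * s * g2 x) x y eta0; cbv beta zeta => ->.
have [hfx rfx] := hf x (y - x); have [_ rbx] := hb x (y - x).
have xy : x + (y - x) = y by ring.
rewrite xy in hfx rfx rbx; move: hfx rfx rbx.
set z := y - x; set u := eta + hav z; set al := f y - f x; set be := b y - b x.
set S := hav z => hfx rfx rbx.
set V := 1 + _; set V1 := 2 * s * g1 x.
have u0 : 0 < u by exact: addr_hav_gt0.
have S0 : 0 <= S := hav_ge0 z; have S1 : S <= 1 := hav_le1 z.
have Su : S <= u by rewrite lerDr ltW.
have [q0 q1] : 0 <= S / u /\ S / u <= 1.
  by rewrite divr_ge0 ?(ltW u0)// ler_pdivrMr// mul1r.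
(* The size of [sin z / 2] is only the square root of [S]; Young's inequality bounds it by [s],
   which the gain absorbs, plus [S / s], which is left as an error. *)
pose e := s + S / s.
have Ss : S <= S / s by rewrite ler_peMr// invf_ge1.
have Se : S <= e by rewrite /e ler_wpDl// ltW.
have e0 := le_trans S0 Se.
have s1E : (sin z / 2) ^+ 2 = S * (1 - S) by rewrite exprMn sin_sqr_hav /S; field.
have se : `|sin z / 2| <= e.
  apply: norm_le_add_div => //; rewrite s1E ler_piMr// lerBlDr lerDl//.
have sin2 : sin z = 2 * (sin z / 2) by field.
rewrite sin2 in rfx rbx; set sn := sin z / 2 in s1E se rfx rbx *.
have {}hfx : al ^+ 2 <= c * S by apply: le_trans hfx _; rewrite ler_wpM2r.
have {}rfx : `|al - f1 x * (2 * sn)| <= c * S by apply: le_trans rfx _; rewrite ler_wpM2r.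
have {}rbx : `|be - b1 x * (2 * sn)| <= c * S by apply: le_trans rbx _; rewrite ler_wpM2r.
have E1 := first_order_expansion S0 Se se s1E (b1G x) rbx.
have E4 := first_order_expansion S0 Se se s1E (f1G x) rfx.
have Ea := square_expansion S0 S1 Se se c_ge0 s1E (f1G x) rfx.
have [E2 E3] := cosine_expansion S0 Se c_ge0 k_ge0 hfx Ea.
have ce a : 0 <= a -> a <= cc -> a * e <= cc * e by move=> *; exact: ler_wpM2r.
have {}E1 : `|sn * be / u - (f x * f2 x + f1 x ^+ 2) * (S / u)| <= cc * e.
  apply: (@le_trans _ _ ((2 * G + c) * e)); last by rewrite ler_wpM2r// /cc -addrA lerDl addr_ge0.
  apply: div_expansion => //; first exact: mulr_ge0.
  by have -> : f x * f2 x + f1 x ^+ 2 = 2 * b1 x by rewrite /b1; field.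
have {}E2 : `|(2^-1 - S) * al ^+ 2 / u - 2 * f1 x ^+ 2 * (S / u)| <= cc * e.
  apply: (@le_trans _ _ ((k + c) * e)).
    by apply: div_expansion => //; exact: mulr_ge0.
  by rewrite ler_wpM2r// /cc [leRHS]addrAC lerDr addr_ge0.
have {}E3 : `|S * (1 - S) * al ^+ 2 / u ^+ 2 - 4 * f1 x ^+ 2 * (S / u) ^+ 2| <= cc * e.
  apply: (@le_trans _ _ ((k + c) * e)).
    rewrite expr_div_n; apply: div_expansion; rewrite ?exprn_ge0 ?exprn_gt0 ?mulr_ge0//.
    by rewrite lerXn2r// nnegrE ltW.
  by rewrite ler_wpM2r// /cc [leRHS]addrAC lerDr addr_ge0.
have {}E4 : `|f x * (sn * al) / u - 2 * f1 x * f x * (S / u)| <= cc * e.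
  apply: (@le_trans _ _ (G * (2 * G + c) * e)); last by rewrite ler_wpM2r// /cc lerDr addr_ge0.
  apply: div_expansion => //; first exact: mulr_ge0.
  have -> : f x * (sn * al) - 2 * f1 x * f x * S = f x * (sn * al - 2 * f1 x * S) by ring.
  have -> : G * (2 * G + c) * e * S = G * ((2 * G + c) * e * S) by ring.
  by rewrite normrM ler_pM.
have V2 : `|V| <= 2.
  have := Vb x; rewrite -/V => /andP[v1 v2].
  by rewrite ger0_norm; [exact: le_trans v2 (three_half_le2 R)|apply: le_trans v1].
have L1 : f x * f2 x + 2 * (g1 x * b x + g2 x * f x ^+ 2 / 2) <= - (2 * c0).
  have -> : f x * f2 x + 2 * (g1 x * b x + g2 x * f x ^+ 2 / 2) =
    2 * (f x * f2 x / 2 + rho * g1 x + f x * (f1 x * g1 x + f x * g2 x) / 2).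
    by rewrite /b /drift; field.
  by rewrite -mulrN ler_pM2l.
have Q := quotient_bound (ltW s0) s1 q0 q1 e0 cc0 erefl V2 (fG x) (f1G x) (f2G x) (gG x)
  (g1G x) E1 E2 E3 E4 L1.
move: Q; rewrite -/V -/K.
set p1 := sn * be / u; set p2 := _ / u; set p3 := _ / u ^+ 2; set p4 := f x * _ / u.
set L := _ + g2 x * _ / 2 => Q.
have -> : V * (s * p1 + (s * p2 + s * (s - 1) * p3) / 2) +
   (V1 * b x + 2 * s * g2 x * f x ^+ 2 / 2) + s * p4 * V1 =
   s * (V * (p1 + p2 / 2 + (s - 1) * p3 / 2) + 2 * L + 2 * s * p4 * g1 x).
  by rewrite /L /V1; field.
have B0 := weight_ge0 s eta z.
apply: (@le_trans _ _ (weight s eta z * (s * (- c0 + K * (1 - S / u) + K * (S / s))))).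
  rewrite ler_wpM2l// ler_pM2l//; apply: le_trans Q _; rewrite /e.
  exact: collect_decay sK.
have BQ : weight s eta z * (1 - S / u) <= weight s eta 0.
  apply: le_trans (weight_quotient_le eta0 z s1).
  have -> // : 1 - S / u = eta / u.
  by rewrite -[1](divff (lt0r_neq0 u0)) -mulrBl /u addrK.
have B3 : weight s eta z * S <= 3 * S.
  rewrite ler_wpM2r// (le_trans (weight_le eta0 _ (ltW s0) s1))//.
  by apply: one_add_le3.
have BV : weight s eta z * V <= 2 * weight s eta z.
  by rewrite mulrC ler_wpM2r// (le_trans (ler_norm _)).
have -> : weight s eta z * (s * (- c0 + K * (1 - S / u) + K * (S / s))) =
  - (s * c0) * weight s eta z + s * K * (weight s eta z * (1 - S / u)) + K * (weight s eta z * S).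
  by field; rewrite !gt_eqF.
have t1 : - (s * c0) * weight s eta z <= - (s * c0 / 2) * (weight s eta z * V).
  have := ler_wpM2l (ltW (mulr_gt0 s0 c00)) BV.
  by move: (s * c0) (weight s eta z * V) (weight s eta z) => a1 a2 a3; exact: half_neg.
have t2 : s * K * (weight s eta z * (1 - S / u)) <= 3 * K * weight s eta 0.
  apply: (@le_trans _ _ (s * K * weight s eta 0)).
    by rewrite ler_wpM2l// mulr_ge0// ltW.
  rewrite ler_wpM2r ?weight_ge0// ler_wpM2r// (le_trans s1)// ler1n//.
have t3 : K * (weight s eta z * S) <= 3 * K * S.
  have -> : 3 * K * S = K * (3 * S) by ring.
  exact: ler_wpM2l.
by rewrite [3 * K * (_ + _)]mulrDr addrA; apply: lerD => //; exact: lerD.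
Qed.

End weight_generator.

Section bounded_measurable.
Variables (R : realType) (P : probability (wiener_space R) R).
Local Notation Om := (wiener_space R).

Definition bounded_measurable (X : Om -> R) :=
  measurable_fun setT X /\ exists c, forall w, `|X w| <= c.

Lemma bounded_measurable_integrable X : bounded_measurable X -> integrable1 P X.
Proof. by move=> [mX [c hc]]; exact: integrable1_bounded hc. Qed.

Lemma bounded_measurableD X Y : bounded_measurable X -> bounded_measurable Y ->
  bounded_measurable (fun w => X w + Y w).
Proof.
move=> [mX [c hc]] [mY [d hd]]; split; first exact: measurable_funD.
by exists (c + d) => w; apply: le_trans (ler_normD _ _) _; exact: lerD.
Qed.

Lemma bounded_measurableM X Y : bounded_measurable X -> bounded_measurable Y ->
  bounded_measurable (fun w => X w * Y w).
Proof.
move=> [mX [c hc]] [mY [d hd]]; split; first exact: measurable_funM.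
by exists (c * d) => w; rewrite normrM; exact: ler_pM.
Qed.

Lemma bounded_measurable_cst c : bounded_measurable (fun=> c).
Proof. by split => //; exists `|c|. Qed.

Lemma bounded_measurable_comp (g : R -> R) (X : Om -> R) c : measurable_fun setT g ->
  (forall x, `|g x| <= c) -> measurable_fun setT X -> bounded_measurable (fun w => g (X w)).
Proof. by move=> mg hg mX; split; [exact: measurableT_comp|exists c]. Qed.

Lemma integrable1_weight s eta (Z : Om -> R) : measurable_fun setT Z -> 0 < eta ->
  integrable1 P (fun w => weight s eta (Z w)).
Proof.
move=> mZ eta0; have T0 : 0 < 2 * pi :> R by rewrite mulr_gt0// pi_gt0.
have cw := derivative_continuous (derivative_weight eta0 s).
have [M hM] := periodic_bounded T0 cw (periodic_weight eta s).
apply: bounded_measurable_integrable; apply: (bounded_measurable_comp (c := M)) => //.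
exact: continuous_measurable_fun.
Qed.

End bounded_measurable.

(** * Moments of the two-point motion *)

Section flow_moments.
Variables (R : realType) (P : probability (wiener_space R) R).
Hypothesis hP : wiener_measure P.
Local Notation Om := (wiener_space R).
Variables (rho : R) (f f1 f2 : R -> R).
Hypotheses (df : derivative f f1) (df1 : derivative f1 f2).
Hypotheses (sf : forall n, smooth n f) (pf : periodic (2 * pi) f).
Let b := drift rho f f1.
Variables (C K : R) (Phi : R -> R -> Om -> R).
Hypotheses (C1 : 1 <= C) (K0 : 0 <= K).
Hypotheses (fC : forall x, `|f x| <= C) (bC : forall x, `|b x| <= C).
Hypotheses (dPhi : forall x, diffusion_step P f b K (Phi x)).
Hypotheses (Phi0 : forall x w, Phi x 0 w = x).

Let T0 : 0 < 2 * pi :> R.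
Proof. by rewrite mulr_gt0// pi_gt0. Qed.

Let mf : measurable_fun setT f.
Proof. by apply: continuous_measurable_fun; exact: derivative_continuous df. Qed.

Let mb : measurable_fun setT b.
Proof.
apply: continuous_measurable_fun; apply: smooth_continuous.
exact: (@smooth_drift _ rho _ _ df sf 1).
Qed.

Let mPhi x u : 0 <= u -> measurable_fun setT (Phi x u).
Proof. by move=> u0; have [m _ _] := dPhi x; exact: m. Qed.

Section dynkin_formula.
Variables (B B1 B2 V V1 V2 : R -> R) (M : R).
Hypotheses (M0 : 0 < M) (tB : taylor_bounded M B B1 B2) (tV : taylor_bounded M V V1 V2).
Hypotheses (mB : measurable_fun setT B) (mB1 : measurable_fun setT B1)
  (mB2 : measurable_fun setT B2) (mV : measurable_fun setT V)
  (mV1 : measurable_fun setT V1) (mV2 : measurable_fun setT V2).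
Variables x y : R.
Let X := Phi x.
Let Y := Phi y.

Let mZ u : 0 <= u -> measurable_fun setT (fun w => Y u w - X u w).
Proof. by move=> u0; apply: measurable_funB; exact: mPhi. Qed.

Let compB (g : R -> R) u : 0 <= u -> measurable_fun setT g -> (forall x, `|g x| <= M) ->
  bounded_measurable (fun w => g (Y u w - X u w)).
Proof. by move=> u0 mg hg; apply: bounded_measurable_comp hg _ => //; exact: mZ. Qed.

Let compX (g : R -> R) z u c : 0 <= u -> measurable_fun setT g -> (forall x, `|g x| <= c) ->
  bounded_measurable (fun w => g (Phi z u w)).
Proof. by move=> u0 mg hg; apply: bounded_measurable_comp hg _ => //; exact: mPhi. Qed.

Lemma bounded_measurable_test u : 0 <= u ->
  bounded_measurable (fun w => B (Y u w - X u w) * V (X u w)).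
Proof.
move=> u0; apply: bounded_measurableM.
  by apply: compB => // z; have [[]] := tB z 0.
by apply: (compX x u0 mV (c := M)) => z; have [[]] := tV z 0.
Qed.

Lemma bounded_measurable_generator u : 0 <= u ->
  bounded_measurable (fun w => generator f b B B1 B2 V V1 V2 (X u w) (Y u w)).
Proof.
move=> u0.
have hB : bounded_measurable (fun w => B (Y u w - X u w)).
  by apply: compB => // z; have [[]] := tB z 0.
have hB1 : bounded_measurable (fun w => B1 (Y u w - X u w)).
  by apply: compB => // z; have [[]] := tB z 0.
have hB2 : bounded_measurable (fun w => B2 (Y u w - X u w)).
  by apply: compB => // z; have [[]] := tB z 0.
have hV : bounded_measurable (fun w => V (X u w)).
  by apply: (compX x u0 mV (c := M)) => z; have [[]] := tV z 0.
have hV1 : bounded_measurable (fun w => V1 (X u w)).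
  by apply: (compX x u0 mV1 (c := M)) => z; have [[]] := tV z 0.
have hV2 : bounded_measurable (fun w => V2 (X u w)).
  by apply: (compX x u0 mV2 (c := M)) => z; have [[]] := tV z 0.
have hfX := compX x u0 mf fC; have hfY := compX y u0 mf fC.
have hbX := compX x u0 mb bC; have hbY := compX y u0 mb bC.
have sub U1 U2 : bounded_measurable U1 -> bounded_measurable U2 ->
    bounded_measurable (fun w => U1 w - U2 w :> R).
  move=> k1 k2; under eq_fun do rewrite -mulN1r.
  by apply: bounded_measurableD => //; apply: bounded_measurableM => //; exact: bounded_measurable_cst.
have hf := sub _ _ hfY hfX; have hb := sub _ _ hbY hbX.
have h2 := bounded_measurable_cst (2^-1 : R).
have sqr U : bounded_measurable U -> bounded_measurable (fun w => U w ^+ 2 : R).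
  by move=> k; under eq_fun do rewrite expr2; exact: bounded_measurableM.
rewrite /generator.
have mul3 U1 U2 U3 : bounded_measurable U1 -> bounded_measurable U2 ->
    bounded_measurable U3 -> bounded_measurable (fun w => U1 w * U2 w * U3 w : R).
  by move=> k1 k2 k3; apply: bounded_measurableM => //; exact: bounded_measurableM.
apply: bounded_measurableD.
  apply: bounded_measurableD.
    apply: bounded_measurableD.
      by apply: bounded_measurableD; exact: mul3.
    by apply: bounded_measurableM => //; apply: mul3 => //; exact: sqr.
  by apply: bounded_measurableM => //; apply: mul3 => //; exact: sqr.
by apply: bounded_measurableM => //; exact: mul3.
Qed.

Lemma dynkin_gronwall al th T : 0 <= T -> 0 <= th -> (forall z, 0 <= B z) -> 0 <= V x ->
  (forall u, 0 <= u -> u <= T ->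
    generator_mean P f b B B1 B2 V V1 V2 X Y u <= al * test_mean P B V X Y u + th) ->
  test_mean P B V X Y T <=
    expR (al * T) * (B (y - x) * V x) + expR (`|al| * T) * T * th.
Proof.
move=> T_ge0 th0 B0 V0 gH.
have e0 : test_mean P B V X Y 0 = B (y - x) * V x.
  rewrite /test_mean -[RHS](mean_cst P); congr mean; apply/funext => w.
  by rewrite /X /Y !Phi0.
have D s t (s0 : 0 <= s) (st : s < t) (st1 : t - s <= 1) :=
  dynkin_step hP C1 M0 fC bC mf mb mB mB1 mB2 mV mV1 mV2 tB tV (dPhi x) (dPhi y) s0 st st1.
have C0 : 0 <= C by exact: le_trans C1.
have Kc0 : 0 <= 3 * M ^+ 2 * K + 1000 * M ^+ 2 * C ^+ 3 * (1 + 48 * expR 2^-1 + 2 * K).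
  apply: addr_ge0; first by apply: mulr_ge0 => //; apply: mulr_ge0; rewrite ?sqr_ge0.
  apply: mulr_ge0; first apply: mulr_ge0; last first.
  - apply: addr_ge0; last exact: mulr_ge0.
    by apply: addr_ge0 => //; apply: mulr_ge0 => //; exact: expR_ge0.
  - exact: exprn_ge0.
  - by apply: mulr_ge0; [exact: ler0n|exact: sqr_ge0].
move: Kc0 D; set Kc := _ + _ * (1 + _ + _); move: Kc => Kc Kc0 D.
have e00 : 0 <= test_mean P B V X Y 0 by rewrite e0 mulr_ge0.
by have := gronwall T_ge0 th0 Kc0 e00 gH D; rewrite e0.
Qed.

End dynkin_formula.

Let mcont (g : R -> R) : continuous g -> measurable_fun setT g.
Proof. exact: continuous_measurable_fun. Qed.

Let weight_taylor (s eta : R) : 0 < eta -> exists2 M, 0 < M &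
  taylor_bounded M (weight s eta) (weight1 s eta) (weight2 s eta).
Proof.
move=> eta0; apply: (smooth_taylor_bounded T0 (periodic_weight eta s)).
- exact: derivative_weight.
- exact: derivative_weight1.
- exact: smooth_weight.
Qed.

Let weight_measurable (s eta : R) : 0 < eta -> [/\ measurable_fun (setT : set R) (weight s eta),
  measurable_fun (setT : set R) (weight1 s eta) & measurable_fun (setT : set R) (weight2 s eta)].
Proof.
move=> eta0; have d1 := derivative_weight eta0 s; have d2 := derivative_weight1 eta0 s.
split; apply: mcont.
- exact: derivative_continuous d1.
- exact: derivative_continuous d2.
- exact: smooth_derivative d2 (smooth_derivative d1 (smooth_weight eta0 s 2)).
Qed.

Lemma exists_weight_mean_bound : exists2 c, 0 <= c & forall s eta x y T,
  `|s| <= 1 -> 0 < eta -> 0 <= T ->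
  mean P (fun w => weight s eta (Phi y T w - Phi x T w)) <= expR (c * T) * weight s eta (y - x).
Proof.
have [c c0 H] := exists_weight_generator_bound rho df df1 sf pf.
exists c => // s eta x y T s1 eta0 T_ge0.
have [M M0 tB] := weight_taylor s eta0; have [mB mB1 mB2] := weight_measurable s eta0.
have tV : taylor_bounded (M + 1) (fun=> 1) (fun=> 0) (fun=> 0).
  move=> z d; rewrite normr1 normr0 !(subrr, mul0r, normr0).
  have M10 : 0 <= M + 1 by rewrite addr_ge0// ltW.
  by do 2?split; rewrite ?lerDr ?(ltW M0) ?mulr_ge0 ?exprn_ge0.
have {}tB : taylor_bounded (M + 1) (weight s eta) (weight1 s eta) (weight2 s eta).
  by apply: taylor_bounded_le tB; rewrite lerDl.
have M10 : 0 < M + 1 by rewrite addr_gt0.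
have mc (a : R) : measurable_fun [set: R] (fun=> a : R) by exact: measurable_cst.
have := dynkin_gronwall (x := x) (y := y) (al := c) (th := 0) M10 tB tV mB mB1 mB2 (mc 1) (mc 0) (mc 0) T_ge0.
rewrite lexx mulr0 addr0 mulr1 /test_mean.
under [X in _ -> _ -> _ -> _ -> mean P X <= _]eq_fun do rewrite mulr1.
apply => //; first by move=> z; exact: weight_ge0.
move=> u u0 _; rewrite addr0 /test_mean.
have i1 := bounded_measurable_test tB tV mB (mc 1) x y u0.
have i2 := bounded_measurable_generator tB tV mB mB1 mB2 (mc 1) (mc 0) (mc 0) x y u0.
rewrite -meanZ; last exact: bounded_measurable_integrable.
apply: le_mean; [exact: bounded_measurable_integrable| |].
  by apply: integrable1Z; exact: bounded_measurable_integrable.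
by move=> w; rewrite mulr1; exact: H.
Qed.

Variables (g g1 g2 : R -> R) (c0 : R).
Hypotheses (dg : derivative g g1) (dg1 : derivative g1 g2) (sg : smooth 3 g).
Hypotheses (pg : periodic (2 * pi) g) (c00 : 0 < c0).
Hypothesis hL : forall x,
  f x * f2 x / 2 + rho * g1 x + f x * (f1 x * g1 x + f x * g2 x) / 2 <= - c0.

(** The factor 3 is the ratio of the bounds [3/2] and [1/2] of [V], used at time 0 and at time [T].
    The error [hav] of the generator estimate is controlled up to time [T] by the growth bound with
    [s = 1], so [K'] depends on [T], but not on [eta]. *)
Lemma exists_weight_mean_decay : exists s al, [/\ 0 < s, s <= 2^-1, 0 < al &
  forall T, 0 <= T -> exists2 K', 0 <= K' & forall eta x y, 0 < eta -> eta <= 1 ->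
  mean P (fun w => weight s eta (Phi y T w - Phi x T w)) <=
    3 * expR (- al * T) * weight s eta (y - x) + K' * (weight s eta 0 + (eta + hav (y - x)))].
Proof.
have [s [al [K1 [[s0 s12 al0 K10] [Vb H]]]]] := exists_weight_generator_decay df df1 sf pf dg dg1 pg c00 hL.
have s1 : `|s| <= 1.
  by rewrite gtr0_norm// (le_trans s12)// invf_le1// ler1n.
have [c c_ge0 Hc] := exists_weight_mean_bound.
exists s, al; split => // T T_ge0.
exists (2 * (expR (`|- al| * T) * T * (K1 * expR (c * T)))).
  by rewrite !mulr_ge0// expR_ge0.
move=> eta x y eta0 eta1.
pose V x := 1 + 2 * s * g x; pose V1 x := 2 * s * g1 x; pose V2 x := 2 * s * g2 x.
have dV : derivative V V1.
  apply: derivative_eq (derivativeD (derivative_cst 1) (derivativeZ (2 * s) dg)) _ => z.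
  by rewrite add0r.
have dV1 : derivative V1 V2 by exact: derivativeZ.
have pV : periodic (2 * pi) V by move=> z; rewrite /V pg.
have sV : smooth 3 V by apply: smoothD (smooth_cst _ _) (smoothM (smooth_cst _ _) sg).
have mV : measurable_fun setT V by apply: mcont; exact: derivative_continuous dV.
have mV1 : measurable_fun setT V1 by apply: mcont; exact: derivative_continuous dV1.
have mV2 : measurable_fun setT V2.
  apply: mcont; apply: smooth_continuous.
  exact: smooth_derivative dV1 (smooth_derivative dV sV).
have [Mb Mb0 tB'] := weight_taylor s eta0; have [mB mB1 mB2] := weight_measurable s eta0.
have [Mv Mv0 tV'] := smooth_taylor_bounded T0 pV dV dV1 sV.
have M0 : 0 < Mb + Mv by rewrite addr_gt0.
have tB : taylor_bounded (Mb + Mv) (weight s eta) (weight1 s eta) (weight2 s eta).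
  by apply: taylor_bounded_le tB'; rewrite lerDl ltW.
have tV : taylor_bounded (Mb + Mv) V V1 V2.
  by apply: taylor_bounded_le tV'; rewrite lerDr ltW.
have V0 z : 0 <= V z by have /andP[h _] := Vb z; apply: le_trans h; rewrite invr_ge0.
pose th := K1 * (weight s eta 0 + expR (c * T) * (eta + hav (y - x))).
have W0 z : 0 <= weight s eta z := weight_ge0 s eta z.
have eh : 0 <= eta + hav (y - x) by rewrite ltW// addr_hav_gt0.
have th0 : 0 <= th.
  by apply: mulr_ge0 => //; apply: addr_ge0 => //; rewrite mulr_ge0// expR_ge0.
have D := dynkin_gronwall (x := x) (y := y) (al := - al) (th := th) M0 tB tV mB mB1 mB2
  mV mV1 mV2 T_ge0 th0 W0 (V0 x).
have {}D : test_mean P (weight s eta) V (Phi x) (Phi y) T <=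
    expR (- al * T) * (weight s eta (y - x) * V x) + expR (`|- al| * T) * T * th.
  apply: D => u u0 uT.
  have i1 := bounded_measurable_integrable P (bounded_measurable_test tB tV mB mV x y u0).
  have i2 := bounded_measurable_integrable P
    (bounded_measurable_generator tB tV mB mB1 mB2 mV mV1 mV2 x y u0).
  have i3 := integrable1_weight P s (measurable_funB (mPhi y u0) (mPhi x u0)) eta0.
  have i4 := integrable1_weight P 1 (measurable_funB (mPhi y u0) (mPhi x u0)) eta0.
  have i0 := integrable1_cst P (weight s eta 0).
  have i5 := integrable1Z K1 (integrable1D i0 i4).
  apply: (@le_trans _ _ (mean P (fun w => - al * (weight s eta (Phi y u w - Phi x u w) * V (Phi x u w)) +
      K1 * (weight s eta 0 + weight 1 eta (Phi y u w - Phi x u w))))).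
    apply: le_mean => //; first exact: integrable1D (integrable1Z _ i1) i5.
    move=> w; apply: le_trans (H _ _ _ eta0 eta1) _.
    by rewrite lerD2l ler_wpM2l// lerD2l weight1r// lerDr ltW.
  rewrite (meanD (integrable1Z _ i1) i5) (meanZ _ i1) (meanZ _ (integrable1D i0 i4)) (meanD i0 i4) mean_cst.
  rewrite lerD2l /th ler_wpM2l// lerD2l.
  have n1 : `|1 : R| <= 1 by rewrite normr1.
  apply: le_trans (Hc 1 eta x y u n1 eta0 u0) _.
  by rewrite weight1r// ler_wpM2r// ler_expR ler_wpM2l.
have i1 := bounded_measurable_integrable P (bounded_measurable_test tB tV mB mV x y T_ge0).
have i3 := integrable1_weight P s (measurable_funB (mPhi y T_ge0) (mPhi x T_ge0)) eta0.
apply: (@le_trans _ _ (2 * test_mean P (weight s eta) V (Phi x) (Phi y) T)).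
  rewrite /test_mean -(meanZ _ i1); apply: le_mean => //; first exact: integrable1Z.
  move=> w; rewrite mulrCA ler_peMr//.
  by have /andP[h _] := Vb (Phi x T w); rewrite -(ler_pM2l (_ : 0 < 2^-1)) ?invr_gt0// mulrA mulVf// mul1r mulr1.
apply: le_trans (ler_wpM2l _ D) _ => //; rewrite mulrDr; apply: lerD.
  have /andP[_ h] := Vb x.
  have -> : 3 * expR (- al * T) * weight s eta (y - x) =
    2 * (expR (- al * T) * (weight s eta (y - x) * (3 / 2))) by field.
  by rewrite ler_pM2l// ler_wpM2l ?expR_ge0// ler_wpM2l.
rewrite -!mulrA ler_pM2l// ler_wpM2l ?expR_ge0// ler_wpM2l// ler_wpM2l//.
rewrite [leRHS]mulrDr lerD2r ler_peMl// -[leLHS]expR0 ler_expR; exact: mulr_ge0.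
Qed.

End flow_moments.

(** * The linearized flow *)

Section limits.
Variable R : realType.

Lemma difference_quotient_cvg (h : R -> R) (x d : R) (u : nat -> R) : is_derive x 1 h d ->
  (forall n, u n != 0) -> u @ \oo --> (0 : R) ->
  (fun n => (h (x + u n) - h x) / u n) @ \oo --> d.
Proof.
move=> [dh <-] u0 cu.
have : (fun t : R => t^-1 *: ((h \o shift x) (t *: 1) - h x)) t @[t --> 0^'] --> 'D_1 h x.
  exact: dh.
move/cvgr_dnbhsP => /(_ u (conj u0 cu)); apply: cvg_trans.
have -> // : (fun n => (h (x + u n) - h x) / u n) =
  (fun n => (u n)^-1 *: ((h \o shift x) (u n *: 1) - h x)).
by apply/funext => n; rewrite /= [_%:A]mulr1 [u n + x]addrC [RHS]mulrC.
Qed.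

Lemma hav_quotient_cvg (u z : nat -> R) (d : R) : (forall n, 0 < u n) ->
  u @ \oo --> (0 : R) -> (fun n => z n / u n) @ \oo --> d ->
  (fun n => hav (z n) / u n ^+ 2) @ \oo --> d ^+ 2 / 4.
Proof.
move=> u0 cu ch.
pose h n := z n / u n; pose r n := hav (z n) / u n ^+ 2 - h n ^+ 2 / 4.
have rb n : `|r n| <= `|h n| ^+ 3 * u n.
  have -> : r n = (hav (z n) - z n ^+ 2 / 4) / u n ^+ 2.
    by rewrite /r /h; field; rewrite gt_eqF.
  rewrite normrM [X in _ * X]gtr0_norm ?invr_gt0 ?exprn_gt0// ler_pdivrMr ?exprn_gt0//.
  apply: le_trans (hav_taylor _) _.
  rewrite /h normrM [X in (_ * X) ^+ 3]gtr0_norm ?invr_gt0//.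
  by rewrite le_eqVlt; apply/orP; left; apply/eqP; field; rewrite gt_eqF.
have h2 : h n ^+ 2 @[n --> \oo] --> d ^+ 2.
  by rewrite expr2; under eq_fun do rewrite expr2; exact: cvgM.
have c3 : `|h n| ^+ 3 * u n @[n --> \oo] --> (0 : R).
  rewrite -(mulr0 (`|d| ^+ 3)); apply: cvgM cu.
  have nh : `|h n| @[n --> \oo] --> `|d| by exact: cvg_norm.
  rewrite !exprS expr0; under eq_fun do rewrite !exprS expr0.
  by apply: cvgM => //; apply: cvgM => //; apply: cvgM => //; exact: cvg_cst.
have r0 : r @ \oo --> (0 : R).
  apply: (squeeze_cvgr (f := fun n => - (`|h n| ^+ 3 * u n)) _ _ c3).
    by apply: nearW => n; rewrite -ler_norml.
  by rewrite -oppr0; exact: cvgN.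
have -> : (fun n => hav (z n) / u n ^+ 2) = (fun n => h n ^+ 2 / 4 + r n).
  by apply/funext => n; rewrite /r; ring.
by rewrite -[X in _ --> X]addr0; apply: cvgD r0; apply: cvgM h2 _; exact: cvg_cst.
Qed.

End limits.

Section sequences.
Variable R : realType.

Definition shrinking (e0 : R) (n : nat) : R := e0 * harmonic n.

Lemma shrinking_gt0 e0 n : 0 < e0 -> 0 < shrinking e0 n.
Proof. by move=> h; rewrite mulr_gt0// harmonic_gt0. Qed.

Lemma shrinking_le e0 n : 0 < e0 -> shrinking e0 n <= e0.
Proof.
by move=> h; rewrite /shrinking /= ger_pMr// invf_le1// ler1n.
Qed.

Lemma shrinking_cvg0 e0 : shrinking e0 @ \oo --> (0 : R).
Proof. by rewrite -(mulr0 e0); apply: cvgM; [exact: cvg_cst|exact: cvg_harmonic]. Qed.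

Lemma hav_ge_small (u : R) : 0 < u -> u <= 8^-1 -> u ^+ 2 / 8 <= hav u.
Proof.
move=> u0 u8; have := hav_taylor u; rewrite [`|u|]gtr0_norm// ler_norml => /andP[t _].
have : u ^+ 3 <= u ^+ 2 / 8 by rewrite exprSr ler_wpM2l// sqr_ge0.
by move: t; move: (u ^+ 3) => a; lra.
Qed.

End sequences.

(** * From two nearby points to the derivative *)

Section small_distance.
Variables (R : realType) (P : probability (wiener_space R) R).
Local Notation Om := (wiener_space R).
Variables (Psi : R -> Om -> R) (x : R) (D : Om -> R).
Hypothesis mPsi : forall y, measurable_fun setT (Psi y).
Hypothesis dD : forall w, is_derive x 1 (Psi ^~ w) (D w).

Let Z (u : R) w := Psi (x + u) w - Psi x w.

Let mZ u : measurable_fun setT (Z u).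
Proof. by apply: measurable_funB; exact: mPsi. Qed.

Lemma measurable_space_derivative : measurable_fun setT D.
Proof.
apply: (@measurable_fun_cvg _ _ _ _ (fun n w => Z (shrinking 1 n) w / shrinking 1 n)).
  by move=> n; apply: measurable_funM => //; exact: mZ.
move=> w _; apply: (difference_quotient_cvg (dD w)).
  by move=> n; rewrite gt_eqF// shrinking_gt0.
exact: shrinking_cvg0.
Qed.

Let measurable_zero : measurable [set w | D w = 0].
Proof.
rewrite -[X in measurable X]setTI.
exact: (measurable_space_derivative measurableT (measurable_set1 (0 : R))).
Qed.

Let quotient_cvg e0 w : 0 < e0 ->
  (fun n => hav (Z (shrinking e0 n) w) / shrinking e0 n ^+ 2) @ \oo --> D w ^+ 2 / 4.
Proof.
move=> e00; apply: hav_quotient_cvg.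
- by move=> n; exact: shrinking_gt0.
- exact: shrinking_cvg0.
- apply: (difference_quotient_cvg (dD w)); last exact: shrinking_cvg0.
  by move=> n; rewrite gt_eqF// shrinking_gt0.
Qed.

(* The case [D w = 0] must be excluded since [ln 0 = 0]. *)
Lemma derivative_neq0 A : 0 <= A ->
  (forall eta y, 0 < eta ->
    mean P (fun w => weight (-1) eta (Psi y w - Psi x w)) <= A * weight (-1) eta (y - x)) ->
  P.-negligible [set w | D w = 0].
Proof.
move=> A0 H; have [i1 PE] := mean_indic P measurable_zero.
exists [set w | D w = 0]; split=> //; rewrite -PE.
suff : mean P (\1_[set w | D w = 0] : Om -> R) <= 0.
  have : 0 <= mean P (\1_[set w | D w = 0] : Om -> R).
    by apply: mean_ge0 => w; rewrite indicE.
  by move=> h1 h2; congr (_%:E); apply/eqP; rewrite eq_le h1 h2.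
apply: (@le0_linear_eq _ _ _ (8 * A)) => del del0; rewrite add0r.
pose u := @shrinking R 8^-1.
have e80 : 0 < 8^-1 :> R by [].
have u0 n : 0 < u n by exact: shrinking_gt0.
have un0 n : u n != 0 by rewrite gt_eqF.
have u20 n : 0 < u n ^+ 2 by rewrite exprn_gt0.
have du0 n : 0 < del * u n ^+ 2 by rewrite mulr_gt0.
(* With [eta = del * u^2] the scaled weight tends to [(del + D^2 / 4)^-1]. Its mean stays below
   [8 * A], the 8 coming from [hav_ge_small], whereas it equals [1 / del] on the event [D = 0],
   whose probability is thus at most [8 * A * del]. *)
pose F n w := u n ^+ 2 * weight (-1) (del * u n ^+ 2) (Z (u n) w).
have FE n w : F n w = (del + hav (Z (u n) w) / u n ^+ 2)^-1.
  rewrite /F weightN1//.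
  have h := addr_hav_gt0 (du0 n) (Z (u n) w).
  have -> : del + hav (Z (u n) w) / u n ^+ 2 = (del * u n ^+ 2 + hav (Z (u n) w)) / u n ^+ 2.
    by field; rewrite un0.
  by rewrite invf_div.
have iw n := integrable1_weight P (-1) (mZ (u n)) (du0 n).
have iF n : integrable1 P (F n) by exact: integrable1Z.
have [iG mG] : integrable1 P (fun w => (del + D w ^+ 2 / 4)^-1) /\
    mean P (fun w => (del + D w ^+ 2 / 4)^-1) <= 8 * A.
  apply: (mean_fatou (F := F)) => //.
  - by move=> n; exact: integrable1_measurable (iF n).
  - by move=> n w; rewrite mulr_ge0 ?(ltW (u20 n))// weight_ge0.
  - move=> n; rewrite /F (meanZ _ (iw n)).
    apply: (@le_trans _ _ (u n ^+ 2 * (A * weight (-1) (del * u n ^+ 2) (u n)))).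
      have := H _ (x + u n) (du0 n); rewrite [x + u n - x]addrAC subrr add0r.
      by rewrite ler_pM2l.
    rewrite weightN1// mulrCA [8 * A]mulrC ler_wpM2l// ler_pdivrMr ?addr_hav_gt0//.
    have := hav_ge_small (u0 n) (shrinking_le n e80); have := du0 n.
    by move: (u n ^+ 2) (del * _) => a b; lra.
  - move=> w; under eq_fun do rewrite FE.
    have c1 : (fun n => del + hav (Z (u n) w) / u n ^+ 2) @ \oo --> del + D w ^+ 2 / 4.
      have q := @quotient_cvg _ w e80.
      apply: (@cvgD _ R^o _ _ _ (fun=> del)); first exact: cvg_cst.
      exact: q.
    by apply: cvgV c1; rewrite gt_eqF// ltr_wpDr// mulr_ge0 ?sqr_ge0.
rewrite mulrC; apply: (@le_trans _ _ (mean P (fun w => del * (del + D w ^+ 2 / 4)^-1))).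
  apply: le_mean => //; first exact: integrable1Z.
  move=> w; rewrite indicE; have [|_] := boolP (w \in _).
    by rewrite inE => /= ->; rewrite expr0n/= mul0r addr0 divff// gt_eqF.
  by rewrite mulr_ge0 ?(ltW del0)// invr_ge0 addr_ge0 ?(ltW del0)// mulr_ge0// sqr_ge0.
by rewrite (meanZ _ iG) ler_pM2l.
Qed.

Lemma exists_small_error (s A K : R) : 0 < s -> 0 < A -> 0 <= K -> exists2 e0 : R, 0 < e0 <= 8^-1 &
  forall u, 0 < u -> u <= e0 -> K * (expR (s * ln u) + 2 * u) <= A.
Proof.
move=> s0 A0 K0.
pose t := A / (3 * (K + 1)).
have K10 : 0 < K + 1 by rewrite ltr_wpDl.
have t0 : 0 < t by rewrite divr_gt0// mulr_gt0.
exists (Num.min 8^-1 (Num.min t (expR (ln t / s)))).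
  by rewrite ge_min lexx/= andbT !lt_min t0 expR_gt0 invr_gt0 ltr0n.
move=> u u0; rewrite !le_min => /and3P[_ ut us].
have e1 : expR (s * ln u) <= t.
  rewrite -[leRHS]lnK ?posrE// ler_expR mulrC -ler_pdivlMr// -ler_expR lnK ?posrE//.
apply: (@le_trans _ _ (K * (3 * t))).
  by rewrite ler_wpM2l//; move: e1; move: (expR _) => a; lra.
have -> : K * (3 * t) = A * (K / (K + 1)) by rewrite /t; field; rewrite gt_eqF.
by rewrite ler_piMr ?(ltW A0)// ler_pdivrMr// mul1r lerDl.
Qed.

(** The choice [eta = u^3] is negligible against [u^2], the order of [hav (Z u)], so the weight
    divided by [u^(2 s)] tends to [(D^2 / 4)^s]. The indicator removes the points with [D w = 0],
    where the convention [ln 0 = 0] would give 1 instead of 0. *)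
Lemma derivative_moment s A K : 0 < s -> s <= 2^-1 -> 0 < A -> 0 <= K ->
  (forall eta y, 0 < eta -> eta <= 1 ->
    mean P (fun w => weight s eta (Psi y w - Psi x w)) <=
      A * weight s eta (y - x) + K * (weight s eta 0 + (eta + hav (y - x)))) ->
  let G w := \1_[set w | D w != 0] w * expR (s * ln (D w ^+ 2 / 4)) in
  integrable1 P G /\ mean P G <= 3 * A.
Proof.
move=> s0 s12 A0 K0 H G.
have [e0 /andP[e00 e08] err] := exists_small_error s0 A0 K0.
pose u := shrinking e0.
have u0 n : 0 < u n by exact: shrinking_gt0.
have ue n : u n <= e0 by exact: shrinking_le.
have u8 n : u n <= 8^-1 by exact: le_trans (ue n) e08.
have u1 n : u n <= 1 by rewrite (le_trans (u8 n))// invf_le1// ler1n.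
have un0 n : u n != 0 by rewrite gt_eqF.
have u20 n : 0 < u n ^+ 2 by rewrite exprn_gt0.
have u30 n : 0 < u n ^+ 3 by rewrite exprn_gt0.
pose k n := expR (- (s * ln (u n ^+ 2))).
have k0 n : 0 <= k n := expR_ge0 _.
have kE n z : expR (s * ln (u n + hav z / u n ^+ 2)) = k n * weight s (u n ^+ 3) z.
  have -> : u n + hav z / u n ^+ 2 = (u n ^+ 3 + hav z) / u n ^+ 2 by field; rewrite un0.
  rewrite ln_div ?posrE ?addr_hav_gt0// -expRD; congr expR; ring.
pose I w : R := \1_[set w | D w != 0] w.
have mI : measurable_fun setT I.
  apply: measurable_indic; have -> : [set w | D w != 0] = ~` [set w | D w = 0].
    by apply/seteqP; split => w /= /eqP.
  exact: measurableC.
have I01 w : 0 <= I w <= 1 by rewrite /I indicE; case: (_ \in _); rewrite ?lexx ?ler01.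
pose F n w := I w * (k n * weight s (u n ^+ 3) (Z (u n) w)).
have iw n := integrable1_weight P s (mZ (u n)) (u30 n).
have ikw n := integrable1Z (k n) (iw n).
have kw0 n w : 0 <= k n * weight s (u n ^+ 3) (Z (u n) w) by rewrite mulr_ge0// weight_ge0.
have F0 n w : 0 <= F n w by rewrite mulr_ge0//; case/andP: (I01 w).
have Fle n w : F n w <= k n * weight s (u n ^+ 3) (Z (u n) w).
  by rewrite ler_piMl//; case/andP: (I01 w).
have mF n : measurable_fun setT (F n).
  by apply: measurable_funM => //; exact: integrable1_measurable (ikw n).
have iF n : integrable1 P (F n).
  by apply: integrable1_le (ikw n) => // w; rewrite ger0_norm.
apply: (mean_fatou (F := F)) => //.
- move=> n; apply: le_trans (le_mean (iF n) (ikw n) (Fle n)) _; rewrite (meanZ _ (iw n)).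
  have := H _ (x + u n) (u30 n) (exprn_ile1 3 (ltW (u0 n)) (u1 n)).
  rewrite [x + u n - x]addrAC subrr add0r => /(ler_wpM2l (k0 n))/le_trans; apply.
  have hu : hav (u n) <= u n ^+ 2 := hav_le_sqr (u n).
  have t1 : k n * weight s (u n ^+ 3) (u n) <= 2.
    rewrite -kE; have v0 : 0 < u n + hav (u n) / u n ^+ 2.
      by rewrite ltr_wpDr// mulr_ge0 ?hav_ge0// invr_ge0 ltW.
    have v2 : u n + hav (u n) / u n ^+ 2 <= 2.
      by rewrite (_ : 2 = 1 + 1 :> R)// lerD// ler_pdivrMr// mul1r.
    rewrite -[leRHS]lnK ?posrE// ler_expR (@le_trans _ _ (s * ln 2))//.
      by rewrite ler_pM2l// ler_ln ?posrE.
    have s1 : s <= 1 by rewrite (le_trans s12)// invf_le1// ler1n.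
    by rewrite ler_piMl// ln_ge0// ler1n.
  have t2 : k n * weight s (u n ^+ 3) 0 = expR (s * ln (u n)).
    by rewrite -kE /hav cos0 subrr !mul0r addr0.
  (* Here [s <= 2^-1] matters: [k n], that is [u^(- 2 s)], is then at most [1 / u], while
     [u^3 + hav u] is at most [2 u^2]. *)
  have t3 : k n * (u n ^+ 3 + hav (u n)) <= 2 * u n.
    have ku : k n <= (u n)^-1.
      rewrite -[leRHS]lnK ?posrE ?invr_gt0// ler_expR lnV ?posrE// lerN2 lnXn//.
      have l0 : ln (u n) <= 0 by rewrite ln_le0.
      rewrite -[ln (u n) *+ 2]mulr_natl mulrA; have : s * 2 <= 1 by move: s12; lra.
      by move=> h; rewrite ler_niMl.
    apply: (@le_trans _ _ ((u n)^-1 * (2 * u n ^+ 2))); last first.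
      by rewrite le_eqVlt; apply/orP; left; apply/eqP; field; rewrite un0.
    have h3 : u n ^+ 3 <= u n ^+ 2 by rewrite exprSr ler_piMr// ltW.
    apply: ler_pM => //; first by rewrite addr_ge0 ?hav_ge0// ltW.
    by rewrite mulr_natl mulr2n lerD.
  have e := err _ (u0 n) (ue n).
  have -> : k n * (A * weight s (u n ^+ 3) (u n) + K * (weight s (u n ^+ 3) 0 + (u n ^+ 3 + hav (u n)))) =
    A * (k n * weight s (u n ^+ 3) (u n)) +
    K * (k n * weight s (u n ^+ 3) 0 + k n * (u n ^+ 3 + hav (u n))) by ring.
  have -> : 3 * A = A * 2 + A by ring.
  apply: lerD; first by rewrite ler_pM2l.
  by apply: le_trans e; rewrite t2 ler_wpM2l// lerD2l.
- move=> w; rewrite /F /G /I indicE; have [|_] := boolP (w \in _); last first.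
    by rewrite mul0r; under eq_fun do rewrite mul0r; exact: cvg_cst.
  rewrite inE /= => Dw; rewrite mul1r; under eq_fun do rewrite mul1r -kE.
  have D2 : 0 < D w ^+ 2 / 4 by rewrite divr_gt0// exprn_even_gt0.
  have c1 : (fun n => u n + hav (Z (u n) w) / u n ^+ 2) @ \oo --> D w ^+ 2 / 4.
    by rewrite -[X in _ --> X]add0r; apply: cvgD (@quotient_cvg _ w e00); exact: shrinking_cvg0.
  have c2 : (fun n => s * ln (u n + hav (Z (u n) w) / u n ^+ 2)) @ \oo --> s * ln (D w ^+ 2 / 4).
    apply: cvgM; first exact: cvg_cst.
    by apply: continuous_cvg c1; exact: continuous_ln.
  by apply: continuous_cvg c2; exact: continuous_expR.
Qed.

End small_distance.

(** * Almost sure statements and contradiction *)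

Section almost_everywhere.

Lemma not_negligible_setT d (T : measurableType d) (R : realType) (P : probability T R) :
  ~ P.-negligible setT.
Proof.
move=> [A [mA A0 TA]]; have : P setT = 0%E.
  apply/eqP; rewrite eq_le measure_ge0 andbT -A0.
  by apply: le_measure => //; rewrite inE.
by rewrite probability_setT => /eqP; rewrite onee_eq0.
Qed.

(** A null set of the product has null sections over almost every [x], and some such [x] exists
    because [mu] has mass 1. *)
Lemma ae_section d1 (T1 : measurableType d1) d2 (T2 : measurableType d2) (R : realType)
  (P : probability T1 R) (mu : probability T2 R) (Q : T1 * T2 -> Prop) :
  {ae (P \x mu)%E, forall z, Q z} -> exists x, {ae P, forall w, Q (w, x)}.
Proof.
move=> [N [mN N0 QN]].
have : (\int[mu]_x `|P (ysection N x)| = 0)%E.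
  rewrite -N0 (product_measure_unique (m' := (P \x^ mu)%E))//.
    by apply: eq_integral => x _; rewrite gee0_abs.
  by move=> A B mA mB; exact: product_measure2E.
move/(ae_eq_integral_abs mu measurableT (measurable_fun_ysection P mN)) => [M [mM M0 MN]].
have [x Mx] : exists x, ~ M x.
  apply: contrapT => h; apply: (@not_negligible_setT _ _ _ mu).
  exists M; split => // x _; apply: contrapT => Mx; by apply: h; exists x.
exists x, (ysection N x); split; first exact: measurable_ysection.
  by apply: contrapT => h; apply: Mx; apply: MN => /= /(_ I).
by move=> w /= h; rewrite /ysection /= inE; apply: QN.
Qed.

Variables (d : measure_display) (T : measurableType d) (R : realType) (P : probability T R).

(** By Markov's inequality the event at rank [n] has probability at most
    [C / c * expR (- (al / 2) * n)]. Hence the events of rank at least [m] have a null intersection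
    for each [m], whereas these intersections cover almost all paths. *)
Lemma markov_contradiction (G : nat -> T -> R) (al c C : R) : 0 < al -> 0 < c -> 0 <= C ->
  (forall n, integrable1 P (G n)) -> (forall n w, 0 <= G n w) ->
  (forall n, mean P (G n) <= C * expR (- al * n%:R)) ->
  {ae P, forall w, \forall n \near \oo, c * expR (- (al / 2) * n%:R) <= G n w} -> False.
Proof.
move=> al0 c0 C0 iG G0 mG hG.
pose A n := [set w | c * expR (- (al / 2) * n%:R) <= G n w].
have mA n : measurable (A n).
  rewrite [X in measurable X](_ : _ = setT `&` G n @^-1` `[c * expR (- (al / 2) * n%:R), +oo[).
    by apply: (integrable1_measurable (iG n)).
  by rewrite setTI; apply/seteqP; split => w; rewrite /A /= in_itv/= andbT.
have PA n : (P (A n) <= (C / c * expR (- (al / 2) * n%:R))%:E)%E.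
  have [i1 <-] := mean_indic P (mA n); rewrite lee_fin.
  pose k := c * expR (- (al / 2) * n%:R).
  have k0 : 0 < k by rewrite mulr_gt0// expR_gt0.
  have : k * mean P (\1_(A n) : T -> R) <= C * expR (- al * n%:R).
    apply: le_trans (mG n); rewrite -(meanZ _ i1); apply: le_mean => //; first exact: integrable1Z.
    move=> w; rewrite indicE; have [|_] := boolP (w \in _); last by rewrite mulr0.
    by rewrite inE mulr1.
  rewrite mulrC -ler_pdivlMr// => /le_trans; apply.
  rewrite ler_pdivrMr// /k.
  have -> : C / c * expR (- (al / 2) * n%:R) * (c * expR (- (al / 2) * n%:R)) =
    C * (expR (- (al / 2) * n%:R) * expR (- (al / 2) * n%:R)) by field; rewrite gt_eqF.
  rewrite -expRD; have -> // : - (al / 2) * n%:R + - (al / 2) * n%:R = - al * n%:R :> R by field.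
have mB m : measurable (\bigcap_(n in [set n | (m <= n)%N]) A n) by apply: bigcap_measurable => //; exists m => /=.
have B0 m : P.-negligible (\bigcap_(n in [set n | (m <= n)%N]) A n).
  exists (\bigcap_(n in [set n | (m <= n)%N]) A n); split => //.
  apply/eqP; rewrite eq_le measure_ge0 andbT.
  apply/lee_addgt0Pr => e e0; rewrite add0e.
  (* The inequality [expR x >= x] turns the exponential bound into an explicit rank. *)
  pose n := maxn m (Num.trunc (C / c / (e * (al / 2)))).+1.
  apply: (@le_trans _ _ (P (A n))).
    apply: le_measure; rewrite ?inE//.
    by move=> w /(_ n); apply => /=; exact: leq_maxl.
  apply: le_trans (PA n) _; rewrite lee_fin.
  have a20 : 0 < al / 2 by rewrite divr_gt0.
  have h : C / c / (e * (al / 2)) <= n%:R.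
    apply: (@le_trans _ _ (Num.trunc (C / c / (e * (al / 2)))).+1%:R).
      by rewrite ltW// truncnS_gt.
    by rewrite ler_nat leq_maxr.
  rewrite mulNr expRN ler_pdivrMr ?expR_gt0//.
  move: h; rewrite ler_pdivrMr ?mulr_gt0// => /le_trans; apply.
  have -> : n%:R * (e * (al / 2)) = e * (al / 2 * n%:R) by ring.
  rewrite ler_pM2l//; apply: le_trans (expR_ge1Dx _); by rewrite lerDr.
apply: (@not_negligible_setT _ _ _ P).
apply: negligibleS (negligibleU hG (negligible_bigcup B0)) => w _.
have [[m _ hm]|h] := pselect (\forall n \near \oo, c * expR (- (al / 2) * n%:R) <= G n w).
  by right; exists m.
by left.
Qed.

End almost_everywhere.

(** * The coefficients and the flow of the equation *)

Section smooth_coefficients.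
Variables (R : realType) (f : R -> R).
Hypothesis fsmooth : forall (k : nat) (x : R), derivable (f^`(k)) x 1.

Lemma derivative_derive1n k : derivative (f^`(k)) (f^`(k.+1)).
Proof. by move=> x; apply: DeriveDef; [exact: fsmooth|rewrite derive1nS derive1E]. Qed.

Lemma smooth_derive1n n k : smooth n (f^`(k)).
Proof.
elim: n k => [|n IHn] k; first exact: derivative_continuous (derivative_derive1n k).
by exists (f^`(k.+1)); [exact: derivative_derive1n|exact: IHn].
Qed.

Variable rho : R.
Hypothesis pf : periodic (2 * pi) f.
Let f1 := f^`(1).
Let f2 := f^`(2).
Let b := drift rho f f1.

Lemma exists_coefficient_bound : exists C : R, [/\ 1 <= C,
  forall x, `|f x| <= C, forall x, `|f1 x| <= C, forall x, `|f2 x| <= C &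
  [/\ forall x, `|b x| <= C, forall x y, `|f x - f y| <= C * `|x - y| &
      forall x y, `|b x - b y| <= C * `|x - y|]].
Proof.
have T0 : 0 < 2 * pi :> R by rewrite mulr_gt0// pi_gt0.
have df : derivative f f1 := derivative_derive1n 0.
have df1 : derivative f1 f2 := derivative_derive1n 1.
have sf n : smooth n f := smooth_derive1n n 0.
have db := derivative_drift rho df df1.
have pb := periodic_drift rho df pf.
have [b2 db1 _] := smooth_derivative db (smooth_drift rho df sf 2).
have pf1 := derivative_periodic df pf; have pf2 := derivative_periodic df1 pf1.
have [M0 h0] := periodic_bounded T0 (derivative_continuous df) pf.
have [M1 h1] := periodic_bounded T0 (derivative_continuous df1) pf1.
have [M2 h2] := periodic_bounded T0 (smooth_continuous (smooth_derive1n 0 2)) pf2.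
have [M3 h3] := periodic_bounded T0 (derivative_continuous db) pb.
have [M4 h4] := periodic_bounded T0 (derivative_continuous db1) (derivative_periodic db pb).
have n0 := le_trans (normr_ge0 _) (h0 0); have n1 := le_trans (normr_ge0 _) (h1 0).
have n2 := le_trans (normr_ge0 _) (h2 0); have n3 := le_trans (normr_ge0 _) (h3 0).
have n4 := le_trans (normr_ge0 _) (h4 0).
have [C [C1 k0 k1 k2 [k3 k4]]] : exists C, [/\ 1 <= C, M0 <= C, M1 <= C, M2 <= C &
    M3 <= C /\ M4 <= C].
  by exists (1 + M0 + M1 + M2 + M3 + M4); split; [..|split]; lra.
have lip g g1 M : derivative g g1 -> (forall x, `|g1 x| <= M) -> M <= C ->
    forall x y : R, `|g x - g y| <= C * `|x - y|.
  move=> dg gM MC x y; apply: (@le_trans _ _ (M * `|x - y|)); last exact: ler_wpM2r.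
  exact: mean_value_bound dg (fun _ _ => gM _).
exists C; split=> // [x|x|x|].
- exact: le_trans (h0 x) k0.
- exact: le_trans (h1 x) k1.
- exact: le_trans (h2 x) k2.
- split=> [x||]; first exact: le_trans (h3 x) k3.
    exact: lip df h1 k1.
  exact: lip db h4 k4.
Qed.

End smooth_coefficients.

Section circle_flow.
Variables (R : realType) (P : probability (wiener_space R) R).
Hypothesis hP : wiener_measure P.
Local Notation Om := (wiener_space R).
Variables (rho : R) (f : R -> R) (phi : R -> Om -> R -> R).
Hypothesis fsmooth : forall (k : nat) (x : R), derivable (f^`(k)) x 1.
Hypothesis phi_rds : smooth_circle_rds phi.
Hypothesis phi_sde : forall x, stratonovich_solution P rho f x (fun t w => phi t w x).
Let b := drift rho f f^`(1).

Let measurable_flow x : measurable_fun setT (fun z : Om * R => phi (Num.max 0 z.2) z.1 x).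
Proof.
pose h (z : Om * R) : measurableTypeR R * Om * measurableTypeR R := (Num.max 0 z.2, z.1, x).
have mh : measurable_fun setT h.
  apply: measurable_fun_pair; last exact: measurable_cst.
  apply: measurable_fun_pair; last exact: measurable_fst.
  by apply: measurable_maxr; [exact: measurable_cst|exact: measurable_snd].
apply: (measurable_comp _ _ (rds_measurable phi_rds) mh).
  rewrite [X in measurable X](_ : _ = setT `&` (fst \o fst) @^-1` `[0, +oo[).
    by apply: (measurableT_comp measurable_fst measurable_fst) => //; exact: measurable_itv.
  by rewrite setTI; apply/seteqP; split => z; rewrite /= in_itv/= andbT.
by move=> _ [z _ <-] /=; rewrite le_max lexx.
Qed.

(** The constant adds those of [remainder_moment2] and [remainder_mean], so that a single one serves
    both estimates. *)
Lemma circle_flow_step C : 1 <= C -> (forall x, `|f x| <= C) -> (forall x, `|b x| <= C) ->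
  (forall x y, `|f x - f y| <= C * `|x - y|) -> (forall x y, `|b x - b y| <= C * `|x - y|) ->
  forall x, diffusion_step P f b (26 * C ^+ 4 + 4 * C ^+ 3) (fun t w => phi t w x).
Proof.
move=> C1 fC bC flip blip x.
have mf : measurable_fun setT f.
  by apply: continuous_measurable_fun; exact: derivative_continuous (derivative_derive1n fsmooth 0).
have mb : measurable_fun setT b.
  apply: continuous_measurable_fun; apply: smooth_continuous.
  exact: smooth_drift (derivative_derive1n fsmooth 0) (fun n => smooth_derive1n fsmooth n 0) 0.
have fX u : 0 <= u -> filtration_measurable P u (fun w => phi u w x).
  by move=> u0 _ B mB; rewrite setTI; exact: (solution_adapted (phi_sde x)).
have ito : forall t, 0 <= t -> ito_integral P (fun u w => f (phi u w x)) t
    (fun w => phi t w x - x - \int[lebesgue_measure]_(u in `[0, t]) b (phi u w x)).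
  exact: solution_ito (phi_sde x).
have C0 : 0 <= C by exact: le_trans C1.
split=> //.
  move=> u u0; have : measurable_fun setT
      ((fun z : Om * R => phi (Num.max 0 z.2) z.1 x) \o pair^~ u).
    by apply: measurableT_comp => //; exact: pair2_measurable.
  by congr (measurable_fun _ _); apply/funext => w /=; rewrite (max_idPr u0).
move=> s t s0 st st1.
have ts0 : 0 <= t - s by rewrite subr_ge0 ltW.
have [sr r2] := remainder_moment2 hP C1 fC bC flip mf mb (measurable_flow x) fX ito s0 st st1.
split=> //.
  apply: le_trans r2 _; rewrite ler_wpM2r ?sqr_ge0// lerDl.
  by apply: mulr_ge0 => //; exact: exprn_ge0.
move=> zeta mz fz z1.
apply: le_trans (remainder_mean hP C1 fC bC flip blip mf mb (measurable_flow x) fX ito s0 st st1 mz fz z1) _.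
rewrite ler_wpM2r ?sqrtr_ge0// ler_wpM2r// lerDr.
by apply: mulr_ge0 => //; exact: exprn_ge0.
Qed.

End circle_flow.

Theorem theorem1 (R : realType)
  (P : probability (wiener_space R) R) (hP : wiener_measure P)
  (rho : R) (hrho : 0 < rho)
  (f : R -> R)
  (fsmooth : forall (k : nat) (x : R), derivable (f^`(k)) x 1)
  (fperiodic : forall x : R, f (x + 2 * pi) = f x)
  (fnonconst : ~ exists c : R, forall x : R, f x = c)
  (fzeros : forall x : R, 0 <= x <= 2 * pi -> f x = 0 -> f^`() x != 0)
  (phi : R -> wiener_space R -> R -> R)
  (phi_rds : smooth_circle_rds phi)
  (phi_sde : forall x : R, stratonovich_solution P rho f x (fun t w => phi t w x))
  (mu : probability (measurableTypeR R) R)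
  (hmu : stationary_distribution P phi mu)
  (lambda : R)
  (hlambda : lyapunov_exponent P phi mu lambda) :
  lambda < 0.
Proof.
(* One starting point is fixed for which the limit holds along almost every path. *)
have [x hx] := ae_section hlambda.
have [//|l0] := ltP lambda 0; exfalso.
have T0 : 0 < 2 * pi :> R by rewrite mulr_gt0// pi_gt0.
have df : derivative f f^`(1) := derivative_derive1n fsmooth 0.
have df1 := derivative_derive1n fsmooth 1.
have sf n : smooth n f := smooth_derive1n fsmooth n 0.
have [C [C1 fC f1C f2C [bC flip blip]]] := exists_coefficient_bound fsmooth rho fperiodic.
have [g [g1 [g2 [c0 [[dg dg1 sg pg] [c00 hL]]]]]] :=
  exists_corrector T0 hrho C1 df df1 sf fperiodic fC f1C f2C fnonconst.
have dPhi := circle_flow_step hP fsmooth phi_rds phi_sde C1 fC bC flip blip.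
have K0 : 0 <= 26 * C ^+ 4 + 4 * C ^+ 3.
  by apply: addr_ge0; apply: mulr_ge0 => //; apply: exprn_ge0; exact: le_trans C1.
pose Phi x t w := phi t w x.
have Phi0 y w : Phi y 0 w = y := rds_id phi_rds w y.
have [c c_ge0 Hc] := exists_weight_mean_bound hP df df1 sf fperiodic C1 K0 fC bC dPhi Phi0.
have [s [al [s0 s12 al0 Hs]]] := exists_weight_mean_decay hP df df1 sf fperiodic C1 K0 fC bC dPhi Phi0
  dg dg1 (sg 3) pg c00 hL.
pose D (n : nat) w := (phi n%:R w)^`() x.
have n0 (n : nat) : 0 <= n%:R :> R by exact: ler0n.
have mPsi (n : nat) y : measurable_fun setT (Phi y n%:R) by have [m _ _] := dPhi y; exact: m.
have dD (n : nat) w : is_derive x 1 (fun y => Phi y n%:R w) (D n w).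
  apply: DeriveDef; last by rewrite /D derive1E.
  exact: (@rds_derivable _ _ phi_rds 0%N n%:R w x (n0 n)).
have D0 n : P.-negligible [set w | D n w = 0].
  apply: (derivative_neq0 (mPsi n) (dD n) (expR_ge0 (c * n%:R))) => eta y eta0.
  by apply: Hc => //; rewrite normrN normr1.
(* Off the null set where [D n] vanishes, this is [|D n / 2|] to the power [2 s]. *)
pose G n w := \1_[set w | D n w != 0] w * expR (s * ln (D n w ^+ 2 / 4)).
have hG n : integrable1 P (G n) /\ mean P (G n) <= 3 * (3 * expR (- al * n%:R)).
  have [K K_ge0 HK] := Hs _ (n0 n).
  apply: (derivative_moment (mPsi n) (dD n) s0 s12 _ K_ge0) => [|eta y eta0 eta1].
    by rewrite mulr_gt0// expR_gt0.
  exact: HK.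
(* The 9 is [3 * 3], one factor from [derivative_moment] and one from [exists_weight_mean_decay];
   [expR (-2)] is a lower bound for [4] to the power [- s]. *)
apply: (@markov_contradiction _ _ _ P G al (expR (-2)) 9) => //.
- by move=> n; case: (hG n).
- by move=> n w; rewrite mulr_ge0 ?expR_ge0// indicE.
- by move=> n; have [_ /le_trans] := hG n; apply; rewrite mulrA -natrM.
apply: negligibleS (negligibleU hx (negligible_bigcup D0)) => w /= hw.
apply: contrapT => /not_orP[/contrapT lw Dw]; apply: hw.
have {}Dw n : D n w != 0 by apply/eqP => D0w; apply: Dw; exists n.
have seq : (fun n => n%:R^-1 * ln `|D n w|) @ \oo --> lambda.
  exact: (cvg_comp _ _ (@cvgr_idn R) lw).
(* This rate makes [|D n|^(2 s)] eventually exceed [expR (- al * n / 2)], which is too large for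
   means that decay like [expR (- al * n)]. *)
have small : - (al / (4 * s)) < lambda.
  by apply: lt_le_trans l0; rewrite oppr_lt0 divr_gt0// mulr_gt0.
have gt_small := @cvgr_gt _ _ _ _ _ _ seq _ small.
near=> n.
have n1 : 0 < n%:R :> R by rewrite ltr0n; near: n; exact: nbhs_infty_gt.
have hn : - (al / (4 * s)) < n%:R^-1 * ln `|D n w| by near: n; exact: gt_small.
rewrite /G indicE mem_set /=; last exact: Dw.
rewrite mul1r -expRD ler_expR ln_div ?posrE//; last by rewrite exprn_even_gt0//= Dw.
rewrite -[D n w ^+ 2]real_normK ?num_real// lnXn ?normr_gt0//.
have l4 : s * ln 4 <= 2.
  have : ln 4 < 4 :> R by exact: ln_sublinear.
  have : 0 <= ln 4 :> R by rewrite ln_ge0// ler1n.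
  move=> h1 h2; apply: (@le_trans _ _ (2^-1 * ln 4)); first by rewrite ler_wpM2r.
  by rewrite mulrC ler_pdivrMr// (le_trans (ltW h2))// -natrM.
have : s * (n%:R * - (al / (4 * s))) <= s * ln `|D n w|.
  by rewrite ler_pM2l// -ler_pdivlMl// ltW.
have -> : s * (n%:R * - (al / (4 * s))) = - (al * n%:R / 4) by field; rewrite gt_eqF.
by rewrite -[_ *+ 2]mulr_natl; move: (ln `|_|) (ln 4) l4 => p q; clear; lra.
Unshelve. all: by end_near.
Qed.
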